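(* Let $G$ be a directed graph such that every connected component of $G$ is strongly connected. Then for every derivation $\delta$ on $\mathcal{A}_G$, there exists $T\in\mathfrak{L}_G$ such that $\delta=\delta_T$ and $\|T\|\leq\|\delta\|$.
   Context: A directed graph $G=(\mathcal{V},\mathcal{E},s,r)$ has a vertex set $\mathcal{V}$ and an edge set $\mathcal{E}$ (each of arbitrary cardinality, countable or uncountable; loops and multiple edges allowed) and source and range maps $s,r\colon\mathcal{E}\to\mathcal{V}$; an edge $e$ is an arrow from $s(e)$ to $r(e)$. $\mathbb{F}_G^+$ is the set of all directed paths of finite length: vertices $v$ are paths of length $0$ with $r(v)=s(v)=v$, and a path of length $n\geq1$ is $p=e_1e_2\cdots e_n$ with $s(e_j)=r(e_{j+1})$, $r(p)=r(e_1)$, $s(p)=s(e_n)$; if $s(p_1)=r(p_2)$, the product $p_1p_2$ is the concatenation. Let $\mathcal{H}_G=\ell^2(\mathbb{F}_G^+)$ with orthonormal basis $\{\xi_w\}$. For $e\in\mathcal{E}$, $L_e\xi_w=\xi_{ew}$ if $r(w)=s(e)$ and $0$ otherwise; for $x\in\mathcal{V}$, $L_x\xi_w=\xi_w$ if $r(w)=x$ and $0$ otherwise. $\mathfrak{L}_G$ is the weak-operator closed algebra, and $\mathcal{A}_G$ the norm-closed algebra, generated by $\{L_e,L_x\colon e\in\mathcal{E},x\in\mathcal{V}\}$ in $B(\mathcal{H}_G)$. A derivation on $\mathcal{A}_G$ is a linear map $\delta\colon\mathcal{A}_G\to\mathcal{A}_G$ (not assumed bounded) with $\delta(AB)=\delta(A)B+A\delta(B)$;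 for $T\in\mathfrak{L}_G$, $\delta_T(A)=AT-TA$. $G$ is strongly connected if for any vertices $x,y$ there is a directed path from $x$ to $y$ (a single vertex with no edge is strongly connected). Connected components are those of the underlying undirected graph. *)

(* Defs.v *)
From HB Require Import structures.
From Stdlib Require Import Relations.
From mathcomp Require Import all_boot all_order all_algebra.
From mathcomp Require Import all_classical all_reals all_analysis.
From mathcomp Require Import complex ring.

Set Implicit Arguments.
Unset Strict Implicit.
Unset Printing Implicit Defensive.

Import Order.TTheory GRing.Theory Num.Theory.
Import Normc.

Local Open Scope classical_set_scope.
Local Open Scope ring_scope.
Local Open Scope complex_scope.

(* Every type carries a choiceType structure classically, so this puts no
   restriction on the cardinality of the vertex and edge sets. *)
Record digraph := Digraph {
  vert : choiceType;
  edge : choiceType;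
  src : edge -> vert;
  tgt : edge -> vert }.

Section Paths.
Variable G : digraph.

(* chain x [:: e1; ...; en] says tgt e1 = x and src e_j = tgt e_(j+1). *)
Fixpoint chain (x : vert G) (s : seq (edge G)) : bool :=
  if s is e :: s' then (tgt e == x) && chain (src e) s' else true.

(* The path e1 e2 ... en (which runs from src en to tgt e1) is encoded as
   (tgt e1, [:: e1; ...; en]), and the vertex v as (v, [::]). *)
Record dipath := DiPath {
  path_code :> vert G * seq (edge G);
  path_chain : chain path_code.1 path_code.2 }.

HB.instance Definition _ := [isSub for path_code].
HB.instance Definition _ := [Choice of dipath by <:].

Definition pedges (p : dipath) : seq (edge G) := (path_code p).2.
Definition ptgt (p : dipath) : vert G := (path_code p).1.
Definition psrc (p : dipath) : vert G := last (ptgt p) (map (@src G) (pedges p)).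

Definition behead_code (p : dipath) : vert G * seq (edge G) :=
  if pedges p is e :: s then (src e, s) else path_code p.

Lemma chain_behead (p : dipath) : chain (behead_code p).1 (behead_code p).2.
Proof. by case: p => -[x [//|e s]] /= /andP[]. Qed.

(* The path w when p = e w for an edge e, and p itself when p is a vertex. *)
Definition pbehead (p : dipath) : dipath := DiPath (chain_behead p).

Lemma chain_cons (e : edge G) (w : dipath) (h : ptgt w = src e) :
  chain (tgt e, e :: pedges w).1 (tgt e, e :: pedges w).2.
Proof. by rewrite /= eqxx -h; case: w {h}. Qed.

Definition pcons (e : edge G) (w : dipath) (h : ptgt w = src e) : dipath :=
  DiPath (chain_cons h).

Definition adjacent (x y : vert G) : Prop := exists e, src e = x /\ tgt e = y.

Definition undirected_component (x : vert G) : set (vert G) :=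
  [set y | clos_refl_sym_trans (vert G) adjacent x y].

(* For a connected component C it makes no difference whether the path is
   asked to stay in C, since every path starting in C does. *)
Definition strongly_connected (C : set (vert G)) : Prop :=
  forall x y, C x -> C y -> exists p : dipath, psrc p = x /\ ptgt p = y.

End Paths.

Section SquareSummable.
Variables (R : realType) (X : choiceType).

Definition sqsum (f : X -> R[i]) : \bar R :=
  (\esum_(x in [set: X]) (normc (f x) ^+ 2)%:E)%E.

Definition sqsummable : {pred X -> R[i]} := fun f => `[< (sqsum f < +oo)%E >].

Lemma le_sqsum (f g : X -> R[i]) :
  (forall x, normc (f x) ^+ 2 <= normc (g x) ^+ 2) -> (sqsum f <= sqsum g)%E.
Proof. by move=> fg; apply: le_esum => x _; rewrite lee_fin. Qed.

Lemma sqsum_ge0 (f : X -> R[i]) : (0 <= sqsum f)%E.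
Proof. by apply: esum_ge0 => x _; rewrite lee_fin sqr_ge0. Qed.

Lemma sqsummableP (f : X -> R[i]) :
  reflect (sqsum f < +oo)%E (f \in sqsummable).
Proof. by rewrite unfold_in; exact: asboolP. Qed.

Lemma sqsumZ_le (c : R) (f : X -> R[i]) : 0 <= c ->
  (\esum_(x in [set: X]) (c * normc (f x) ^+ 2)%:E <= c%:E * sqsum f)%E.
Proof.
move=> c0; apply: ge_ereal_sup => _ [A [finA _] <-].
rewrite fsbig_finite//= (eq_bigr (fun x => c%:E * (normc (f x) ^+ 2)%:E)%E)//.
rewrite -ge0_sume_distrr; last by move=> x _; rewrite lee_fin sqr_ge0.
rewrite lee_wpmul2l ?lee_fin// -(@fsbig_finite _ _ _ _ A)//.
by apply: ereal_sup_ubound; exists A.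
Qed.

Lemma sqsummable_submod : submod_closed sqsummable.
Proof.
split.
  apply/sqsummableP; rewrite /sqsum esum1 ?ltry// => x _.
  by rewrite -[X in normc X]/(0 : R[i]) normc0 expr0n.
move=> a f g /sqsummableP ff /sqsummableP gf; apply/sqsummableP.
apply: (@le_lt_trans _ _ (\esum_(x in [set: X])
   ((2 * normc a ^+ 2 * normc (f x) ^+ 2)%:E
    + (2 * normc (g x) ^+ 2)%:E))%E).
  apply: le_esum => x _; rewrite lee_fin.
  have := @le_normcD R (a * f x) (g x); rewrite normcM.
  set u := normc (_ + _); set v := normc a; set w := normc (f x).
  set t := normc (g x) => uvwt.
  have nge0 (z : R[i]) : 0 <= normc z by case: z => p q; exact: sqrtr_ge0.
  have u2 : u ^+ 2 <= (v * w + t) ^+ 2.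
    by rewrite ler_pXn2r// ?nnegrE ?nge0// addr_ge0 ?mulr_ge0// nge0.
  apply: (le_trans u2); rewrite -subr_ge0.
  have -> : 2 * v ^+ 2 * w ^+ 2 + 2 * t ^+ 2 - (v * w + t) ^+ 2
            = (v * w - t) ^+ 2 by ring.
  exact: sqr_ge0.
have c0 : 0 <= 2 * normc a ^+ 2 by rewrite mulr_ge0 ?sqr_ge0.
rewrite esumD; first last.
- by move=> x _; rewrite lee_fin mulr_ge0 ?sqr_ge0.
- by move=> x _; rewrite lee_fin mulr_ge0 ?sqr_ge0.
apply: lte_add_pinfty.
  apply: le_lt_trans (sqsumZ_le f c0) _.
  by rewrite lte_mul_pinfty// ?fin_numE// lee_fin.
apply: le_lt_trans (@sqsumZ_le 2 g _) _ => //.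
by rewrite lte_mul_pinfty// ?fin_numE// lee_fin.
Qed.

HB.instance Definition _ :=
  GRing.isSubmodClosed.Build R[i] (X -> R[i]) sqsummable sqsummable_submod.

Record l2 := L2 { l2_fun :> X -> R[i]; l2_sqsummable : l2_fun \in sqsummable }.

HB.instance Definition _ := [isSub for l2_fun].
HB.instance Definition _ := [Choice of l2 by <:].
HB.instance Definition _ := [SubChoice_isSubLmodule of l2 by <:].

Definition l2norm (f : l2) : R := Num.sqrt (fine (sqsum f)).

(* Sums of absolutely summable families. *)
Definition rsum (f : X -> R) : R :=
  fine (\esum_(x in [set: X]) (EFin \o f)^\+ x
        - \esum_(x in [set: X]) (EFin \o f)^\- x)%E.

Definition csum (f : X -> R[i]) : R[i] :=
  rsum (fun x => complex.Re (f x)) +i* rsum (fun x => complex.Im (f x)).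

Definition l2dot (f g : l2) : R[i] := csum (fun x => f x * conjc (g x)).

Definition delta_fun (x : X) : X -> R[i] := fun y => if y == x then 1 else 0.

Lemma delta_sqsummable (x : X) : delta_fun x \in sqsummable.
Proof.
apply/sqsummableP; rewrite /sqsum.
have -> : (\esum_(y in [set: X]) (normc (delta_fun x y) ^+ 2)%:E =
           \esum_(y in [set x]) 1)%E.
  rewrite [RHS]esum_mkcond; apply: eq_esum => y _; rewrite /delta_fun.
  case: eqVneq => [->|yx]; first by rewrite mem_set// normc1 expr1n.
  by rewrite memNset ?normc0 ?expr0n//; apply/eqP.
by rewrite esum_set1// ltry.
Qed.

Definition xi (x : X) : l2 := L2 (delta_sqsummable x).

End SquareSummable.

Section Operators.
Variables (R : realType) (X : choiceType).
Local Notation H := (l2 R X).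

Definition opnorm (A : H -> H) : \bar R :=
  ereal_sup [set (l2norm (A f))%:E | f in [set f : H | l2norm f <= 1]].

Definition bounded_operator : set (H -> H) :=
  [set A | linear A /\ (opnorm A < +oo)%E].

(* Subalgebras of B(H); they need not contain the identity operator. *)
Definition subalgebra (M : set (H -> H)) : Prop :=
  [/\ M `<=` bounded_operator,
      M 0,
      forall (a : R[i]) A B, M A -> M B -> M (a *: A + B) &
      forall A B, M A -> M B -> M (A \o B)].

Definition norm_closed (M : set (H -> H)) : Prop :=
  forall T, bounded_operator T ->
    (forall eps : R, 0 < eps -> exists2 A, M A & (opnorm (T - A)%R < eps%:E)%E) ->
    M T.

(* The sets of operators A with |<(T - A) f_i, g_i>| < eps for i < n form a
   neighbourhood base of T in the weak operator topology. *)
Definition wot_closed (M : set (H -> H)) : Prop :=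
  forall T, bounded_operator T ->
    (forall (n : nat) (f g : 'I_n -> H) (eps : R), 0 < eps ->
       exists2 A, M A & forall i, normc (l2dot ((T - A) (f i)) (g i)) < eps) ->
    M T.

Definition norm_closed_algebra (S : set (H -> H)) : set (H -> H) :=
  smallest (fun M => subalgebra M /\ norm_closed M) S.

Definition wot_closed_algebra (S : set (H -> H)) : set (H -> H) :=
  smallest (fun M => subalgebra M /\ wot_closed M) S.

(* A map on M is represented by a map on all H -> H of which only the values on
   M matter. *)
Definition derivation (M : set (H -> H)) (d : (H -> H) -> (H -> H)) : Prop :=
  [/\ forall A, M A -> M (d A),
      forall (a : R[i]) A B, M A -> M B -> d (a *: A + B) = a *: d A + d B &
      forall A B, M A -> M B -> d (A \o B) = (d A \o B) + (A \o d B)].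

Definition inner_derivation (T : H -> H) : (H -> H) -> (H -> H) :=
  fun A => (A \o T) - (T \o A).

Definition map_norm (M : set (H -> H)) (d : (H -> H) -> (H -> H)) : \bar R :=
  ereal_sup [set opnorm (d A) | A in [set A | M A /\ (opnorm A <= 1)%E]].

End Operators.

Section GraphAlgebras.
Variables (R : realType) (G : digraph).
Local Notation H := (l2 R (dipath G)).

Definition Ledge_fun (e : edge G) (f : H) : dipath G -> R[i] :=
  fun p => if ohead (pedges p) == Some e then f (pbehead p) else 0.

Definition Lvert_fun (x : vert G) (f : H) : dipath G -> R[i] :=
  fun p => if ptgt p == x then f p else 0.

Lemma pbehead_inj (e : edge G) :
  set_inj [set p : dipath G | ohead (pedges p) == Some e] (@pbehead G).
Proof.
case=> -[x [|e1 s]] hp [[y [|e2 t]] hq] /[!inE]//= /eqP[pe] /eqP[qe].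
move=> /(congr1 (@path_code G)) -[_ st]; apply: val_inj => /=.
by case/andP: hp => /= /eqP<- _; case/andP: hq => /= /eqP<- _; rewrite pe qe st.
Qed.

Lemma sqsum_Ledge (e : edge G) (f : H) :
  (sqsum (Ledge_fun e f) <= sqsum f)%E.
Proof.
set D := [set p : dipath G | ohead (pedges p) == Some e].
have -> : sqsum (Ledge_fun e f) =
    (\esum_(p in D) (normc (f (pbehead p)) ^+ 2)%:E)%E.
  rewrite [RHS]esum_mkcond; apply: eq_esum => p _; rewrite /Ledge_fun.
  case: ifPn => pe; first by rewrite mem_set.
  by rewrite memNset ?normc0 ?expr0n//; apply/negP.
rewrite -(esum_image D (@pbehead G) (fun q => (normc (f q) ^+ 2)%:E));
  last exact: pbehead_inj.
rewrite esum_mkcond; apply: le_esum => q _; case: ifP => // _.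
by rewrite lee_fin sqr_ge0.
Qed.

Lemma sqsum_Lvert (x : vert G) (f : H) :
  (sqsum (Lvert_fun x f) <= sqsum f)%E.
Proof.
apply: le_sqsum => p; rewrite /Lvert_fun; case: ifP => // _.
by rewrite normc0 expr0n sqr_ge0.
Qed.

Lemma Ledge_sqsummable e f : Ledge_fun e f \in @sqsummable R (dipath G).
Proof.
apply/sqsummableP; apply: le_lt_trans (sqsum_Ledge e f) _.
exact/sqsummableP/l2_sqsummable.
Qed.

Lemma Lvert_sqsummable x f : Lvert_fun x f \in @sqsummable R (dipath G).
Proof.
apply/sqsummableP; apply: le_lt_trans (sqsum_Lvert x f) _.
exact/sqsummableP/l2_sqsummable.
Qed.

Definition Ledge (e : edge G) (f : H) : H := L2 (Ledge_sqsummable e f).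

Definition Lvert (x : vert G) (f : H) : H := L2 (Lvert_sqsummable x f).

Lemma Ledge_xi (e : edge G) (w : dipath G) (h : ptgt w = src e) :
  Ledge e (xi R w) = xi R (pcons h).
Proof.
apply: val_inj; apply: funext => -[[x s] hp].
rewrite /= /Ledge_fun /= /delta_fun -![_ == _ :> dipath G]val_eqE /=.
case: s hp => [|e1 s] hp /=; first by rewrite xpair_eqE andbF.
have /andP[/= /eqP ex _] := hp.
rewrite /behead_code /= xpair_eqE eqseq_cons -ex.
case: (eqVneq e1 e) => [->|ne]; last first.
  by rewrite andbF; case: eqP => // -[/eqP]; rewrite (negbTE ne).
case: w h => -[y t] hw /= h; rewrite eqxx.
by rewrite /= /pedges /= xpair_eqE -h !eqxx.
Qed.

Lemma Ledge_xi0 (e : edge G) (w : dipath G) :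
  ptgt w <> src e -> Ledge e (xi R w) = 0.
Proof.
move=> h; apply: val_inj; apply: funext => -[[x s] hp].
rewrite /= /Ledge_fun /delta_fun; case: ifP => //=.
case: s hp => [//|e1 s] hp /= /eqP[e1e].
rewrite /delta_fun; case: ifP => // /eqP we.
by case: h; rewrite -we /ptgt /= /behead_code /= e1e.
Qed.

Lemma Lvert_xi (x : vert G) (w : dipath G) :
  Lvert x (xi R w) = if ptgt w == x then xi R w else 0.
Proof.
apply: val_inj; apply: funext => p; rewrite /= /Lvert_fun.
have [->|pw] := eqVneq p w; first by case: ifP.
have xi0 : xi R w p = 0 by rewrite /= /delta_fun (negbTE pw).
by rewrite xi0 if_same; case: ifP => // _; rewrite xi0.
Qed.

Definition generators : set (H -> H) := range Ledge `|` range Lvert.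

Lemma generators_bounded : generators `<=` @bounded_operator R (dipath G).
Proof.
have ub (A : H -> H) : (forall f, (sqsum (A f) <= sqsum f)%E) ->
    (opnorm A < +oo)%E.
  move=> Af; apply: (@le_lt_trans _ _ 1%E); last exact: ltry.
  apply: ge_ereal_sup => _ [f /= f1 <-]; rewrite lee_fin; apply: le_trans f1.
  have fin (g : H) : sqsum g \is a fin_num.
    rewrite ge0_fin_numE ?sqsum_ge0//.
    exact/sqsummableP/(l2_sqsummable g).
  by apply: ler_wsqrtr; apply: fine_le.
move=> A [[e _ <-]|[x _ <-]]; split.
- move=> a f g; apply: val_inj; apply: funext => p.
  rewrite -[RHS]/(a * Ledge_fun e f p + Ledge_fun e g p) /= /Ledge_fun.
  by case: ifP => //= _; rewrite mulr0 addr0.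
- by apply: ub => f; exact: sqsum_Ledge.
- move=> a f g; apply: val_inj; apply: funext => p.
  rewrite -[RHS]/(a * Lvert_fun x f p + Lvert_fun x g p) /= /Lvert_fun.
  by case: ifP => //= _; rewrite mulr0 addr0.
- by apply: ub => f; exact: sqsum_Lvert.
Qed.

Definition tensor_algebra : set (H -> H) := norm_closed_algebra generators.

Definition free_semigroupoid_algebra : set (H -> H) :=
  wot_closed_algebra generators.

End GraphAlgebras.

Arguments tensor_algebra R G : clear implicits.
Arguments free_semigroupoid_algebra R G : clear implicits.

(* Main.v *)
(* For a path [p] let L_p be the product of the generators along [p]. Every
   operator commuting with all right multiplications is determined by its
   Fourier series \sum_w a_w L_w, and a derivation d of the norm-closed algebra
   is determined by the coefficients b(p, w) of d(L_p) at the paths [w].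

   Automatic continuity: at a vertex on a cycle [c], d followed by the projection
   onto paths shorter than m|c| is bounded on L_c^m A_G, because d(L_c^m Y)
   is there d(L_c^m) Y, and a gliding hump along the powers of [c] shows that
   L_x d is bounded; a second gliding hump over finite sets of vertices shows
   that d is bounded.

   For parallel [p] and [w] the coefficients satisfy
   b(p, w) = a(p^{-1} w) - a(w p^{-1}), a quotient being dropped when it does not
   exist. If there are two distinct loops c, d of the same length at a vertex, set
   a(u) = b(e, eu) for e in {c, d} chosen with eu not ending in e; boundedness
   of b on powers of a loop forces this to work. Otherwise the loops at the vertex
   are the powers of one cycle, b vanishes on them, and a is fixed by
   averaging along the cycle. Strong connectedness transports a from one base
   vertex to its component.

   The averaged identity \sum_k b(p_k, p_k u) = M a(u), taken over paths p_(x, k)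
   that for each [k] are pairwise incomparable as [x] varies, shows that T with
   Fourier coefficients a is compressed from an average of
   L_(p_(x, k))^* d(\sum_x \pm L_(p_(x, k))), whence |T| <= |d|. The operators d(A)
   and AT - TA have the same Fourier coefficients for A = L_p, so they agree on
   the algebra. Finally the Cesaro means of the Fourier series of T are
   averages of compressions of T to blocks, hence uniformly bounded, and they
   converge to T in the weak operator topology. *)
Require Import Defs.
From Stdlib Require Import Relations.
From HB Require Import structures.
From mathcomp Require Import all_boot all_order all_algebra.
From mathcomp Require Import all_classical all_reals all_analysis.
From mathcomp Require Import complex ring lra.

Set Implicit Arguments.
Unset Strict Implicit.
Unset Printing Implicit Defensive.

Import Order.TTheory GRing.Theory Num.Theory.
Import Normc.

Local Open Scope classical_set_scope.
Local Open Scope ring_scope.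
Local Open Scope complex_scope.

(** * Square-summable families and bounded operators *)

(** The implementing operator is unique only up to operators commuting with the algebra, and |T| <=
    |d| fails for a careless choice (for d = 0, any nonzero multiple of the identity). This obstacle
    shapes the proof. At a vertex with two loops of one length, the coefficients of T at nontrivial
    loops are forced and only the value at the vertex is free; it is set to 0. On a single cycle
    every choice of coefficients at loops works, so there the choice must come from an average
    around the cycle.

    The estimate must also survive infinitely many vertices. No finite number M and no single family
    of paths serves all of them, so the averaging is done for finite sets of vertices and loops. M
    depends on these sets, but the resulting bound does not, and a bound tested on finite sets of
    paths is enough to construct T. The signs separate the vertices: d applied to the sum of the
    L_(p_x) mixes different x, and averaging over signs keeps exactly the diagonal terms at no cost
    in the constant. *)

Section FiniteSums.
Variable R : realType.

Lemma normc_ge0 (z : R[i]) : 0 <= normc z.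
Proof. by case: z => a b; exact: sqrtr_ge0. Qed.

Lemma normc_conj (z : R[i]) : normc (conjc z) = normc z.
Proof. by case: z => a b /=; rewrite sqrrN. Qed.

Lemma normc_real (a : R) : normc a%:C = `|a|.
Proof. by rewrite /normc /= expr0n /= addr0 sqrtr_sqr. Qed.

Lemma ler_normc_sum (I : Type) (r : seq I) (F : I -> R[i]) :
  normc (\sum_(i <- r) F i) <= \sum_(i <- r) normc (F i).
Proof.
elim: r => [|i r IH]; first by rewrite !big_nil normc0.
by rewrite !big_cons; apply: le_trans (le_normcD _ _) _; rewrite lerD2l.
Qed.

(** Induction on the sequence: given s^2 <= ab, the new cross term satisfies 2fgs <= a g^2 + b f^2,
    because (a g^2 + b f^2)^2 - 4 f^2 g^2 ab is a square. *)
Lemma CauchySchwarz_seq (I : Type) (r : seq I) (F G : I -> R) :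
  (\sum_(i <- r) F i * G i) ^+ 2
    <= (\sum_(i <- r) F i ^+ 2) * (\sum_(i <- r) G i ^+ 2).
Proof.
elim: r => [|i r IH]; first by rewrite !big_nil expr0n mulr0.
rewrite !big_cons; move: IH.
have : 0 <= \sum_(j <- r) F j ^+ 2 by apply: sumr_ge0 => j _; exact: sqr_ge0.
have : 0 <= \sum_(j <- r) G j ^+ 2 by apply: sumr_ge0 => j _; exact: sqr_ge0.
move: (\sum_(j <- r) F j ^+ 2) (\sum_(j <- r) G j ^+ 2) => a b.
move: (\sum_(j <- r) F j * G j) (F i) (G i) => s f g b0 a0 sab.
suff : 2 * (f * g) * s <= a * g ^+ 2 + b * f ^+ 2.
  by rewrite !expr2 in sab *; nra.
rewrite leNgt; apply/negP => h.
have r0 : 0 <= a * g ^+ 2 + b * f ^+ 2.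
  by apply: addr_ge0; apply: mulr_ge0 => //; exact: sqr_ge0.
have : (a * g ^+ 2 + b * f ^+ 2) ^+ 2 < (2 * (f * g) * s) ^+ 2.
  by rewrite ltr_pXn2r// nnegrE// ltW// (le_lt_trans r0).
apply/negP; rewrite -leNgt.
apply: (@le_trans _ _ (4 * (f ^+ 2 * g ^+ 2) * (a * b))).
  have -> : (2 * (f * g) * s) ^+ 2 = 4 * (f ^+ 2 * g ^+ 2) * s ^+ 2 by ring.
  apply: ler_wpM2l => //; apply: mulr_ge0 => //.
  by apply: mulr_ge0; exact: sqr_ge0.
rewrite -subr_ge0.
have -> : (a * g ^+ 2 + b * f ^+ 2) ^+ 2 - 4 * (f ^+ 2 * g ^+ 2) * (a * b)
  = (a * g ^+ 2 - b * f ^+ 2) ^+ 2 by ring.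
exact: sqr_ge0.
Qed.

Lemma CauchySchwarz_le (I : Type) (r : seq I) (F G : I -> R) (A B : R) :
  0 <= A -> 0 <= B ->
  \sum_(i <- r) F i ^+ 2 <= A ^+ 2 -> \sum_(i <- r) G i ^+ 2 <= B ^+ 2 ->
  \sum_(i <- r) F i * G i <= A * B.
Proof.
move=> A0 B0 FA GB; have := CauchySchwarz_seq r F G => h.
have {}h : (\sum_(i <- r) F i * G i) ^+ 2 <= (A * B) ^+ 2.
  rewrite exprMn; apply: le_trans h _; apply: ler_pM => //;
    by apply: sumr_ge0 => j _; exact: sqr_ge0.
apply: le_trans (ler_norm _) _.
by rewrite -(@ler_pXn2r _ 2)// ?nnegrE ?mulr_ge0// real_normK// num_real.
Qed.

End FiniteSums.

Section L2norm.
Variables (R : realType) (X : choiceType).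
Implicit Types (f g : l2 R X) (J : seq X).

Lemma sum_le_sqsum (h : X -> R[i]) J : uniq J ->
  ((\sum_(x <- J) normc (h x) ^+ 2)%:E <= sqsum h)%E.
Proof.
move=> uJ; apply: esum_ge; exists [set` J] => //.
by rewrite -fsbig_seq// sumEFin.
Qed.

Lemma sqsum_le (h : X -> R[i]) (K : R) :
  (forall J, uniq J -> \sum_(x <- J) normc (h x) ^+ 2 <= K) ->
  (sqsum h <= K%:E)%E.
Proof.
move=> hK; apply: ge_ereal_sup => _ [A [finA _] <-].
by rewrite fsbig_finite//= sumEFin lee_fin; exact: hK.
Qed.

Lemma sqsummable_le (h : X -> R[i]) (K : R) :
  (forall J, uniq J -> \sum_(x <- J) normc (h x) ^+ 2 <= K) ->
  h \in @sqsummable R X.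
Proof.
by move=> /sqsum_le hK; apply/sqsummableP; apply: le_lt_trans hK (ltry _).
Qed.

Lemma l2_fin f : sqsum f \is a fin_num.
Proof.
by rewrite ge0_fin_numE ?sqsum_ge0//; exact/sqsummableP/(l2_sqsummable f).
Qed.

Lemma l2norm_ge0 f : 0 <= l2norm f. Proof. exact: sqrtr_ge0. Qed.

Lemma l2norm_sqr f : l2norm f ^+ 2 = fine (sqsum f).
Proof. by rewrite sqr_sqrtr// fine_ge0// sqsum_ge0. Qed.

Lemma sum_le_l2norm f J : uniq J ->
  \sum_(x <- J) normc (f x) ^+ 2 <= l2norm f ^+ 2.
Proof.
by move=> uJ; rewrite l2norm_sqr -lee_fin fineK ?l2_fin//; exact: sum_le_sqsum.
Qed.

Lemma l2norm_le f (K : R) : 0 <= K ->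
  (forall J, uniq J -> \sum_(x <- J) normc (f x) ^+ 2 <= K ^+ 2) ->
  l2norm f <= K.
Proof.
move=> K0 h; rewrite -(@ler_pXn2r _ 2)// ?nnegrE ?l2norm_ge0//.
by rewrite l2norm_sqr -lee_fin fineK ?l2_fin//; exact: sqsum_le.
Qed.

Lemma normc_le_l2norm f x : normc (f x) <= l2norm f.
Proof.
rewrite -(@ler_pXn2r _ 2)// ?nnegrE ?l2norm_ge0 ?normc_ge0//.
by have := @sum_le_l2norm f [:: x] isT; rewrite big_seq1.
Qed.

Lemma l2P f g : f =1 g -> f = g.
Proof. by move=> fg; apply: val_inj; exact: funext. Qed.

Lemma l2DE f g x : (f + g) x = f x + g x. Proof. by []. Qed.
Lemma l2ZE (a : R[i]) f x : (a *: f) x = a * f x. Proof. by []. Qed.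
Lemma l20E x : (0 : l2 R X) x = 0. Proof. by []. Qed.
Lemma l2BE f g x : (f - g) x = f x - g x. Proof. by []. Qed.

Lemma l2_sumE (I : Type) (r : seq I) (F : I -> l2 R X) x :
  (\sum_(i <- r) F i) x = \sum_(i <- r) F i x.
Proof.
by elim: r => [|i r IH]; rewrite ?big_nil// !big_cons l2DE IH.
Qed.

Lemma l2norm0 : l2norm (0 : l2 R X) = 0.
Proof.
apply/eqP; rewrite eq_le l2norm_ge0 andbT; apply: l2norm_le => // J _.
by rewrite big1 ?expr0n// => x _; rewrite l20E normc0 expr0n.
Qed.

Lemma l2normZ (a : R[i]) f : l2norm (a *: f) <= normc a * l2norm f.
Proof.
apply: l2norm_le => [|J uJ]; first by rewrite mulr_ge0 ?normc_ge0 ?l2norm_ge0.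
rewrite (eq_bigr (fun x => normc a ^+ 2 * normc (f x) ^+ 2)); last first.
  by move=> x _; rewrite l2ZE normcM exprMn.
by rewrite -mulr_sumr exprMn ler_wpM2l ?sqr_ge0// sum_le_l2norm.
Qed.

Lemma l2normN f : l2norm (- f) = l2norm f.
Proof.
congr (Num.sqrt (fine _)); apply: eq_esum => x _.
by rewrite -[(- f) x]/(- f x) normcN.
Qed.

Lemma l2normD f g : l2norm (f + g) <= l2norm f + l2norm g.
Proof.
apply: l2norm_le => [|J uJ]; first by rewrite addr_ge0 ?l2norm_ge0.
apply: (@le_trans _ _ (\sum_(x <- J) (normc (f x) ^+ 2 +
    (2 * (normc (f x) * normc (g x)) + normc (g x) ^+ 2)))).
  apply: ler_sum => x _.
  have -> : normc (f x) ^+ 2 + (2 * (normc (f x) * normc (g x)) + normc (g x) ^+ 2)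
     = (normc (f x) + normc (g x)) ^+ 2 by ring.
  by rewrite ler_pXn2r// ?nnegrE ?addr_ge0 ?normc_ge0// l2DE le_normcD.
rewrite big_split big_split -mulr_sumr /=.
have := sum_le_l2norm f uJ; have := sum_le_l2norm g uJ.
have := @CauchySchwarz_le _ _ J (fun x => normc (f x)) (fun x => normc (g x))
  _ _ (l2norm_ge0 f) (l2norm_ge0 g) (sum_le_l2norm f uJ) (sum_le_l2norm g uJ).
by rewrite !expr2; nra.
Qed.

Lemma l2normB f g : l2norm (f - g) <= l2norm f + l2norm g.
Proof. by rewrite -(l2normN g); exact: l2normD. Qed.

Lemma l2norm_sum (I : Type) (r : seq I) (F : I -> l2 R X) :
  l2norm (\sum_(i <- r) F i) <= \sum_(i <- r) l2norm (F i).
Proof.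
elim: r => [|i r IH]; first by rewrite !big_nil l2norm0.
by rewrite !big_cons; apply: le_trans (l2normD _ _) _; rewrite lerD2l.
Qed.

Lemma l2norm_xi (x : X) : l2norm (xi R x) <= 1.
Proof.
apply: l2norm_le => // J uJ; rewrite expr1n.
have [xJ|xJ] := boolP (x \in J).
  rewrite (bigD1_seq x)//= big1 => [|y yx].
    by rewrite /delta_fun eqxx normc1 expr1n addr0.
  by rewrite /delta_fun (negbTE yx) normc0 expr0n.
rewrite big1_seq// => y /andP[_ yJ]; rewrite /= /delta_fun.
by case: eqP => [yx|]; [rewrite -yx yJ in xJ|rewrite normc0 expr0n].
Qed.

Lemma l2norm_gt f (K : R) : 0 <= K -> K < l2norm f ->
  exists2 J, uniq J & K ^+ 2 < \sum_(x <- J) normc (f x) ^+ 2.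
Proof.
move=> K0 Kf; apply/not_exists2P => h.
move: Kf; apply/negP; rewrite -leNgt; apply: l2norm_le => // J uJ.
by have [|/negP] := h J; [|rewrite -leNgt].
Qed.

(** A finite set carrying more than |f|^2 - e^2 of the squared norm leaves less than e^2 to any set
    disjoint from it. *)
Lemma l2_tail f (e : R) : 0 < e ->
  exists2 J, uniq J & forall J', uniq J' -> (forall x, x \in J -> x \notin J') ->
    \sum_(x <- J') normc (f x) ^+ 2 <= e ^+ 2.
Proof.
move=> e0; have [le|ge] := lerP (l2norm f) e.
  exists [::] => // J' uJ' _; apply: le_trans (sum_le_l2norm f uJ') _.
  by rewrite ler_pXn2r// ?nnegrE ?l2norm_ge0 ?ltW.
have f2 : 0 <= l2norm f ^+ 2 - e ^+ 2.
  by rewrite subr_ge0 ler_pXn2r// ?nnegrE ?l2norm_ge0 ?ltW.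
have [||J uJ hJ] := @l2norm_gt f (Num.sqrt (l2norm f ^+ 2 - e ^+ 2)).
- exact: sqrtr_ge0.
- rewrite -(@ltr_pXn2r _ 2)// ?nnegrE ?l2norm_ge0 ?sqrtr_ge0// sqr_sqrtr//.
  by rewrite ltrBlDr ltrDl exprn_gt0.
exists J => // J' uJ' JJ'; rewrite sqr_sqrtr// in hJ.
have uJJ : uniq (J ++ J').
  rewrite cat_uniq uJ uJ' andbT /=; apply/hasPn => x xJ'.
  by apply/negP => /JJ'; rewrite xJ'.
have := sum_le_l2norm f uJJ; rewrite big_cat /=; lra.
Qed.

(** The zero vector stands in when [h] is not square-summable. Operators can thus be written down
    first, and [toL2_le] supplies summability and norm bound together. *)
Definition toL2 (h : X -> R[i]) : l2 R X := insubd (0 : l2 R X) h.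

Lemma toL2E (h : X -> R[i]) : h \in @sqsummable R X -> toL2 h =1 h.
Proof. by move=> hs x; rewrite -[toL2 h x]/(val (toL2 h) x) val_insubd hs. Qed.

Lemma toL2_le (h : X -> R[i]) (K : R) : 0 <= K ->
  (forall J, uniq J -> \sum_(x <- J) normc (h x) ^+ 2 <= K ^+ 2) ->
  (toL2 h =1 h) /\ l2norm (toL2 h) <= K.
Proof.
move=> K0 hK; have e := toL2E (sqsummable_le hK); split=> //.
apply: l2norm_le => // J uJ.
by rewrite (eq_bigr (fun x => normc (h x) ^+ 2)) ?hK// => x _; rewrite e.
Qed.

End L2norm.

Section Bounds.
Variables (R : realType) (X : choiceType).
Local Notation H := (l2 R X).
Implicit Types (A B : H -> H) (M : set (H -> H)) (k : R).

(** Homogeneous real-valued form of [opnorm A <= k]: for linear [A] and [0 <= k] the two are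
    equivalent by [opnorm_le] and [opnorm_bnd], and constants combine inside [R]. *)
Definition bnd A k := forall f, l2norm (A f) <= k * l2norm f.

Lemma opDE A B f : (A + B) f = A f + B f. Proof. by []. Qed.
Lemma opBE A B f : (A - B) f = A f - B f. Proof. by []. Qed.
Lemma opZE (a : R[i]) A f : (a *: A) f = a *: A f. Proof. by []. Qed.
Lemma op0E f : (0 : H -> H) f = 0. Proof. by []. Qed.

Lemma op_sumE (I : Type) (r : seq I) (F : I -> H -> H) f :
  (\sum_(i <- r) F i) f = \sum_(i <- r) F i f.
Proof.
by elim: r => [|i r IH]; rewrite ?big_nil// !big_cons opDE IH.
Qed.

Lemma linear_add A f g : linear A -> A (f + g) = A f + A g.
Proof. by move=> h; have := h 1 f g; rewrite !scale1r. Qed.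

Lemma linear_zero A : linear A -> A 0 = 0.
Proof.
move=> h; have := linear_add 0 0 h; rewrite addr0 => e.
by apply: (@addrI _ (A 0)); rewrite addr0 -e.
Qed.

Lemma linear_scale A (a : R[i]) f : linear A -> A (a *: f) = a *: A f.
Proof. by move=> h; have := h a f 0; rewrite !addr0 linear_zero// addr0. Qed.

Lemma linear_sub A f g : linear A -> A (f - g) = A f - A g.
Proof. by move=> h; rewrite -scaleN1r linear_add// linear_scale// scaleN1r. Qed.

Lemma linear_comp A B : linear A -> linear B -> linear (A \o B).
Proof. by move=> hA hB a f g /=; rewrite hB hA. Qed.

Lemma linear_comb (a : R[i]) A B : linear A -> linear B -> linear (a *: A + B).
Proof.
move=> hA hB b f g; rewrite !opDE !opZE hA hB !scalerDr !scalerA.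
by rewrite [b * a]mulrC !addrA; congr (_ + _); rewrite addrAC.
Qed.

Lemma linear_opp A : linear A -> linear (- A).
Proof.
move=> hA b f g; rewrite -[LHS]/(- A _) hA -[(- A) f]/(- A f) -[(- A) g]/(- A g).
by rewrite scalerN opprD.
Qed.

Lemma linear_opD A B : linear A -> linear B -> linear (A + B).
Proof. by rewrite -[A in A + B]scale1r; exact: linear_comb. Qed.

Lemma linear_opB A B : linear A -> linear B -> linear (A - B).
Proof. by move=> hA hB; apply: linear_opD => //; exact: linear_opp. Qed.

Lemma linear_op0 : linear (0 : H -> H).
Proof. by move=> a f g; rewrite op0E scaler0 addr0. Qed.

Lemma bnd_comp A B k l : 0 <= k -> bnd A k -> bnd B l -> bnd (A \o B) (k * l).
Proof.
by move=> k0 hA hB f; apply: le_trans (hA _) _; rewrite -mulrA ler_wpM2l.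
Qed.

Lemma bndD A B k l : bnd A k -> bnd B l -> bnd (A + B) (k + l).
Proof.
move=> hA hB f; apply: le_trans (l2normD _ _) _.
by rewrite mulrDl; apply: lerD.
Qed.

Lemma bndN A k : bnd A k -> bnd (- A) k.
Proof. by move=> hA f; rewrite -[(- A) f]/(- A f) l2normN. Qed.

Lemma bndB A B k l : bnd A k -> bnd B l -> bnd (A - B) (k + l).
Proof. by move=> hA hB; apply: bndD => //; exact: bndN. Qed.

Lemma bndZ (a : R[i]) A k : bnd A k -> bnd (a *: A) (normc a * k).
Proof.
move=> hA f; rewrite opZE; apply: le_trans (l2normZ _ _) _.
by rewrite -mulrA ler_wpM2l// normc_ge0.
Qed.

Lemma bnd_le A k l : k <= l -> bnd A k -> bnd A l.
Proof.
by move=> kl hA f; apply: le_trans (hA f) _; rewrite ler_wpM2r// l2norm_ge0.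
Qed.

Lemma bnd0 : bnd 0 0.
Proof. by move=> f; rewrite op0E l2norm0 mul0r. Qed.

Lemma l2norm_eq0 (f : H) : l2norm f = 0 -> f = 0.
Proof.
move=> f0; apply: l2P => x; apply: eq0_normc; apply/eqP.
by rewrite eq_le normc_ge0 andbT -f0 normc_le_l2norm.
Qed.

Lemma opnorm_le A k : 0 <= k -> bnd A k -> (opnorm A <= k%:E)%E.
Proof.
move=> k0 hA; apply: ge_ereal_sup => _ [f /= f1 <-].
by rewrite lee_fin (le_trans (hA f))// ler_piMr.
Qed.

Lemma bnd_unit A k : linear A -> (forall f, l2norm f <= 1 -> l2norm (A f) <= k) ->
  bnd A k.
Proof.
move=> lA h f; have [f0|f0] := eqVneq (l2norm f) 0.
  by rewrite (l2norm_eq0 f0) linear_zero// l2norm0 mulr0.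
have {}f0 : 0 < l2norm f by rewrite lt_def f0 l2norm_ge0.
set a : R[i] := (l2norm f)%:C; set b : R[i] := (l2norm f)^-1%:C.
have ba : a * b = 1 by rewrite -rmorphM mulfV ?gt_eqF.
have -> : f = a *: (b *: f) by rewrite scalerA ba scale1r.
rewrite linear_scale//; apply: le_trans (l2normZ _ _) _.
have na : normc a = l2norm f by rewrite normc_real ger0_norm// ltW.
have -> : a *: (b *: f) = f by rewrite scalerA ba scale1r.
rewrite na [leRHS]mulrC; apply: ler_wpM2l; [exact: ltW|apply: h].
apply: le_trans (l2normZ _ _) _.
have -> : normc b = (l2norm f)^-1.
  by rewrite normc_real ger0_norm// invr_ge0 ltW.
by rewrite mulVf//; apply: lt0r_neq0.
Qed.

Lemma l2norm_pos_scale (e : R) (f : H) : 0 < e -> e * l2norm f <= l2norm (e%:C *: f).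
Proof.
move=> e0; rewrite mulrC -ler_pdivlMr//.
have {1}-> : f = (e^-1)%:C *: (e%:C *: f).
  by rewrite scalerA -rmorphM mulVf ?gt_eqF// scale1r.
apply: le_trans (l2normZ _ _) _.
have e1 : 0 <= e^-1 by rewrite invr_ge0 ltW.
by rewrite normc_real (ger0_norm e1) mulrC.
Qed.

Lemma opnorm_bnd A k : linear A -> (opnorm A <= k%:E)%E -> bnd A k.
Proof.
move=> lA h; apply: bnd_unit => // f f1; rewrite -lee_fin; apply: le_trans h.
by apply: ereal_sup_ubound; exists f.
Qed.

Lemma opnorm_ge0 A : (0 <= opnorm A)%E.
Proof.
apply: (@le_trans _ _ (l2norm (A 0))%:E); first by rewrite lee_fin l2norm_ge0.
by apply: ereal_sup_ubound; exists 0 => //=; rewrite l2norm0.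
Qed.

Lemma bounded_linear A : bounded_operator A -> linear A.
Proof. by case. Qed.

Lemma bounded_bnd A : bounded_operator A -> exists2 k, 0 <= k & bnd A k.
Proof.
case=> lA oA; exists (fine (opnorm A)); first by rewrite fine_ge0 ?opnorm_ge0.
by apply: opnorm_bnd => //; rewrite fineK// ge0_fin_numE ?opnorm_ge0.
Qed.

Lemma bnd_bounded A k : linear A -> bnd A k -> bounded_operator A.
Proof.
move=> lA hA; split=> //; apply: (@le_lt_trans _ _ (`|k|)%:E); last exact: ltry.
by apply: opnorm_le => //; apply: bnd_le hA; exact: ler_norm.
Qed.

(** The boundedness asked for by [norm_closed] is automatic, [A] being within 1 of a bounded
    operator; approximating within e / 2 turns <= into the strict inequality. *)
Lemma norm_closed_bnd M A : norm_closed M -> M `<=` @bounded_operator R X ->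
  linear A -> (forall e, 0 < e -> exists2 B, M B & bnd (A - B) e) -> M A.
Proof.
move=> cM bM lA h.
have [B MB AB] := h 1 ltr01.
have [k k0 Bk] := bounded_bnd (bM _ MB).
have bA : bounded_operator A.
  apply: (@bnd_bounded _ (1 + k)) => //.
  by have := bndD AB Bk; rewrite subrK.
apply: cM => // e e0; have [|C MC AC] := h (e / 2); first by rewrite divr_gt0.
exists C => //; apply: (@le_lt_trans _ _ (e / 2)%:E).
  by apply: opnorm_le => //; rewrite divr_ge0 ?ltW.
by rewrite lte_fin ltr_pdivrMr// mulr_natr mulr2n ltrDl.
Qed.

End Bounds.

(** * Completeness of l2 and limits of operators *)

Section Completeness.
Variables (R : realType).

(** The products e n * (n + 1) stay below e 0, since (n + 2) / 2 <= n + 1; the Archimedean property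
    then suffices. *)
Lemma halving_arbitrarily_small (e : nat -> R) (C : R) (d : R) :
  (forall n, 0 <= e n) -> (forall n, e n.+1 <= e n / 2) -> 0 < d -> 0 <= C ->
  exists n, e n * C <= d.
Proof.
move=> e0 he d0 C0.
have hn n : e n * n.+1%:R <= e 0%N.
  elim: n => [|n IH]; first by rewrite mulr1.
  apply: le_trans IH; apply: (@le_trans _ _ (e n / 2 * n.+2%:R)).
    by rewrite ler_wpM2r// he.
  rewrite -mulrA ler_wpM2l// mulrC ler_pdivrMr// -natrM ler_nat.
  by rewrite muln2 -addnn addSnnS leq_addl.
have [n hN] : exists n : nat, e 0%N * C / d < n.+1%:R.
  exists (Num.truncn (e 0%N * C / d)); exact: truncnS_gt.
exists n; have n0 : 0 < n.+1%:R :> R by rewrite ltr0n.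
rewrite -(ler_pM2r n0) mulrAC; apply: (@le_trans _ _ (e 0%N * C)).
  by rewrite ler_wpM2r.
by rewrite [leRHS]mulrC -ler_pdivrMr// ltW.
Qed.

(** The limit is the supremum of the numbers r n - e n, each r m + e m being an upper bound of all
    of them. *)
Lemma real_cauchy_limit (r e : nat -> R) :
  (forall n m, `|r n - r m| <= e n + e m) ->
  exists l, forall n, `|l - r n| <= e n.
Proof.
move=> h; set S := [set r n - e n | n in [set: nat]].
have ub m : ubound S (r m + e m).
  by move=> _ [n _ <-]; have := le_trans (ler_norm _) (h n m); lra.
have S0 : S !=set0 by exists (r 0%N - e 0%N); exists 0%N.
exists (sup S) => n; rewrite ler_distl; apply/andP; split.
  apply: ub_le_sup; first by exists (r 0%N + e 0%N); exact: ub.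
  by exists n.
exact: ge_sup.
Qed.

Variable X : choiceType.
Local Notation H := (l2 R X).

(** Coordinatewise limits of real and imaginary parts give the candidate. The factor 2 is the sum of
    the geometric series. *)
Lemma l2_geometric_limit (u : nat -> H) (e : nat -> R) :
  (forall n, 0 <= e n) -> (forall n, e n.+1 <= e n / 2) ->
  (forall n, l2norm (u n.+1 - u n) <= e n) ->
  exists v, forall n, l2norm (v - u n) <= 2 * e n.
Proof.
move=> e0 he hu.
(* The subtracted term closes the induction: one more step costs e (n + k), which is at most 2 * e
   (n + k) - 2 * e (n + k + 1). *)
have step n k : l2norm (u (n + k)%N - u n) <= 2 * e n - 2 * e (n + k)%N.
  elim: k => [|k IH]; first by rewrite addn0 !subrr l2norm0.
  have -> : u (n + k.+1)%N - u n = (u (n + k).+1 - u (n + k)%N) + (u (n + k)%N - u n).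
    by rewrite addnS addrA subrK.
  apply: le_trans (l2normD _ _) _.
  have := hu (n + k)%N; have := he (n + k)%N; rewrite addnS; lra.
have cau n m : l2norm (u n - u m) <= 2 * e n + 2 * e m.
  have [nm|/ltnW nm] := leqP n m.
    rewrite -(subnKC nm) -l2normN opprB; apply: le_trans (step _ _) _.
    have := e0 (n + (m - n))%N; lra.
  rewrite -(subnKC nm); apply: le_trans (step _ _) _.
  have := e0 (m + (n - m))%N; lra.
have reP x : exists l : R, forall n, `|l - complex.Re (u n x)| <= 2 * e n.
  apply: real_cauchy_limit => n m; apply: le_trans (cau n m).
  apply: le_trans (normc_le_l2norm _ x); rewrite l2BE.
  case: (u n x) => a b; case: (u m x) => c d /=.
  rewrite -(sqrtr_sqr (a - c)); apply: ler_wsqrtr.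
  by rewrite lerDl sqr_ge0.
have imP x : exists l : R, forall n, `|l - complex.Im (u n x)| <= 2 * e n.
  apply: real_cauchy_limit => n m; apply: le_trans (cau n m).
  apply: le_trans (normc_le_l2norm _ x); rewrite l2BE.
  case: (u n x) => a b; case: (u m x) => c d /=.
  rewrite -(sqrtr_sqr (b - d)); apply: ler_wsqrtr.
  by rewrite lerDr sqr_ge0.
have [re hre] := choice reP; have [im him] := choice imP.
pose v x : R[i] := re x +i* im x.
have vu x n : normc (v x - u n x) <= 4 * e n.
  have -> : v x - u n x = (re x - complex.Re (u n x))%:C
     + 'i%C * (im x - complex.Im (u n x))%:C.
    rewrite /v; case: (u n x) => a b /=; apply/eqP.
    by rewrite eq_complex /=; apply/andP; split; apply/eqP; ring.
  apply: le_trans (le_normcD _ _) _; rewrite normcM !normc_real.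
  have -> : normc ('i%C : R[i]) = 1 by rewrite /= expr0n expr1n add0r sqrtr1.
  have := hre x n; have := him x n; lra.
(* The coordinate bound 4 * e n cannot be summed over [J]. Comparison with u (n + m) leaves 2 * e n
   as main term and an error of order size J * e (n + m), which vanishes for large m. *)
have key n J : uniq J -> \sum_(x <- J) normc (v x - u n x) ^+ 2 <= (2 * e n) ^+ 2.
  move=> uJ; apply/ler_addgt0Pr => d d0.
  pose C := 16 * (size J)%:R * e n + 16 * (size J)%:R * e 0%N + 16 * (size J)%:R.
  have C0 : 0 <= C by rewrite !addr_ge0// !mulr_ge0// ler0n.
  have em0 m : e m <= e 0%N.
    by elim: m => // m IH; have := he m; have := e0 m; lra.
  have e'0 m : 0 <= e (n + m)%N by [].
  have [m hm] : exists m, e (n + m)%N * C <= d.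
    by apply: halving_arbitrarily_small => // m; rewrite addnS; exact: he.
  have unm x : normc ((u (n + m)%N - u n) x) <= 2 * e n.
    apply: le_trans (normc_le_l2norm _ _) _; apply: le_trans (step _ _) _.
    have := e0 (n + m)%N; lra.
  apply: (@le_trans _ _ (\sum_(x <- J) (normc ((u (n + m)%N - u n) x) ^+ 2 +
    (16 * e n * e (n + m)%N + 16 * e 0%N * e (n + m)%N)))).
    apply: ler_sum => x _; have := unm x; have := vu x (n + m)%N.
    have : normc (v x - u n x) <= normc (v x - u (n + m)%N x)
                                  + normc ((u (n + m)%N - u n) x).
      apply: le_trans (le_normcD _ _); rewrite l2BE.
      by rewrite addrA subrK.
    have := em0 (n + m)%N; have := e0 (n + m)%N; have := e0 n.
    have := normc_ge0 (v x - u n x); have := normc_ge0 (v x - u (n + m)%N x).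
    have := normc_ge0 ((u (n + m)%N - u n) x).
    move: (normc _) (normc _) (normc _) (e _) (e _) (e _) => p q r s t w.
    move=> p0 q0 r0 s0 t0 tw rqp qt ps; rewrite !expr2.
    have : p * p <= (q + r) * (q + r) by apply: ler_pM.
    have : q * q <= (4 * t) * (4 * t) by apply: ler_pM.
    have : q * r <= (4 * t) * (2 * w) by apply: ler_pM.
    have : t * t <= s * t by apply: ler_wpM2r.
    lra.
  rewrite big_split /=; apply: lerD.
    apply: le_trans (sum_le_l2norm (u (n + m)%N - u n) uJ) _.
    rewrite ler_pXn2r// ?nnegrE ?l2norm_ge0 ?mulr_ge0//.
    by apply: le_trans (step _ _) _; have := e0 (n + m)%N; lra.
  rewrite big_const_seq count_predT iter_addr_0 -mulr_natl; apply: le_trans hm.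
  rewrite /C; have : 0 <= e (n + m)%N * (16 * (size J)%:R).
    by rewrite mulr_ge0// mulr_ge0// ler0n.
  lra.
have sq : v \in @sqsummable R X.
  have -> : v = (v - u 0%N) + u 0%N by rewrite subrK.
  apply: rpredD; last exact: l2_sqsummable.
  exact: sqsummable_le (key 0%N).
exists (L2 sq) => n; apply: l2norm_le => [|J uJ]; first by rewrite mulr_ge0.
exact: key.
Qed.

Lemma op_geometric_limit (S : nat -> H -> H) (e : nat -> R) :
  (forall n, linear (S n)) ->
  (forall n, 0 <= e n) -> (forall n, e n.+1 <= e n / 2) ->
  (forall n, bnd (S n.+1 - S n) (e n)) ->
  exists2 A, linear A & forall n, bnd (A - S n) (2 * e n).
Proof.
move=> lS e0 he hS.
have hA f : exists v, forall n, l2norm (v - S n f) <= 2 * (e n * l2norm f).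
  apply: l2_geometric_limit => [n|n|n].
  - by rewrite mulr_ge0 ?l2norm_ge0.
  - by rewrite mulrAC ler_wpM2r ?l2norm_ge0.
  - exact: hS.
have [A {}hA] := choice hA.
have hA' n : bnd (A - S n) (2 * e n) by move=> f; rewrite -mulrA; exact: hA.
exists A => // a f g; apply/eqP; rewrite -subr_eq0; apply/eqP.
apply: l2norm_eq0; apply/eqP; rewrite eq_le l2norm_ge0 andbT.
apply/ler_addgt0Pr => d d0; rewrite add0r.
pose C := 2 * l2norm (a *: f + g) + (normc a * (2 * l2norm f) + 2 * l2norm g).
have C0 : 0 <= C.
  by rewrite !addr_ge0// !mulr_ge0 ?mulr_ge0 ?normc_ge0 ?l2norm_ge0.
have [n hn] := halving_arbitrarily_small e0 he d0 C0.
apply: le_trans hn.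
have -> : A (a *: f + g) - (a *: A f + A g) =
   (A - S n) (a *: f + g) - (a *: (A - S n) f + (A - S n) g).
  rewrite !opBE lS scalerBr.
  by rewrite addrACA -opprD opprB addrA subrK.
apply: le_trans (l2normB _ _) _.
apply: (@le_trans _ _ (2 * e n * l2norm (a *: f + g)
    + (normc a * (2 * e n * l2norm f) + 2 * e n * l2norm g))).
  apply: lerD; first exact: hA'.
  apply: le_trans (l2normD _ _) _; apply: lerD; last exact: hA'.
  apply: le_trans (l2normZ _ _) _; rewrite ler_wpM2l ?normc_ge0//.
  exact: hA'.
by rewrite /C le_eqVlt; apply/orP; left; apply/eqP; ring.
Qed.

End Completeness.

(** * Words and routes *)

Section Words.
Variable T : eqType.
Implicit Types s t u v c : seq T.

Lemma prefix_cat_le s t u : (size s <= size t)%N -> prefix s (t ++ u) = prefix s t.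
Proof. by move=> st; rewrite !prefixE takel_cat. Qed.

Lemma prefix_cat2l s t u : prefix (u ++ s) (u ++ t) = prefix s t.
Proof. by elim: u => //= x u ->; rewrite eqxx. Qed.

Lemma suffix_cat_le s t u : (size s <= size t)%N -> suffix s (u ++ t) = suffix s t.
Proof. by move=> st; rewrite /suffix rev_cat prefix_cat_le// !size_rev. Qed.

Lemma suffix_cat2r s t u : suffix (s ++ u) (t ++ u) = suffix s t.
Proof. by rewrite /suffix !rev_cat prefix_cat2l. Qed.

Lemma prefix_size_eq s t : prefix s t -> size s = size t -> s = t.
Proof.
move=> /prefixP[u ->]; rewrite size_cat => /eqP; rewrite -{1}[size s]addn0 eqn_add2l.
by case: u => //; rewrite cats0.
Qed.

Lemma suffix_size_eq s t : suffix s t -> size s = size t -> s = t.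
Proof.
move=> /suffixP[u ->]; rewrite size_cat => /eqP; rewrite -{1}[size s]add0n eqn_add2r.
by case: u.
Qed.

Definition wpow c n := flatten (nseq n c).

Lemma wpowS c n : wpow c n.+1 = c ++ wpow c n. Proof. by []. Qed.

Lemma wpow_comm c w n : c ++ w = w ++ c -> wpow c n ++ w = w ++ wpow c n.
Proof.
move=> cw; elim: n => [|n IH]; first by rewrite cats0.
by rewrite wpowS -catA IH catA cw -catA.
Qed.

Lemma wpowD c m n : wpow c (m + n) = wpow c m ++ wpow c n.
Proof. by elim: m => //= m IH; rewrite addSn !wpowS IH catA. Qed.

Lemma size_wpow c n : size (wpow c n) = (n * size c)%N.
Proof. by rewrite size_flatten /shape map_nseq sumn_nseq mulnC. Qed.

Lemma suffix_pow u c n : suffix c (c ++ u) -> suffix c (c ++ wpow u n).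
Proof.
move=> h; elim: n => [|n IH]; first by rewrite cats0 suffix_refl.
case/suffixP: h => v cu; rewrite wpowS catA cu -catA.
by rewrite suffix_cat_le// size_cat leq_addr.
Qed.

(* A word c such that c is a suffix of cu is a suffix of the left-infinite
   word ...uuu, so it is determined by its length. *)
Lemma suffix_self_unique u c d : u <> [::] -> size c = size d ->
  suffix c (c ++ u) -> suffix d (d ++ u) -> c = d.
Proof.
move=> u0 cd hc hd.
have {}u0 : (0 < size u)%N by case: u u0 hc hd.
have tail e : size e = size c -> suffix e (e ++ u) ->
    e = drop (size (wpow u (size c)) - size c) (wpow u (size c)).
  move=> ec /(@suffix_pow _ _ (size c)); rewrite suffix_cat_le.
    by rewrite suffixE ec => /eqP.
  by rewrite ec size_wpow leq_pmulr.
by rewrite (tail c)// [RHS]tail.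
Qed.

Lemma prefix_self_unique u c d : u <> [::] -> size c = size d ->
  prefix c (u ++ c) -> prefix d (u ++ d) -> c = d.
Proof.
move=> u0 cd hc hd; apply: (can_inj revK).
apply: (@suffix_self_unique (rev u)); rewrite ?size_rev//.
- by move=> /(congr1 rev); rewrite revK.
- by rewrite -rev_cat /suffix !revK.
- by rewrite -rev_cat /suffix !revK.
Qed.

(** Call p good for u when p is not a suffix of p u. Goodness survives lengthening p on the left, so
    finitely many u can be treated one after the other. *)
Lemma good_catl u e p : ~~ suffix p (p ++ u) -> ~~ suffix (e ++ p) ((e ++ p) ++ u).
Proof.
apply: contra => /suffixP[v]; rewrite catA -[LHS]catA => E.
have : suffix p (e ++ (p ++ u)) by apply/suffixP; exists (v ++ e).
by rewrite suffix_cat_le// size_cat leq_addr.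
Qed.

Lemma good_catr u e p : ~~ prefix p (u ++ p) -> ~~ prefix (p ++ e) (u ++ (p ++ e)).
Proof.
apply: contra => /prefixP[v]; rewrite -catA catA => E.
have : prefix p ((u ++ p) ++ e) by apply/prefixP; exists (e ++ v).
by rewrite prefix_cat_le// size_cat leq_addl.
Qed.

Lemma suffix_linear s t w :
  suffix s w -> suffix t w -> (size s <= size t)%N -> suffix s t.
Proof.
by move=> sw /suffixP[v wE] st; move: sw; rewrite wE suffix_cat_le.
Qed.

Lemma prefix_linear s t w :
  prefix s w -> prefix t w -> (size s <= size t)%N -> prefix s t.
Proof.
by move=> sw /prefixP[v wE] st; move: sw; rewrite wE prefix_cat_le.
Qed.

(* The word of length [i] at the end of [...zzz]. *)
Definition wtail z i := drop (size (wpow z i) - i) (wpow z i).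

Lemma size_wtail z i : z <> [::] -> size (wtail z i) = i.
Proof.
move=> z0; rewrite size_drop subKn// size_wpow leq_pmulr//.
by case: z z0.
Qed.

Lemma wtail_nil i : wtail [::] i = [::].
Proof. by apply: size0nil; rewrite size_drop size_wpow muln0. Qed.

Lemma suffix_wtail z i : suffix (wtail z i) (wpow z i).
Proof. exact: suffix_drop. Qed.

Lemma suffix_wtail_le z i k : (i <= k)%N -> suffix (wtail z i) (wpow z k).
Proof.
move=> ik; rewrite -(subnK ik) wpowD.
exact: suffix_catr (suffix_wtail z i).
Qed.

(** The value 1 at the empty word keeps periods positive; the tails of the empty word are all empty,
    so 1 is a period of them. *)
Definition period (z : seq T) := if z is [::] then 1%N else size z.

Lemma period_gt0 z : (0 < period z)%N. Proof. by case: z. Qed.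

Lemma wtail_period z i : wtail z (i + period z) = wtail z i ++ z.
Proof.
have [->|z0] := eqVneq z [::]; first by rewrite !wtail_nil.
have pz : period z = size z by case: z z0.
have zs : (0 < size z)%N by rewrite lt0n size_eq0.
move/eqP in z0; apply: suffix_size_eq; last first.
  by rewrite size_cat !size_wtail// pz.
apply: (@suffix_linear _ _ (wpow z (i + period z))).
- exact: suffix_wtail.
- rewrite pz; have -> : (i + size z = i + (size z).-1 + 1)%N.
    by rewrite -addnA addn1 prednK.
  rewrite wpowD {2}/wpow /= cats0 suffix_cat2r; apply: suffix_wtail_le.
  exact: leq_addr.
- by rewrite size_cat !size_wtail// pz.
Qed.

Section Quotients.
Variable V : nmodType.
Implicit Types phi : seq T -> V.

(* [Lt s t phi] is [phi u] if [t = s ++ u], and 0 if there is no such [u];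
   [Rt t s phi] is the mirror image. *)
Definition Lt s t phi : V := if prefix s t then phi (drop (size s) t) else 0.
Definition Rt t s phi : V :=
  if suffix s t then phi (take (size t - size s) t) else 0.

Lemma Lt_cat s u phi : Lt s (s ++ u) phi = phi u.
Proof. by rewrite /Lt prefix_prefix drop_size_cat. Qed.

Lemma Rt_cat s u phi : Rt (u ++ s) s phi = phi u.
Proof. by rewrite /Rt suffix_suffix size_cat addnK take_size_cat. Qed.

Lemma Lt_cat2l e s t phi : Lt (e ++ s) (e ++ t) phi = Lt s t phi.
Proof. by rewrite /Lt prefix_cat2l size_cat addnC -drop_drop drop_size_cat. Qed.

Lemma Rt_cat2r e s t phi : Rt (t ++ e) (s ++ e) phi = Rt t s phi.
Proof.
rewrite /Rt suffix_cat2r !size_cat subnDr.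
by case: ifP => // /size_suffix st; rewrite takel_cat// leq_subr.
Qed.

Lemma Lt0 s t phi : ~~ prefix s t -> Lt s t phi = 0.
Proof. by rewrite /Lt => /negbTE->. Qed.

Lemma Rt0 s t phi : ~~ suffix s t -> Rt t s phi = 0.
Proof. by rewrite /Rt => /negbTE->. Qed.

Lemma Lt_small s t phi : (size t < size s)%N -> Lt s t phi = 0.
Proof.
by move=> ts; rewrite Lt0//; apply: contraL ts => /size_prefix; rewrite -leqNgt.
Qed.

Lemma Rt_small s t phi : (size t < size s)%N -> Rt t s phi = 0.
Proof.
by move=> ts; rewrite Rt0//; apply: contraL ts => /size_suffix; rewrite -leqNgt.
Qed.

End Quotients.
End Words.

(** * Edge lists as paths between two given vertices *)

Section Routes.
Variable G : digraph.
Implicit Types (x y z : vert G) (s t : seq (edge G)).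

(* The edge list [s] is a path from [y] to [x]. *)
Definition route x s y := chain x s && (last x (map (@src G) s) == y).

Lemma chain_cat x s t :
  chain x (s ++ t) = chain x s && chain (last x (map (@src G) s)) t.
Proof. by elim: s x => //= e s IH x; rewrite IH andbA. Qed.

Lemma route_nil x y : route x [::] y = (x == y).
Proof. by []. Qed.

Lemma route_refl x : route x [::] x.
Proof. by rewrite route_nil. Qed.

Lemma route_cons x e s y : route x (e :: s) y = (tgt e == x) && route (src e) s y.
Proof. by rewrite /route /= -andbA. Qed.

Lemma route_split x s t z : route x (s ++ t) z ->
  exists2 y, route x s y & route y t z.
Proof.
rewrite /route chain_cat map_cat last_cat => /andP[/andP[xs yt] tz].
by exists (last x (map (@src G) s)); apply/andP.
Qed.

Lemma route_cat x s y t z : route x s y -> route y t z -> route x (s ++ t) z.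
Proof.
by rewrite /route chain_cat map_cat last_cat => /andP[-> /eqP->].
Qed.

Lemma route_source x s y y' : route x s y -> route x s y' -> y = y'.
Proof. by move=> /andP[_ /eqP<-] /andP[_ /eqP<-]. Qed.

Definition rtgt y s := if s is e :: _ then tgt e else y.

Lemma route_target x s y : route x s y -> x = rtgt y s.
Proof. by case: s => [|e s] /=; [rewrite route_nil => /eqP|case/andP => /= /andP[/eqP]]. Qed.

Lemma route_catl x s y t z : route x (s ++ t) z -> route x s y -> route y t z.
Proof. by move=> /route_split[y' h1 h2] /(route_source h1) <-. Qed.

Lemma route_catr x s y t z : route x (s ++ t) z -> route y t z -> route x s y.
Proof.
by move=> /route_split[y' h1 /route_target h2] /route_target ->; rewrite -h2.
Qed.

Lemma route_drop x s t z : route x (s ++ t) z -> route (rtgt z t) t z.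
Proof. by move=> /route_split[y _ h]; rewrite -(route_target h). Qed.

Lemma loop_wpow x c n : route x c x -> route x (wpow c n) x.
Proof.
by move=> xc; elim: n => [|n IH]; [exact: route_refl|exact: (route_cat xc)].
Qed.

End Routes.

(** * Derivations on formal coefficients *)

Section Combinatorics.
Variables (R : realType) (G : digraph).
Variables (b : vert G -> seq (edge G) -> seq (edge G) -> R[i]) (D : R).
Hypothesis bD : forall x y z s1 s2 t, route x s1 y -> route y s2 z ->
  route x t z -> b x (s1 ++ s2) t = Rt t s2 (b x s1) + Lt s1 t (b y s2).
Hypothesis bB : forall x z s J, route x s z -> uniq J ->
  (forall t, t \in J -> route x t z) ->
  \sum_(t <- J) normc (b x s t) ^+ 2 <= D.

Lemma sqr_bounded_eq0 (z : R) (K : R) : 0 <= z ->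
  (forall n : nat, n.+1%:R * z ^+ 2 <= K) -> z = 0.
Proof.
move=> z0 h; apply/eqP; rewrite eq_le z0 andbT leNgt; apply/negP => {}z0.
have z2 : 0 < z ^+ 2 by rewrite exprn_gt0.
have := h (Num.truncn (K / z ^+ 2)); rewrite -ler_pdivlMr//.
by rewrite leNgt truncnS_gt.
Qed.

(** By the Leibniz rule the coefficient of c^(n+1) at c^n w is (n + 1) b(c, w), and a single
    coefficient is bounded independently of n. *)
Lemma coef_commuting x c w : route x c x -> route x w x -> c ++ w = w ++ c ->
  b x c w = 0.
Proof.
move=> xc xw cw; apply: eq0_normc.
have bn n : b x (wpow c n.+1) (wpow c n ++ w) = n.+1%:R * b x c w.
  elim: n => [|n IH]; first by rewrite wpowS /= cats0 mul1r.
  have lw : route x (wpow c n.+1 ++ w) x by apply: route_cat xw; exact: loop_wpow.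
  rewrite wpowS (bD xc (loop_wpow n.+1 xc) lw) wpow_comm// Rt_cat -wpow_comm//.
  by rewrite [in X in Lt _ X]wpowS -catA Lt_cat IH -[in RHS]natr1 mulrDl mul1r addrC.
apply: (@sqr_bounded_eq0 _ D) => [|n]; first exact: normc_ge0.
have := @bB x x (wpow c n.+1) [:: wpow c n ++ w] (loop_wpow _ xc) isT.
rewrite big_seq1 bn normcM.
have -> : normc (n.+1%:R : R[i]) = n.+1%:R.
  by rewrite -[X in normc X](rmorph_nat (real_complex R)) normc_real ger0_norm.
rewrite exprMn => h; apply: le_trans (h _).
  by rewrite ler_wpM2r ?sqr_ge0// expr2 ler_peMr// ler1n.
by move=> t; rewrite inE => /eqP->; apply: route_cat xw; exact: loop_wpow.
Qed.

(** Split off the first edge e of s. The right quotient by the rest survives only if t equals the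
    rest; then e is a loop and b(e, [::]) = 0 by [coef_commuting]. The left quotient is covered by
    induction. *)
Lemma coef_short x y s t : route x s y -> route x t y -> (size t < size s)%N ->
  b x s t = 0.
Proof.
elim: s x t => // e s IH x t.
move=> xs; have /andP[/eqP ex es] : (tgt e == x) && route (src e) s y.
  by rewrite -route_cons.
move=> xt ts; have xe : route x [:: e] (src e) by rewrite route_cons ex eqxx route_refl.
rewrite -cat1s (bD xe es xt).
have [tE|ne] := eqVneq t s; last first.
  rewrite Rt0; last first.
    apply/negP => /suffixP[[|e' v] tE]; first by rewrite tE eqxx in ne.
    by rewrite tE /= size_cat ltnS ltnNge leq_addl in ts.
  rewrite add0r /Lt; case: ifP => // /prefixP[v tE].
  rewrite tE drop_size_cat//; apply: IH => //; last by rewrite tE /= ltnS in ts.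
  by rewrite tE in xt; exact: route_catl xt xe.
subst t; rewrite -{1}[s]cat0s Rt_cat.
have -> : b x [:: e] [::] = 0.
  have := @route_catr _ x [::] (src e) s y xt es; rewrite route_nil => /eqP xe'.
  by apply: coef_commuting; rewrite ?cats0 ?route_refl// {2}xe'.
rewrite add0r /Lt; case: ifP => // /prefixP[v tE].
rewrite [in X in b _ _ X]tE drop_size_cat//; apply: IH => //.
  by rewrite tE in xt; exact: route_catl xt xe.
by rewrite [in ltnRHS]tE /= ltnS.
Qed.

(** The n + 1 words c^k w c^(n-k) are distinct, as c is not a prefix of w, and at each of them the
    coefficient of c^(n+1) is b(c, w): every other Leibniz term would need c as a prefix or a suffix
    of w. So (n + 1) |b(c, w)|^2 <= D. *)
Lemma coef_unrelated x c w : route x c x -> route x w x ->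
  (size c <= size w)%N -> ~~ prefix c w -> ~~ suffix c w -> b x c w = 0.
Proof.
move=> xc xw cw pcw scw; apply: eq0_normc.
pose q n k := wpow c k ++ w ++ wpow c (n - k).
have xq n k : route x (q n k) x.
  by apply: route_cat (loop_wpow k xc) _; apply: route_cat xw _; exact: loop_wpow.
have bq n k : (k <= n)%N -> b x (wpow c n.+1) (q n k) = b x c w.
  move=> kn; rewrite -{1}(subnKC kn) -addnS wpowD.
  rewrite (bD (loop_wpow k xc) (loop_wpow _ xc) (xq n k)) /q Lt_cat.
  rewrite wpowS [X in Rt X]catA Rt_cat2r Rt0; last by rewrite suffix_cat_le.
  rewrite add0r (bD xc (loop_wpow _ xc)); last by apply: route_cat xw _; exact: loop_wpow.
  by rewrite Rt_cat Lt0 ?addr0// prefix_cat_le.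
have q_inj n k l : (k < l)%N -> q n k <> q n l.
  move=> kl; rewrite /q -{1}(subnKC (ltnW kl)) wpowD -catA => /eqP.
  rewrite eqseq_cat// eqxx /= => /eqP E; have : prefix c (w ++ wpow c (n - k)).
    by rewrite E -(prednK (n := l - k)) ?subn_gt0// wpowS -catA prefix_prefix.
  by rewrite prefix_cat_le// (negbTE pcw).
apply: (@sqr_bounded_eq0 _ D) => [|n]; first exact: normc_ge0.
pose J := [seq q n k | k <- iota 0 n.+1].
have uJ : uniq J.
  rewrite map_inj_in_uniq ?iota_uniq// => k l _ _ E.
  by case: (ltngtP k l) => // /(q_inj n); rewrite E.
apply: le_trans (@bB x x (wpow c n.+1) J (loop_wpow _ xc) uJ _); last first.
  by move=> t /mapP[k _ ->]; exact: xq.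
rewrite big_map (eq_big_seq (fun _ => normc (b x c w) ^+ 2)); last first.
  by move=> k; rewrite mem_iota add0n ltnS => /andP[_ kn]; rewrite bq.
by rewrite big_const_seq count_predT size_iota iter_addr_0 mulr_natl.
Qed.

(* Expand the coefficient of the path [e'ee'e] at [e'eue'e], which vanishes. *)
Lemma coef_good_opp x e e' u : route x e x -> route x e' x -> route x u x ->
  ~~ suffix e (e ++ u) -> ~~ prefix e' (u ++ e') ->
  b x e' (u ++ e') = - b x e (e ++ u).
Proof.
move=> xe xe' xu ge ge'; pose c := e' ++ e.
have xc : route x c x by exact: route_cat xe.
have cu : b x c (c ++ u) = b x e (e ++ u).
  rewrite (bD xe' xe); last exact: route_cat xu.
  rewrite /c -catA Lt_cat Rt0 ?add0r// suffix_cat_le//.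
  by rewrite size_cat leq_addr.
have uc : b x c (u ++ c) = b x e' (u ++ e').
  rewrite (bD xe' xe); last exact: route_cat xc.
  rewrite /c catA Rt_cat Lt0 ?addr0// prefix_cat_le//.
  by rewrite size_cat leq_addl.
have xcu : route x (c ++ u) x by exact: route_cat xu.
have := @coef_unrelated x (c ++ c) ((c ++ u) ++ c).
rewrite (bD xc xc); last exact: route_cat xc.
rewrite Rt_cat -catA Lt_cat cu uc => h; apply/eqP; rewrite -addr_eq0 addrC.
apply/eqP; apply: h.
- exact: (route_cat xc xc).
- exact: (route_cat xc (route_cat xu xc)).
- by rewrite !size_cat leq_add2l leq_addl.
- by rewrite prefix_cat2l good_catr.
- by rewrite catA suffix_cat2r good_catl.
Qed.

Definition implements_loops x (a : seq (edge G) -> R[i]) :=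
  forall p w, route x p x -> route x w x -> b x p w = Lt p w a - Rt w p a.

(** Without such a pair any two loops at x commute ([rigid_comm]); this is the dividing line between
    the two normalisations. *)
Definition flexible (x : vert G) := exists c d, [/\ route x c x, route x d x,
  size c = size d & c <> d].

Lemma flexible_implemented x : flexible x ->
  exists2 a, implements_loops x a & a [::] = 0.
Proof.
move=> [c [d [xc xd cd ncd]]].
(* By [suffix_self_unique] at most one of c, d is a suffix of itself followed by u, so a good choice
   always exists; [pr] is the mirror image. *)
pose pl u := if suffix c (c ++ u) then d else c.
pose pr u := if prefix c (u ++ c) then d else c.
have xpl u : route x (pl u) x by rewrite /pl; case: ifP.
have xpr u : route x (pr u) x by rewrite /pr; case: ifP.
have gpl u : u <> [::] -> ~~ suffix (pl u) (pl u ++ u).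
  move=> u0; rewrite /pl; case: ifPn => // sc; apply/negP => sd.
  exact/ncd/(suffix_self_unique u0).
have gpr u : u <> [::] -> ~~ prefix (pr u) (u ++ pr u).
  move=> u0; rewrite /pr; case: ifPn => // sc; apply/negP => sd.
  exact/ncd/(prefix_self_unique u0).
pose a u := if u is [::] then 0 else b x (pl u) (pl u ++ u).
have aE u : u <> [::] -> a u = b x (pl u) (pl u ++ u) by case: u.
have ar u : u <> [::] -> route x u x -> b x (pr u) (u ++ pr u) = - a u.
  by move=> u0 xu; rewrite aE//; apply: coef_good_opp => //; [exact: gpl|exact: gpr].
exists a => // p w xp xw.
have [wp|pw] := ltnP (size w) (size p).
  by rewrite (coef_short xp xw)// Lt_small// Rt_small// subrr.
have [->|nwp] := eqVneq w p.
  rewrite coef_commuting//; have := Lt_cat p [::] a; rewrite cats0 => ->.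
  by have := Rt_cat p [::] a; rewrite cat0s => ->; rewrite subrr.
(* Pad by [e] on the left and by [d'] on the right so that e p d' is neither a prefix nor a suffix
   of e w d' and [coef_unrelated] applies. Expanding the vanishing coefficient leaves a(w p^-1) from
   [e], the wanted b(p, w), and -a(p^-1 w) from [d'] by [coef_good_opp]. *)
have [e [xe se eR]] : exists e, [/\ route x e x, ~~ suffix (e ++ p) (e ++ w) &
    Rt (e ++ w) p (b x e) = Rt w p a].
  have [/suffixP[v wE]|sw] := boolP (suffix p w); last first.
    by exists [::]; rewrite !cat0s; split; rewrite ?Rt0//; exact: route_refl.
  have v0 : v <> [::] by move=> v0; rewrite wE v0 cat0s eqxx in nwp.
  exists (pl v); split => //.
    by rewrite wE catA suffix_cat2r; exact: gpl.
  by rewrite wE catA !Rt_cat aE.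
have [d' [xd' pd' dL]] : exists d', [/\ route x d' x, ~~ prefix (p ++ d') (w ++ d') &
    Lt p (w ++ d') (b x d') = - Lt p w a].
  have [/prefixP[u wE]|sw] := boolP (prefix p w); last first.
    by exists [::]; rewrite !cats0; split; rewrite ?Lt0 ?oppr0//; exact: route_refl.
  have u0 : u <> [::] by move=> u0; rewrite wE u0 cats0 eqxx in nwp.
  exists (pr u); split => //.
    by rewrite wE -catA prefix_cat2l; exact: gpr.
  rewrite wE -catA !Lt_cat ar//.
  by rewrite wE in xw; exact: route_catl xw xp.
have h := @coef_unrelated x (e ++ (p ++ d')) (e ++ (w ++ d')).
have xpd := route_cat xp xd'; have xwd := route_cat xw xd'.
have {}h : b x (e ++ (p ++ d')) (e ++ (w ++ d')) = 0.
  apply: h.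
  - exact: route_cat xe _.
  - exact: route_cat xe _.
  - by rewrite !size_cat leq_add2l leq_add2r.
  - by rewrite prefix_cat2l.
  - by rewrite !catA suffix_cat2r.
move: h; rewrite (bD xe xpd); last exact: route_cat xe _.
rewrite Lt_cat catA Rt_cat2r eR (bD xp xd')// Rt_cat dL => h.
by apply/eqP; rewrite -subr_eq0 opprB addrC -addrA [- _ + _]addrC h.
Qed.

(** The loops c d and d c have equal length, so they would witness flexibility if they differed. *)
Lemma rigid_comm x c d : ~ flexible x -> route x c x -> route x d x ->
  c ++ d = d ++ c.
Proof.
move=> nf xc xd; apply: contrapT => ne; apply: nf.
exists (c ++ d), (d ++ c); split => //; [exact: route_cat xd|exact: route_cat xc|].
by rewrite !size_cat addnC.
Qed.

Lemma rigid_prefix x c d : ~ flexible x -> route x c x -> route x d x ->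
  (size c <= size d)%N -> exists2 u, d = c ++ u & d = u ++ c.
Proof.
move=> nf xc xd cd; have E := rigid_comm nf xc xd.
have : prefix c (d ++ c) by rewrite -E prefix_prefix.
rewrite prefix_cat_le// => /prefixP[u dE]; exists u => //.
by move: E; rewrite {1 2}dE -catA => /eqP; rewrite eqseq_cat// eqxx => /eqP; rewrite dE.
Qed.

(** Both sides vanish: all loops commute, so b is 0 on loops and the left and right quotients of w
    by p coincide, whatever [a] is. *)
Lemma rigid_implemented x a : ~ flexible x -> implements_loops x a.
Proof.
move=> nf p w xp xw; rewrite coef_commuting//; last exact: rigid_comm nf _ _.
have [wp|pw] := ltnP (size w) (size p); first by rewrite Lt_small// Rt_small// subrr.
have [u E1 E2] := rigid_prefix nf xp xw pw.
by rewrite {1}E1 Lt_cat E2 Rt_cat subrr.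
Qed.

Variables (base : vert G -> vert G) (g h : vert G -> seq (edge G)).
Hypothesis base_eq : forall x s y, route x s y -> base x = base y.
Hypothesis g_route : forall y, route (base y) (g y) y.
Hypothesis h_route : forall y, route y (h y) (base y).
Variable a0 : vert G -> seq (edge G) -> R[i].
Hypothesis a0P : forall x, implements_loops x (a0 x).

(** The value forced at y: it solves the implementing identity for the pair g y, g y ++ v, given the
    coefficients at the base vertex. *)
Definition extension y v :=
  b (base y) (g y) (g y ++ v) + Rt (g y ++ v) (g y) (a0 (base y)).

(** Solving along the return path h y instead gives the same value, because g y ++ h y is a loop at
    the base, where [a0] already implements b. *)
Lemma extensionE y v : route y v y ->
  extension y v = Lt (h y) (v ++ h y) (a0 (base y)) - b y (h y) (v ++ h y).
Proof.
move=> yv; have yg := g_route y; have yh := h_route y.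
have xgh := route_cat yg yh; have yvh := route_cat yv yh.
have := a0P xgh (route_cat yg yvh).
rewrite (bD yg yh (route_cat yg yvh)) !Lt_cat2l Lt_cat catA !Rt_cat2r Rt_cat.
rewrite /extension; move: (b _ _ _) (b _ _ _) (Lt _ _ _) (Rt _ _ _) => p q l r E.
have -> : q = (q + p) - p by ring.
by rewrite E; ring.
Qed.

(** Completing p and w by g x on the left and h y on the right gives loops at the base. The Leibniz
    terms of g x are absorbed by the definition of [extension x], those of h y by [extensionE] at
    y. *)
Lemma extension_implements x y p w : route x p y -> route x w y ->
  b x p w = Lt p w (extension y) - Rt w p (extension x).
Proof.
move=> xp xw; have [wp|pw] := ltnP (size w) (size p).
  by rewrite (coef_short xp xw)// Lt_small// Rt_small// subrr.
have xy := base_eq xp; have xg := g_route x; have yh := h_route y.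
rewrite -xy in yh.
have ph := route_cat xp yh; have wh := route_cat xw yh.
have := a0P (route_cat xg ph) (route_cat xg wh).
rewrite (bD xg ph (route_cat xg wh)) !Lt_cat2l Lt_cat (bD xp yh wh) Rt_cat !catA !Rt_cat2r.
have LE : Lt p w (extension y) = Lt (p ++ h y) (w ++ h y) (a0 (base x))
                                  - Lt p (w ++ h y) (b y (h y)).
  have [/prefixP[u wE]|npw] := boolP (prefix p w); last first.
    have n1 : ~~ prefix p (w ++ h y) by rewrite prefix_cat_le.
    by rewrite !Lt0 ?subrr//; apply: contra n1; exact: catl_prefix.
  have yu : route y u y by rewrite wE in xw; exact: route_catl xw xp.
  by rewrite wE -!catA Lt_cat2l !Lt_cat extensionE// xy.
have RE : Rt w p (extension x) = Rt (g x ++ w) (g x ++ p) (a0 (base x))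
                                  + Rt (g x ++ w) p (b (base x) (g x)).
  have [/suffixP[v wE]|nsw] := boolP (suffix p w); last first.
    have n1 : ~~ suffix p (g x ++ w) by rewrite suffix_cat_le.
    by rewrite !Rt0 ?addr0//; apply: contra n1; exact: catl_suffix.
  by rewrite wE !catA Rt_cat2r !Rt_cat /extension addrC.
rewrite LE RE; move: (Rt _ _ _) (Rt _ _ _) (Lt _ _ _) (Lt _ _ _) (b x p w).
move=> r1 r2 l1 l2 c E.
have -> : c = (r2 + (c + l2)) - r2 - l2 by ring.
by rewrite E; ring.
Qed.

Lemma route_wtail (x : vert G) z i : route x z x -> route (rtgt x (wtail z i)) (wtail z i) x.
Proof.
move=> xz; have := loop_wpow i xz; case/suffixP: (suffix_wtail z i) => s ->.
exact: route_drop.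
Qed.

Definition wtail_coef x z i u := b (rtgt x (wtail z i)) (wtail z i) (wtail z i ++ u).

(* The two normalisations of the coefficients at a base vertex. In the rigid
   case the loops at [x] are the powers of a single cycle and every [a] works;
   this choice makes the sum of the coefficients around the cycle vanish. *)
Definition normalised x z (a : seq (edge G) -> R[i]) :=
  (flexible x /\ a [::] = 0) \/
  [/\ ~ flexible x, route x z x,
      z = [::] -> forall c, route x c x -> c = [::] &
      forall u, route x u x ->
        (period z)%:R * a u = \sum_(i < period z) wtail_coef x z i u].

(** Lengthening the tail by z adds the coefficient b(z, z u), which vanishes because z and z u
    commute. *)
Lemma wtail_coef_period x z i u : ~ flexible x -> route x z x -> route x u x ->
  wtail_coef x z (i + period z) u = wtail_coef x z i u.
Proof.
move=> nf xz xu; rewrite /wtail_coef wtail_period.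
have yz := route_wtail i xz; have yzz := route_cat yz xz.
rewrite -(route_target yzz).
have zu := rigid_comm nf xz xu; have xzu := route_cat xz xu.
rewrite -catA (bD yz xz (route_cat yz xzu)) Lt_cat.
rewrite [b x z _]coef_commuting//; last by rewrite -catA -zu.
by rewrite addr0 zu catA Rt_cat.
Qed.

Lemma periodic_sum_shift (V : zmodType) (F : nat -> V) (n j : nat) :
  (forall i, F (i + n)%N = F i) -> \sum_(k < n) F (j + k)%N = \sum_(k < n) F k.
Proof.
move=> Fn; elim: j => [|j <-]; first by apply: eq_bigr.
apply: (@addrI _ (F j)).
have -> : F j + \sum_(k < n) F (j.+1 + k)%N = \sum_(k < n.+1) F (j + k)%N.
  by rewrite big_ord_recl /= addn0; congr (_ + _); apply: eq_bigr => k _; rewrite /= addSnnS.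
by rewrite big_ord_recr /= Fn addrC.
Qed.

Lemma periodic_sum (V : zmodType) (F : nat -> V) (n m j : nat) :
  (forall i, F (i + n)%N = F i) ->
  \sum_(k < m * n) F (j + k)%N = (\sum_(k < n) F k) *+ m.
Proof.
move=> Fn; elim: m j => [|m IH] j; first by rewrite big_ord0.
rewrite mulSn big_split_ord /= periodic_sum_shift// mulrS; congr (_ + _).
by rewrite -(IH (j + n)%N); apply: eq_bigr => k _; rewrite addnA.
Qed.

(** The loop t ++ s commutes with powers of z, so s and the tail of the same length are suffixes of
    one word: a path issued from a rigid vertex is determined by its length. *)
Lemma rigid_tail x y z s t : ~ flexible x -> route x z x ->
  (z = [::] -> forall c, route x c x -> c = [::]) ->
  route y s x -> route x t y -> s = wtail z (size s).
Proof.
move=> nf xz z0 ys xt; have xts := route_cat xt ys.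
have [zE|zn] := eqVneq z [::].
  by rewrite zE wtail_nil; have := z0 zE _ xts; case: t {xt xts} => //= ->.
have zn' : z <> [::] by apply/eqP.
apply: suffix_size_eq; last by rewrite size_wtail.
apply: (@suffix_linear _ _ _ ((t ++ s) ++ wpow z (size s))).
- rewrite (rigid_comm nf xts (loop_wpow _ xz)) catA; exact: suffix_suffix.
- apply: suffix_catr; exact: suffix_wtail.
- by rewrite size_wtail.
Qed.

(** The words c^i d c^(N-i) have one length and are distinct, hence pairwise incomparable as
    prefixes; one is available for each vertex of a finite set. *)
Lemma flexible_words x N : flexible x -> exists wd : nat -> seq (edge G),
  [/\ forall i, route x (wd i) x,
      forall i j, (i <= N)%N -> (j <= N)%N -> size (wd i) = size (wd j) &
      forall i j, (i <= N)%N -> (j <= N)%N -> wd i = wd j -> i = j].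
Proof.
move=> [c [d [xc xd cd ncd]]].
exists (fun i => wpow c i ++ d ++ wpow c (N - i)); split.
- move=> i; apply: route_cat (loop_wpow _ xc) _.
  by apply: route_cat xd _; exact: loop_wpow.
- move=> i j iN jN; rewrite !size_cat !size_wpow -cd ![(size c + _)%N]addnC !addnA.
  by rewrite -!mulnDl !subnKC.
- have main i j : (i < j)%N ->
      wpow c i ++ d ++ wpow c (N - i) <> wpow c j ++ d ++ wpow c (N - j).
    move=> ij; rewrite -(subnKC (ltnW ij)) wpowD -!catA => /eqP.
    rewrite eqseq_cat// eqxx /= -(prednK (n := j - i)) ?subn_gt0// wpowS -!catA.
    by rewrite eqseq_cat// => /andP[/eqP dc _]; exact/ncd.
  by move=> i j _ _ E; case: (ltngtP i j) => // /main; rewrite E.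
Qed.

(** Prepend c or d once for each u in the list: at most one of the two fails for u, and [good_catl]
    preserves what was achieved before. *)
Lemma flexible_good x p (L : seq (seq (edge G))) : flexible x ->
  exists2 q, route x q x &
    forall u, u \in L -> u <> [::] -> ~~ suffix (q ++ p) ((q ++ p) ++ u).
Proof.
move=> [c [d [xc xd cd ncd]]]; elim: L => [|u L [q xq IH]].
  by exists [::] => //; exact: route_refl.
have [->|/eqP u0] := eqVneq u [::].
  by exists q => // v; rewrite inE => /predU1P[->//|]; exact: IH.
pose e := if suffix (c ++ q ++ p) ((c ++ q ++ p) ++ u) then d else c.
have xe : route x e x by rewrite /e; case: ifP.
exists (e ++ q); first exact: route_cat xq.
move=> v; rewrite inE -catA => /predU1P[-> _|vL v0]; last exact/good_catl/IH.
rewrite /e; case: ifPn => // sc; apply/negP => sd; apply: ncd.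
have : c ++ q ++ p = d ++ q ++ p.
  by apply: (suffix_self_unique u0) => //; rewrite !size_cat cd.
by move/eqP; rewrite eqseq_cat// => /andP[/eqP].
Qed.

Lemma paths_from_flexible x (L : seq (seq (edge G))) : flexible (base x) ->
  exists q, route (base x) q x /\
    forall u, u \in L -> u <> [::] -> ~~ suffix q (q ++ u).
Proof.
move=> fx; have [q xq hq] := flexible_good (g x) L fx.
by exists (q ++ g x); split => //; exact: route_cat (g_route x).
Qed.

Lemma base_idem x : base (base x) = base x.
Proof. exact: base_eq (g_route x). Qed.

(** Needed for the empty loop in [averaging]: there no path is good, and the unwanted term is the
    value at the vertex itself. *)
Lemma extension_base_nil x : a0 (base x) [::] = 0 -> extension (base x) [::] = 0.
Proof.
move=> a00; rewrite /extension base_idem cats0.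
have xg := g_route (base x); rewrite base_idem in xg.
rewrite coef_commuting// add0r.
by have := Rt_cat (g (base x)) [::] (a0 (base x)); rewrite cat0s => ->.
Qed.

(* The family (p_(x,k)) with p_(x,k) h_x the tail of length |h_x| + k of
   ...zzz, and the resulting telescoping of the coefficients. *)
Lemma rigid_rotation x z k : ~ flexible (base x) -> route (base x) z (base x) ->
  (z = [::] -> forall c, route (base x) c (base x) -> c = [::]) ->
  exists y p, [/\ route y p x, size p = if z is [::] then 0%N else k &
    forall u, route x u x -> exists2 u', route (base x) u' (base x) &
      u ++ h x = h x ++ u' /\
      b y p (p ++ u) = wtail_coef (base x) z (size (h x) + k) u'
                       - wtail_coef (base x) z (size (h x)) u'].
Proof.
move=> nf xz z0; set x0 := base x in nf xz z0 *.
have xh := h_route x; have xg := g_route x; rewrite -/x0 in xh xg.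
have hE := rigid_tail nf xz z0 xh xg; set j := size (h x) in hE *.
set s := wtail z (j + k); set y := rtgt x0 s.
have ys : route y s x0 by exact: route_wtail.
have ss : size s = if z is [::] then 0%N else (j + k)%N.
  by rewrite /s; case: (z) => [|e z']; [rewrite wtail_nil|rewrite size_wtail].
have js : (j <= size s)%N.
  rewrite ss; move: hE; case: (z) => [|e z' _]; last exact: leq_addr.
  by rewrite wtail_nil /j => ->.
have /suffixP[p sE] : suffix (h x) s.
  rewrite hE; apply: (@suffix_linear _ _ _ (wpow z (j + k))).
  - by apply: suffix_wtail_le; exact: leq_addr.
  - exact: suffix_wtail.
  - by rewrite -hE.
rewrite sE in ys; have yp := route_catr ys xh.
exists y, p; split=> //.
  have : (size p + j)%N = size s by rewrite sE size_cat.
  rewrite ss; move: hE; case: (z) => [|e z'] hE /eqP.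
    by rewrite addn_eq0 => /andP[/eqP].
  by rewrite [(j + k)%N]addnC eqn_add2r => /eqP.
move=> u xu.
(* The loops g h and g u h at the base commute, which forces u h = h u': the loop u is transported
   along h to a loop u' at the base. *)
have xgh := route_cat xg xh; have xuh := route_cat xu xh.
have := rigid_comm nf xgh (route_cat xg xuh).
rewrite -!catA => /eqP; rewrite eqseq_cat// eqxx /= => /eqP E.
have /prefixP[u' uE] : prefix (h x) (u ++ h x).
  apply: (@prefix_linear _ _ _ (h x ++ g x ++ u ++ h x)).
  - exact: prefix_prefix.
  - by rewrite E catA prefix_prefix.
  - by rewrite size_cat leq_addl.
have xu' : route x0 u' x0 by rewrite uE in xuh; exact: route_catl xuh xh.
exists u' => //; split => //.
rewrite {1}/wtail_coef -/s -/y.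
have phu : p ++ u ++ h x = s ++ u' by rewrite uE catA -sE.
have ysu := route_cat yp xuh.
rewrite -phu [in b y s _]sE (bD yp xh ysu) Lt_cat catA Rt_cat uE.
rewrite /wtail_coef -hE -(route_target xh) addrK//.
Qed.

Variable z : vert G -> seq (edge G).
Hypothesis zP : forall x, normalised x (z x) (a0 x).

Lemma choice_on (A B : Type) (b0 : A -> B) (P : A -> Prop) (Q : A -> B -> Prop) :
  (forall x, P x -> exists y, Q x y) -> exists f, forall x, P x -> Q x (f x).
Proof.
move=> PQ; have [x|f fP] := @choice A B (fun x y => P x -> Q x y); last by exists f.
by case: (pselect (P x)) => [/PQ[y Qy]|nP]; [exists y|exists (b0 x)].
Qed.

(** Over a flexible base one path good for all relevant u serves for every k: the second term of the
    implementing identity drops out and each summand already equals the extension. Over a rigid base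
    the paths of [rigid_rotation] turn around the cycle, and the sum over complete turns is
    evaluated by the normalisation. *)
Lemma averaging (F : seq (vert G)) (U : seq (vert G * seq (edge G))) :
  exists (M : nat) (pi : nat -> vert G -> vert G * seq (edge G)), [/\ (0 < M)%N,
    forall k x, x \in F -> route (pi k x).1 (pi k x).2 x,
    forall k x y, x \in F -> y \in F -> x <> y -> (pi k x).1 = (pi k y).1 ->
      ~~ prefix (pi k x).2 (pi k y).2 &
    forall x u, (x, u) \in U -> x \in F -> route x u x ->
      \sum_(k < M) b (pi k x).1 (pi k x).2 ((pi k x).2 ++ u)
        = M%:R * extension x u].
Proof.
have [wd wdP] := choice_on (fun=> fun=> [::]) (fun x => @flexible_words x (size F)).
pose L x := [seq w.2 | w <- U & w.1 == x].
have [q qP] := choice_on (fun=> [::]) (fun x => @paths_from_flexible x (L x)).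
have [rho rhoP] : exists rho, forall k x, x \in F -> ~ flexible (base x) ->
    [/\ route (rho k x).1 (rho k x).2 x,
      size (rho k x).2 = if z (base x) is [::] then 0%N else k &
      forall u, route x u x -> exists2 u', route (base x) u' (base x) &
      u ++ h x = h x ++ u' /\
      b (rho k x).1 (rho k x).2 ((rho k x).2 ++ u)
        = wtail_coef (base x) (z (base x)) (size (h x) + k) u'
          - wtail_coef (base x) (z (base x)) (size (h x)) u'].
  have := @choice_on (nat * vert G) (vert G * seq (edge G)) (fun kx => (kx.2, [::]))
    (fun kx => ~ flexible (base kx.2)) (fun kx r => [/\ route r.1 r.2 kx.2,
      size r.2 = if z (base kx.2) is [::] then 0%N else kx.1 &
      forall u, route kx.2 u kx.2 -> exists2 u', route (base kx.2) u' (base kx.2) &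
      u ++ h kx.2 = h kx.2 ++ u' /\
      b r.1 r.2 (r.2 ++ u)
        = wtail_coef (base kx.2) (z (base kx.2)) (size (h kx.2) + kx.1) u'
          - wtail_coef (base kx.2) (z (base kx.2)) (size (h kx.2)) u']).
  case=> [[k x] /= nf|f fP]; last by exists (fun k x => f (k, x)) => k x _ nf; exact: (fP (k, x)).
  have [[]//|[_ xz z0 _]] := zP (base x).
  by have [y [p [h1 h2 h3]]] := rigid_rotation k nf xz z0; exists (y, p).
(* A common multiple of the periods, so that k makes complete turns at every rigid base. *)
exists (\prod_(x <- F) period (z (base x)))%N.
exists (fun k x => if `[< flexible (base x) >]
  then (base x, wd (base x) (index x F) ++ q x) else rho k x).
split.
- by rewrite big_seq; apply: prodn_cond_gt0 => x _; exact: period_gt0.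
- move=> k x xF; case: asboolP => [fx|nfx]; last by have [] := rhoP k x xF nfx.
  have [h1 _ _] := wdP _ fx; have [h2 _] := qP _ fx.
  exact: route_cat h2.
- move=> k x y xF yF xy E.
  have bxy : base x = base y.
    have tb v : v \in F -> base (if `[< flexible (base v) >]
      then (base v, wd (base v) (index v F) ++ q v) else rho k v).1 = base v.
      move=> vF; case: asboolP => [fv|nfv] /=; first exact: base_idem.
      by have [/base_eq ->] := rhoP k v vF nfv.
    by rewrite -(tb x)// E tb.
  move: E; rewrite bxy; case: asboolP => [fy|nfy] /= E.
    (* The initial loops [wd] have one length and differ, so they decide incomparability whatever
       follows them. *)
    have [_ hs hi] := wdP _ fy.
    have ixF : (index x F <= size F)%N by exact: index_size.
    have iyF : (index y F <= size F)%N by exact: index_size.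
    apply/negP => /catl_prefix; rewrite prefix_cat_le; last by rewrite (hs _ (index y F)).
    move=> /prefix_size_eq /(_ (hs _ _ ixF iyF)) /(hi _ _ ixF iyF) ixy.
    by apply: xy; rewrite -(nth_index x xF) ixy nth_index.
  (* The two paths have one length and one target; if one were a prefix of the other they would be
     equal, and so would their sources. *)
  rewrite -bxy in nfy; have [rx sx _] := rhoP k x xF nfy.
  rewrite bxy in nfy; have [ry sy _] := rhoP k y yF nfy.
  apply/negP => /prefix_size_eq; rewrite sx sy bxy => /(_ erefl) sxy.
  by apply: xy; apply: (route_source rx); rewrite E sxy.
move=> x u xuU xF xu; case: asboolP => [fx|nfx] /=.
  rewrite sumr_const card_ord mulr_natl; congr (_ *+ _).
  have [h1 _ _] := wdP _ fx; have [h2 hg] := qP _ fx.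
  have [[_ a00]|[]//] := zP (base x).
  set p := wd _ _ ++ _; have xp : route (base x) p x by exact: route_cat h2.
  rewrite (extension_implements xp (route_cat xp xu)) Lt_cat.
  have [->|/eqP u0] := eqVneq u [::].
    have := Rt_cat p [::] (extension (base x)); rewrite cat0s cats0 => ->.
    by rewrite extension_base_nil// subr0.
  rewrite Rt0 ?subr0//; apply: good_catl; apply: hg => //.
  by apply/mapP; exists (x, u) => //; rewrite mem_filter eqxx.
have [[]//|[_ xz z0 za]] := zP (base x).
have [_ _ /(_ _ xu)[u' xu' [uE _]]] := rhoP 0%N x xF nfx.
have hx := h_route x.
have coefE k : b (rho k x).1 (rho k x).2 ((rho k x).2 ++ u)
    = wtail_coef (base x) (z (base x)) (size (h x) + k) u'
      - wtail_coef (base x) (z (base x)) (size (h x)) u'.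
  have [_ _ /(_ _ xu)[u'' xu'' [uE' ->]]] := rhoP k x xF nfx.
  by move: uE'; rewrite uE => /eqP; rewrite eqseq_cat// eqxx => /eqP ->.
under eq_bigr do rewrite coefE.
rewrite sumrB sumr_const card_ord mulr_natl.
set n := period (z (base x)).
have /dvdnP[m ->] : (n %| \prod_(x <- F) period (z (base x)))%N.
  by rewrite (big_rem x)//= dvdn_mulr.
rewrite (@periodic_sum _ (fun i => wtail_coef (base x) (z (base x)) i u')); last first.
  by move=> i; rewrite wtail_coef_period.
rewrite -za// -/n mulr_natl -mulrnA mulnC -mulrnBl; congr (_ *+ _).
have hE := rigid_tail nfx xz z0 hx (g_route x).
rewrite extensionE// uE Lt_cat /wtail_coef -hE -(route_target hx) -uE.
by rewrite uE.
Qed.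

End Combinatorics.

Theorem formal_derivation_inner (R : realType) (G : digraph)
  (b : vert G -> seq (edge G) -> seq (edge G) -> R[i]) (D : R) :
  (forall x y z s1 s2 t, route x s1 y -> route y s2 z -> route x t z ->
    b x (s1 ++ s2) t = Rt t s2 (b x s1) + Lt s1 t (b y s2)) ->
  (forall x z s J, route x s z -> uniq J -> (forall t, t \in J -> route x t z) ->
    \sum_(t <- J) normc (b x s t) ^+ 2 <= D) ->
  (forall (x y : vert G) s, route x s y -> exists t, route y t x) ->
  exists a : vert G -> seq (edge G) -> R[i],
    (forall x y p w, route x p y -> route x w y ->
      b x p w = Lt p w (a y) - Rt w p (a x)) /\
    forall (F : seq (vert G)) (U : seq (vert G * seq (edge G))),
      exists (M : nat) (pi : nat -> vert G -> vert G * seq (edge G)), [/\ (0 < M)%N,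
        forall k x, x \in F -> route (pi k x).1 (pi k x).2 x,
        forall k x y, x \in F -> y \in F -> x <> y -> (pi k x).1 = (pi k y).1 ->
          ~~ prefix (pi k x).2 (pi k y).2 &
        forall x u, (x, u) \in U -> x \in F -> route x u x ->
          \sum_(k < M) b (pi k x).1 (pi k x).2 ((pi k x).2 ++ u)
            = M%:R * a x u].
Proof.
move=> bD bB back.
pose E (x y : vert G) := `[< exists s, route x s y >].
have Ex x : E x x by apply/asboolP; exists [::]; exact: route_refl.
(* Vertices of one component reach the same vertices, and [choose] depends only on that set, so they
   share a representative. *)
pose base x := choose (E x) x.
have baseP x : exists s, route x s (base x).
  by apply/asboolP; exact: (chooseP (Ex x)).
have base_eq (x : vert G) s y : route x s y -> base x = base y.
  move=> xy; have [t yx] := back _ _ _ xy.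
  have Exy : E x =1 E y.
    move=> v; apply/asboolP/asboolP => -[r rv].
      by exists (t ++ r); exact: route_cat yx rv.
    by exists (s ++ r); exact: route_cat xy rv.
  rewrite /base (eq_choose Exy); apply: choose_id; rewrite -?Exy//.
  by apply/asboolP; exists s.
have [h hP] := choice baseP.
have [g gP] : exists g : vert G -> seq (edge G), forall y, route (base y) (g y) y.
  by have [g gP] := choice (fun y => back _ _ _ (hP y)); exists g.
have az x : exists az, implements_loops b x az.1 /\ normalised b x az.2 az.1.
  have [fx|nfx] := pselect (flexible x).
    have [a aP a0] := flexible_implemented bD bB fx.
    by exists (a, [::]); split => //; left.
  have [z [xz z0]] : exists z, route x z x /\
      (z = [::] -> forall c, route x c x -> c = [::]).
    (* Any nonempty loop serves as z; it may be a proper power of another loop. *)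
    have [[z [xz z0]]|nz] := pselect (exists z, route x z x /\ z <> [::]).
      by exists z; split => // /z0.
    exists [::]; split => [|_ c xc]; first exact: route_refl.
    by apply: contrapT => c0; apply: nz; exists c.
  (* Every coefficient function implements b on loops at a rigid vertex, so the normalisation can be
     made the definition. *)
  exists (fun u => (period z)%:R^-1 * \sum_(i < period z) wtail_coef b x z i u, z).
  split; first exact: (rigid_implemented bD bB).
  right; split => // u xu /=; rewrite mulrA mulfV ?mul1r// pnatr_eq0.
  by rewrite -lt0n period_gt0.
have [f fP] := choice az.
have a0P x : implements_loops b x (f x).1 by have [] := fP x.
have zP x : normalised b x (f x).2 (f x).1 by have [] := fP x.
exists (extension b base g (fun x => (f x).1)); split.
  by move=> x y p w xp xw; exact: (extension_implements bD bB base_eq gP hP a0P).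
move=> F U.
exact: (averaging bD bB base_eq gP hP a0P zP F U).
Qed.

(** Weighted composition operators: path operators, their adjoints, right multiplications,
    coordinate projections and signed sums of path operators are all of this form, and are
    contractions once |c| <= 1 and tau is injective on the support of c. *)
HB.lock Definition wop (R : realType) (X : choiceType) (c : X -> R[i])
  (tau : X -> X) (f : l2 R X) : l2 R X := toL2 (fun p => c p * f (tau p)).

Section WeightedShifts.
Variables (R : realType) (X : choiceType).
Local Notation H := (l2 R X).

Variables (c : X -> R[i]) (tau : X -> X).
Hypothesis c1 : forall p, normc (c p) <= 1.
Hypothesis tau_inj : forall p q, c p != 0 -> c q != 0 -> tau p = tau q -> p = q.

Lemma wop_sum (f : H) (J : seq X) : uniq J ->
  \sum_(p <- J) normc (c p * f (tau p)) ^+ 2 <= l2norm f ^+ 2.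
Proof.
move=> uJ; pose J' := [seq tau p | p <- J & c p != 0].
have uJ' : uniq J'.
  rewrite map_inj_in_uniq ?filter_uniq// => p q.
  by rewrite !mem_filter => /andP[cp _] /andP[cq _]; exact: tau_inj.
apply: le_trans (sum_le_l2norm f uJ'); rewrite big_map big_filter big_mkcond /=.
rewrite [leRHS]big_mkcond /=; apply: ler_sum => p _.
case: eqVneq => [->|_] /=; first by rewrite mul0r normc0 expr0n.
rewrite normcM exprMn ler_piMl ?sqr_ge0// -[leRHS](expr1n _ 2).
by rewrite ler_pXn2r// nnegrE ?normc_ge0.
Qed.

Lemma wopE f p : wop c tau f p = c p * f (tau p).
Proof. by rewrite wop.unlock; have [-> _] := toL2_le (l2norm_ge0 f) (@wop_sum f). Qed.

Lemma wop_contraction f : l2norm (wop c tau f) <= l2norm f.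
Proof. by rewrite wop.unlock; have [_] := toL2_le (l2norm_ge0 f) (@wop_sum f). Qed.

Lemma wop_bnd : bnd (wop c tau) 1.
Proof. by move=> f; rewrite mul1r wop_contraction. Qed.

Lemma wop_linear : linear (wop c tau).
Proof.
move=> a f g; apply: l2P => p.
by rewrite l2DE l2ZE !wopE l2DE l2ZE mulrDr mulrCA.
Qed.

End WeightedShifts.

Lemma normc_indicator (R : realType) (b : bool) : normc (b%:R : R[i]) <= 1.
Proof. by case: b; rewrite ?normc1 ?normc0. Qed.

Lemma indicator_neq0 (R : realType) (b : bool) : (b%:R : R[i]) != 0 -> b.
Proof. by case: b; rewrite ?eqxx. Qed.

(** * Factorisation of directed paths *)

Section DirectedPaths.
Variable G : digraph.
Implicit Types (x y z : vert G) (s t : seq (edge G)) (p q w : dipath G).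

Definition vpath x : dipath G := @DiPath G (x, [::]) isT.

(* The path with target [x] and edge list [s]; the junk value is [vpath x]. *)
Definition mkp x s : dipath G := insubd (vpath x) (x, s).

Lemma mkp_code x s : chain x s -> path_code (mkp x s) = (x, s).
Proof. by move=> h; rewrite /mkp -[path_code _]/(val _) val_insubd h. Qed.

Lemma ptgt_mkp x s : ptgt (mkp x s) = x.
Proof. by rewrite /ptgt -[path_code _]/(val _) val_insubd; case: ifP. Qed.

Lemma pedges_mkp x s : chain x s -> pedges (mkp x s) = s.
Proof. by move=> h; rewrite /pedges mkp_code. Qed.

Lemma route_chain x s y : route x s y -> chain x s.
Proof. by case/andP. Qed.

Lemma psrc_mkp x s y : route x s y -> psrc (mkp x s) = y.
Proof.
move=> h; rewrite /psrc ptgt_mkp pedges_mkp; last exact: route_chain h.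
by case/andP: h => _ /eqP.
Qed.

Lemma path_ext p q : ptgt p = ptgt q -> pedges p = pedges q -> p = q.
Proof.
case: p q => -[x s] hp [[y t] hq]; rewrite /ptgt /pedges /= => xy st.
by apply: val_inj; rewrite /= xy st.
Qed.

Lemma route_path p : route (ptgt p) (pedges p) (psrc p).
Proof. by case: p => -[x s] hp; rewrite /route /psrc /= eqxx andbT. Qed.

Lemma mkpK p : mkp (ptgt p) (pedges p) = p.
Proof.
apply: path_ext; first exact: ptgt_mkp.
by apply: pedges_mkp; exact: route_chain (route_path p).
Qed.

Lemma psrc_vpath x : psrc (vpath x) = x. Proof. by []. Qed.
Lemma ptgt_vpath x : ptgt (vpath x) = x. Proof. by []. Qed.
Lemma pedges_vpath x : pedges (vpath x) = [::]. Proof. by []. Qed.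

Lemma mkp_nil x : mkp x [::] = vpath x.
Proof. by apply: path_ext; rewrite ?ptgt_mkp ?pedges_mkp. Qed.

Definition psize p := size (pedges p).

(** Edges are listed from the target end, so p is the product of its left factor [ptake i p] and its
    right factor [pdrop i p]. *)
Definition ptake i p := mkp (ptgt p) (take i (pedges p)).
Definition pdrop i p :=
  mkp (last (ptgt p) (map (@src G) (take i (pedges p)))) (drop i (pedges p)).

Lemma route_take_drop i p :
  route (ptgt p) (take i (pedges p)) (ptgt (pdrop i p)) /\
  route (ptgt (pdrop i p)) (drop i (pedges p)) (psrc p).
Proof.
have := route_path p; rewrite -{1}(cat_take_drop i (pedges p)) /pdrop ptgt_mkp.
by case/route_split => y /andP[h1 /eqP h2]; rewrite h2 => h3; split=> //; apply/andP; rewrite h2.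
Qed.

Lemma ptgt_ptake i p : ptgt (ptake i p) = ptgt p.
Proof. exact: ptgt_mkp. Qed.

Lemma pedges_ptake i p : pedges (ptake i p) = take i (pedges p).
Proof. by have [h _] := route_take_drop i p; rewrite pedges_mkp// (route_chain h). Qed.

Lemma psrc_ptake i p : psrc (ptake i p) = ptgt (pdrop i p).
Proof. by have [h _] := route_take_drop i p; exact: psrc_mkp. Qed.

Lemma pedges_pdrop i p : pedges (pdrop i p) = drop i (pedges p).
Proof.
have [_ h] := route_take_drop i p; rewrite pedges_mkp//.
by have := route_chain h; rewrite /pdrop ptgt_mkp.
Qed.

Lemma psrc_pdrop i p : psrc (pdrop i p) = psrc p.
Proof.
have [_ h] := route_take_drop i p.
have := route_path (pdrop i p); rewrite pedges_pdrop => h'.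
exact: route_source h' h.
Qed.

Lemma pdrop0 p : pdrop 0 p = p.
Proof. by rewrite /pdrop take0 drop0 mkpK. Qed.

Lemma ptake0 p : ptake 0 p = vpath (ptgt p).
Proof. by rewrite /ptake take0 mkp_nil. Qed.

Lemma ptake_size p : ptake (psize p) p = p.
Proof. by rewrite /ptake take_size mkpK. Qed.

Lemma path_suffix p q : suffix (pedges q) (pedges p) -> psrc p = psrc q ->
  pdrop (psize p - psize q) p = q.
Proof.
move=> /suffixP[v E] s; apply: path_ext; last first.
  by rewrite pedges_pdrop /psize E size_cat addnK drop_size_cat.
have [_ h] := route_take_drop (psize p - psize q) p.
have dE : drop (psize p - psize q) (pedges p) = pedges q.
  by rewrite /psize E size_cat addnK drop_size_cat.
rewrite dE s in h; rewrite (route_target h).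
exact/esym/route_target/route_path.
Qed.

Lemma pbehead_edges p : pedges (pbehead p) = behead (pedges p).
Proof. by case: p => -[x [|e s]] hp. Qed.

Lemma pbehead_tgt p e s : pedges p = e :: s -> ptgt (pbehead p) = src e.
Proof.
case: p => -[x [|e' s']] hp //= E; change (src e' = src e); congr src.
by case: E.
Qed.

Lemma pbehead_src p : psrc (pbehead p) = psrc p.
Proof. by case: p => -[x [|e s]] hp. Qed.

Lemma ptgt_cons p e s : pedges p = e :: s -> ptgt p = tgt e.
Proof. by move=> pE; have := route_path p; rewrite pE => /route_target. Qed.

End DirectedPaths.

(** * Path operators and Fourier coefficients *)

Section PathOperators.
Variables (R : realType) (G : digraph).
Local Notation H := (l2 R (dipath G)).
Implicit Types (x y z : vert G) (s t : seq (edge G)) (p q w : dipath G) (f : H).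

(** The test on targets matters only when p is a vertex, whose empty edge list is a prefix of every
    list. *)
Definition starts p q := prefix (pedges p) (pedges q) && (ptgt q == ptgt p).

Definition pstrip p q := mkp (psrc p) (drop (psize p) (pedges q)).

Lemma starts_route p q : starts p q ->
  route (psrc p) (drop (psize p) (pedges q)) (psrc q).
Proof.
case/andP => /prefixP[v E] /eqP pq; have := route_path q.
rewrite pq /psize E drop_size_cat// => h; exact: route_catl h (route_path p).
Qed.

Lemma pedges_pstrip p q : starts p q -> pedges q = pedges p ++ pedges (pstrip p q).
Proof.
move=> h; rewrite pedges_mkp; last exact: route_chain (starts_route h).
by case/andP: h => /prefixP[v E] _; rewrite /psize E drop_size_cat.
Qed.

Definition Lp p : H -> H := wop (fun q => (starts p q)%:R) (pstrip p).

Lemma pstrip_inj p q q' : (starts p q)%:R != 0 :> R[i] ->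
  (starts p q')%:R != 0 :> R[i] -> pstrip p q = pstrip p q' -> q = q'.
Proof.
move=> /indicator_neq0 h /indicator_neq0 h' E; apply: path_ext.
  by case/andP: h => _ /eqP ->; case/andP: h' => _ /eqP ->.
by rewrite (pedges_pstrip h) (pedges_pstrip h') E.
Qed.

Lemma LpE p f q : Lp p f q = if starts p q then f (pstrip p q) else 0.
Proof.
rewrite /Lp wopE; [|by move=> ?; exact: normc_indicator|exact: pstrip_inj].
by case: starts; rewrite ?mul1r ?mul0r.
Qed.

Lemma Lp_linear p : linear (Lp p).
Proof. by apply: wop_linear => [q|]; [exact: normc_indicator|exact: pstrip_inj]. Qed.

Lemma Lp_bnd p : bnd (Lp p) 1.
Proof. by apply: wop_bnd => [q|]; [exact: normc_indicator|exact: pstrip_inj]. Qed.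

Lemma Lp_vpath x : Lp (vpath x) = @Lvert R G x.
Proof.
apply: funext => f; apply: l2P => q.
rewrite LpE /starts ptgt_vpath pedges_vpath prefix0s /= /Lvert_fun.
by case: eqP => // <-; rewrite /pstrip psrc_vpath drop0 mkpK.
Qed.

Lemma LpD x s y t z : route x s y -> route y t z ->
  Lp (mkp x (s ++ t)) = Lp (mkp x s) \o Lp (mkp y t).
Proof.
move=> xs yt; apply: funext => f; apply: l2P => q.
have xst := route_cat xs yt; rewrite [RHS]LpE LpE.
have cs := route_chain xs; have ct := route_chain yt; have cst := route_chain xst.
rewrite {1 2}/starts !ptgt_mkp !pedges_mkp//.
have [qx|_] := eqVneq (ptgt q) x; last by rewrite !andbF.
rewrite !andbT; have [/prefixP[v E]|n] := boolP (prefix s (pedges q)); last first.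
  by rewrite ifN//; apply: contra n; exact: catl_prefix.
have dE : drop (psize (mkp x s)) (pedges q) = v.
  by rewrite /psize pedges_mkp// E drop_size_cat.
have yv : route y v (psrc q).
  by have := route_path q; rewrite qx E => h; exact: route_catl h xs.
rewrite LpE /starts /pstrip dE (psrc_mkp xs) !ptgt_mkp eqxx andbT.
rewrite (psrc_mkp xst) (psrc_mkp yt) !pedges_mkp ?(route_chain yv)// E prefix_cat2l.
by rewrite /psize !pedges_mkp// size_cat addnC -drop_drop drop_size_cat.
Qed.

Lemma Lp_cons e s y : route (src e) s y ->
  Lp (mkp (tgt e) (e :: s)) = @Ledge R G e \o Lp (mkp (src e) s).
Proof.
move=> es; have te : route (tgt e) [:: e] (src e) by rewrite route_cons eqxx route_refl.
rewrite -cat1s (LpD te es); congr (_ \o _); apply: funext => f; apply: l2P => q.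
rewrite LpE /starts ptgt_mkp pedges_mkp; last exact: route_chain te.
rewrite /= /Ledge_fun; case qE: (pedges q) => [|e' v] //=.
rewrite prefix0s andbT (ptgt_cons qE).
have -> : (Some e' == Some e) = (e == e') by rewrite eq_sym.
have [ee'|/eqP ne] := pselect (e = e'); last by rewrite (negbTE ne).
subst e'; rewrite !eqxx /=; congr (f _).
apply: path_ext; rewrite /pstrip ?(psrc_mkp te) ?ptgt_mkp ?(pbehead_tgt qE)//.
have -> : drop (psize (mkp (tgt e) [:: e])) (pedges q) = v.
  by rewrite /psize pedges_mkp ?(route_chain te)// qE /= drop0.
rewrite pbehead_edges qE pedges_mkp//.
by have := route_path q; rewrite qE route_cons => /andP[_ /route_chain].
Qed.

Lemma Lp_vert_comp x p : Lp (vpath x) \o Lp p = if ptgt p == x then Lp p else 0.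
Proof.
apply: funext => f; apply: l2P => q; rewrite /= Lp_vpath /= /Lvert_fun.
have [<-|ne] := eqVneq (ptgt p) x.
  by case: eqP => // ne; rewrite LpE /starts; case: eqP => //; rewrite andbF.
rewrite op0E l20E; case: eqP => // qx; rewrite LpE /starts qx.
by rewrite eq_sym (negbTE ne) andbF.
Qed.

Lemma Lp_comp_vert p y : Lp p \o Lp (vpath y) = if psrc p == y then Lp p else 0.
Proof.
apply: funext => f; apply: l2P => q; rewrite /= LpE.
case: (boolP (starts p q)) => [h|h]; last first.
  by case: eqP => _; rewrite ?op0E// LpE (negbTE h).
rewrite Lp_vpath /= /Lvert_fun /pstrip ptgt_mkp; case: eqP => _ //.
by rewrite LpE h.
Qed.

(* The adjoint of [Lp p]. *)
Definition Ls p : H -> H :=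
  wop (fun q => (ptgt q == psrc p)%:R) (fun q => mkp (ptgt p) (pedges p ++ pedges q)).

Lemma pmul_route p q : ptgt q = psrc p ->
  route (ptgt p) (pedges p ++ pedges q) (psrc q).
Proof. by move=> h; apply: route_cat (route_path p) _; rewrite -h route_path. Qed.

Lemma pmul_inj p q q' : (ptgt q == psrc p)%:R != 0 :> R[i] ->
  (ptgt q' == psrc p)%:R != 0 :> R[i] ->
  mkp (ptgt p) (pedges p ++ pedges q) = mkp (ptgt p) (pedges p ++ pedges q') -> q = q'.
Proof.
move=> /indicator_neq0/eqP h /indicator_neq0/eqP h' E.
apply: path_ext; first by rewrite h h'.
have := congr1 (@pedges G) E.
rewrite !pedges_mkp ?(route_chain (pmul_route h)) ?(route_chain (pmul_route h'))//.
by move=> /eqP; rewrite eqseq_cat// eqxx => /eqP.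
Qed.

Lemma LsE p f q :
  Ls p f q = if ptgt q == psrc p then f (mkp (ptgt p) (pedges p ++ pedges q)) else 0.
Proof.
rewrite /Ls wopE; [|by move=> ?; exact: normc_indicator|exact: pmul_inj].
by case: eqP; rewrite ?mul1r ?mul0r.
Qed.

Lemma Ls_linear p : linear (Ls p).
Proof. by apply: wop_linear => [q|]; [exact: normc_indicator|exact: pmul_inj]. Qed.

Lemma Ls_bnd p : bnd (Ls p) 1.
Proof. by apply: wop_bnd => [q|]; [exact: normc_indicator|exact: pmul_inj]. Qed.

Lemma pstrip_mul p q : ptgt q = psrc p ->
  starts p (mkp (ptgt p) (pedges p ++ pedges q)) /\
  pstrip p (mkp (ptgt p) (pedges p ++ pedges q)) = q.
Proof.
move=> h; have c := route_chain (pmul_route h); split.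
  by rewrite /starts ptgt_mkp eqxx andbT pedges_mkp// prefix_prefix.
apply: path_ext; rewrite /pstrip ?ptgt_mkp//.
have -> : drop (psize p) (pedges (mkp (ptgt p) (pedges p ++ pedges q))) = pedges q.
  by rewrite pedges_mkp// drop_size_cat.
by rewrite pedges_mkp// -h (route_chain (route_path q)).
Qed.

Lemma Lp_mul p f q : ptgt q = psrc p ->
  Lp p f (mkp (ptgt p) (pedges p ++ pedges q)) = f q.
Proof. by move=> h; have [h1 h2] := pstrip_mul h; rewrite LpE h1 h2. Qed.

Lemma LsK p : Ls p \o Lp p = Lp (vpath (psrc p)).
Proof.
apply: funext => f; apply: l2P => q; rewrite /= LsE Lp_vpath /= /Lvert_fun.
by case: eqP => // h; rewrite Lp_mul.
Qed.

(* Right multiplication by [q]. *)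
Definition ends q p := suffix (pedges q) (pedges p) && (psrc p == psrc q).

Definition Rq q : H -> H :=
  wop (fun p => (ends q p)%:R) (fun p => ptake (psize p - psize q) p).

Lemma ends_pdrop q p : ends q p -> pdrop (psize p - psize q) p = q.
Proof. by case/andP => h /eqP h'; exact: path_suffix. Qed.

Lemma ptake_inj q p p' : (ends q p)%:R != 0 :> R[i] ->
  (ends q p')%:R != 0 :> R[i] ->
  ptake (psize p - psize q) p = ptake (psize p' - psize q) p' -> p = p'.
Proof.
move=> /indicator_neq0 h /indicator_neq0 h' E.
have := congr1 (@ptgt G) E; rewrite !ptgt_ptake => tE.
have := congr1 (@pedges G) E; rewrite !pedges_ptake => eE.
apply: path_ext => //.
have d : drop (psize p - psize q) (pedges p) = pedges q.
  by rewrite -pedges_pdrop ends_pdrop.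
have d' : drop (psize p' - psize q) (pedges p') = pedges q.
  by rewrite -pedges_pdrop ends_pdrop.
by rewrite -[LHS](cat_take_drop (psize p - psize q)) eE d -d' cat_take_drop.
Qed.

Lemma RqE q f p : Rq q f p = if ends q p then f (ptake (psize p - psize q) p) else 0.
Proof.
rewrite /Rq wopE; [|by move=> ?; exact: normc_indicator|exact: ptake_inj].
by case: ends; rewrite ?mul1r ?mul0r.
Qed.

Lemma Rq_linear q : linear (Rq q).
Proof. by apply: wop_linear => [p|]; [exact: normc_indicator|exact: ptake_inj]. Qed.

Lemma Rq_bnd q : bnd (Rq q) 1.
Proof. by apply: wop_bnd => [p|]; [exact: normc_indicator|exact: ptake_inj]. Qed.

Lemma Rq_xi q : Rq q (xi R (vpath (ptgt q))) = xi R q.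
Proof.
apply: l2P => p; rewrite RqE /= /delta_fun.
have [h|h] := boolP (ends q p); last first.
  by case: eqP => // pq; rewrite pq /ends suffix_refl eqxx in h.
have pE := ends_pdrop h; have [->|ne] := eqVneq p q.
  by rewrite subnn ptake0 eqxx.
case: eqP => // E; case/negP: ne; apply/eqP; rewrite -pE.
have /= := congr1 (size \o @pedges G) E; rewrite pedges_ptake.
move=> /eqP; rewrite size_eq0 => /eqP tE; apply: path_ext; last first.
  by rewrite pedges_pdrop -{1}(cat_take_drop (psize p - psize q) (pedges p)) tE.
by rewrite /pdrop tE ptgt_mkp.
Qed.

Lemma Rq_Ledge q e f : Rq q (@Ledge R G e f) = Ledge e (Rq q f).
Proof.
apply: l2P => p; rewrite RqE /= /Ledge_fun pedges_ptake.
case pE: (pedges p) => [|e' v] /=.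
  by case: ifP.
rewrite RqE /ends pbehead_edges pbehead_src pE /= /psize pE pbehead_edges pE /=.
have [/andP[/suffixP[[|e2 u] E] sE]|h] := boolP (_ && _).
(* If p consists of exactly the edges of q, its left factor is a vertex, where [Ledge] vanishes, and
   [pbehead p] is too short to end in q. *)
- have qE : pedges q = e' :: v by rewrite E cat0s.
  rewrite qE /= subnn take0 /=; case: ifP => // _; rewrite ifN// negb_and.
  by apply/orP; left; apply/negP => /size_suffix; rewrite /= ltnn.
- case: E => e2E E; subst e2.
  rewrite E sE suffix_suffix /= size_cat -addSn addnK /=.
  case: ifP => // _; congr (f _).
  have pt : pedges (ptake (size u).+1 p) = e' :: u.
    by rewrite pedges_ptake pE E /= take_size_cat.
  apply: path_ext; first by rewrite ptgt_ptake (pbehead_tgt pt) (pbehead_tgt pE).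
  by rewrite pbehead_edges pt pedges_ptake pbehead_edges pE /= E addnK take_size_cat.
case: ifP => // _; rewrite ifN//.
by apply: contra h => /andP[h1 ->]; rewrite andbT; exact: suffix_trans h1 (suffix_cons _ _).
Qed.

Lemma Rq_Lvert q x f : Rq q (@Lvert R G x f) = Lvert x (Rq q f).
Proof.
apply: l2P => p; rewrite RqE /= /Lvert_fun ptgt_ptake RqE.
by case: ifP => //; case: ifP.
Qed.

(** The commutant of the right multiplications. As a norm-closed algebra containing the generators
    it contains the tensor algebra, whose elements are handled only through this property. *)
Definition left_op : set (H -> H) :=
  [set A | bounded_operator A /\ forall q f, A (Rq q f) = Rq q (A f)].

Lemma left_op_algebra : subalgebra left_op.
Proof.
split.
- by move=> A [].
- split; first by apply: bnd_bounded (@bnd0 R _); exact: linear_op0.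
  by move=> q f; rewrite !op0E linear_zero//; exact: Rq_linear.
- move=> a A B [bA cA] [bB cB]; split.
    have [k k0 hk] := bounded_bnd bA; have [l l0 hl] := bounded_bnd bB.
    apply: bnd_bounded (bndD (bndZ a hk) hl).
    by apply: linear_comb; exact: bounded_linear.
  move=> q f; rewrite !opDE !opZE cA cB.
  by rewrite linear_add ?linear_scale//; exact: Rq_linear.
- move=> A B [bA cA] [bB cB]; split.
    have [k k0 hk] := bounded_bnd bA; have [l l0 hl] := bounded_bnd bB.
    apply: bnd_bounded (bnd_comp k0 hk hl).
    by apply: linear_comp; exact: bounded_linear.
  by move=> q f /=; rewrite cB cA.
Qed.

Lemma left_op_closed : norm_closed left_op.
Proof.
move=> T bT h; split => // q f; apply/eqP; rewrite -subr_eq0; apply/eqP.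
apply: l2norm_eq0; apply/eqP; rewrite eq_le l2norm_ge0 andbT.
apply/ler_addgt0Pr => d d0; rewrite add0r.
pose C := 2 * (1 + l2norm f); have C0 : 0 < C by rewrite mulr_gt0// ltr_pwDl ?l2norm_ge0.
have [|A [bA cA] TA] := h (d / C); first by rewrite divr_gt0.
have lT := bounded_linear bT; have lA := bounded_linear bA.
have bTA : bnd (T - A) (d / C).
  by apply: opnorm_bnd; [exact: linear_opB|exact: ltW].
have -> : T (Rq q f) - Rq q (T f) = (T - A) (Rq q f) - Rq q ((T - A) f).
  rewrite !opBE linear_sub; last exact: Rq_linear.
  by rewrite cA opprB addrA subrK.
have dC : 0 <= d / C by rewrite divr_ge0 ?ltW.
have h1 : l2norm (Rq q f) <= l2norm f by rewrite -[leRHS]mul1r Rq_bnd.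
have h2 : l2norm (Rq q ((T - A) f)) <= d / C * l2norm f.
  by apply: le_trans (Rq_bnd _ _) _; rewrite mul1r bTA.
apply: le_trans (l2normB _ _) _.
apply: (@le_trans _ _ (d / C * l2norm f + d / C * l2norm f)).
  apply: lerD h2; apply: le_trans (bTA _) _; exact: ler_wpM2l.
rewrite -mulrDr mulrAC ler_pdivrMr// ler_wpM2l ?ltW// /C.
have := l2norm_ge0 f; lra.
Qed.

Lemma generators_left_op : @generators R G `<=` left_op.
Proof.
move=> A gA; split; first exact: generators_bounded.
by case: gA => [[e _ <-]|[x _ <-]] q f; rewrite ?Rq_Ledge ?Rq_Lvert.
Qed.

Lemma tensor_left_op : tensor_algebra R G `<=` left_op.
Proof.
move=> A; apply; split; last exact: generators_left_op.
by split; [exact: left_op_algebra|exact: left_op_closed].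
Qed.

Lemma tensor_bounded : tensor_algebra R G `<=` @bounded_operator R (dipath G).
Proof. by move=> A /tensor_left_op []. Qed.

Lemma tensor_generators : @generators R G `<=` tensor_algebra R G.
Proof. by move=> A gA M [_ gM]; exact: gM. Qed.

Lemma tensor_subalgebra : subalgebra (tensor_algebra R G).
Proof.
split; first exact: tensor_bounded.
- by move=> M [[[_ h _ _] _] _].
- by move=> a A B hA hB M hM; have [[[_ _ h _] _] _] := hM; apply: h; [exact: hA|exact: hB].
- by move=> A B hA hB M hM; have [[[_ _ _ h] _] _] := hM; apply: h; [exact: hA|exact: hB].
Qed.

Lemma tensor_closed : norm_closed (tensor_algebra R G).
Proof.
move=> T bT h M hM; have [[_ cM] _] := hM; apply: cM => // e e0.
by have [A hA TA] := h e e0; exists A => //; exact: hA.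
Qed.

Lemma subalgebra_Lp (M : set (H -> H)) p :
  subalgebra M -> @generators R G `<=` M -> M (Lp p).
Proof.
move=> [_ _ _ mM] gM; rewrite -(mkpK p); move: (route_path p).
elim: (pedges p) (ptgt p) => [|e s IH] x.
  by move=> _; rewrite mkp_nil Lp_vpath; apply: gM; right; exists x.
rewrite route_cons => /andP[/eqP <- es]; rewrite (Lp_cons es).
by apply: mM; [apply: gM; left; exists e|exact: IH].
Qed.

Lemma subalgebra_sum (M : set (H -> H)) (I : eqType) (r : seq I) (a : I -> R[i])
  (F : I -> H -> H) : subalgebra M -> (forall i, i \in r -> M (F i)) ->
  M (\sum_(i <- r) a i *: F i).
Proof.
move=> [_ m0 mc _]; elim: r => [|i r IH] h; first by rewrite big_nil.
rewrite big_cons; apply: mc; first by apply: h; rewrite inE eqxx.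
by apply: IH => j jr; apply: h; rewrite inE jr orbT.
Qed.

Lemma tensor_Lp p : tensor_algebra R G (Lp p).
Proof. exact: subalgebra_Lp tensor_subalgebra tensor_generators. Qed.

(* The Fourier coefficient of [A] at the path [w]. *)
Definition coef (A : H -> H) w : R[i] := A (xi R (vpath (psrc w))) w.

Lemma left_op_xi A q p : left_op A ->
  A (xi R q) p = if ends q p then coef A (ptake (psize p - psize q) p) else 0.
Proof.
move=> [_ cA]; rewrite -Rq_xi cA RqE; case: ifP => // h.
by rewrite /coef psrc_ptake ends_pdrop.
Qed.

Lemma l2_split (X : choiceType) (J : seq X) (f : l2 R X) : uniq J ->
  exists2 t : l2 R X, f = \sum_(q <- J) f q *: xi R q + t &
    forall x : X, t x = if x \in J then 0 else f x.
Proof.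
move=> uJ; exists (f - \sum_(q <- J) f q *: xi R q); first by rewrite addrC subrK.
move=> x; rewrite l2BE l2_sumE; have [xJ|xJ] := boolP (x \in J).
  rewrite (bigD1_seq x)//= big1 => [|q qx].
    by rewrite addr0 -[X in _ - X]/(f x * delta_fun R x x) /delta_fun eqxx mulr1 subrr.
  by rewrite -[LHS]/(f q * delta_fun R q x) /delta_fun eq_sym (negbTE qx) mulr0.
rewrite big1_seq ?subr0// => q /andP[_ qJ]; rewrite l2ZE /= /delta_fun.
by case: eqP => [xq|]; [rewrite xq qJ in xJ|rewrite mulr0].
Qed.

Lemma linear_opsum (X : choiceType) (A : l2 R X -> l2 R X) (I : Type) (r : seq I)
    (F : I -> l2 R X) : linear A -> A (\sum_(i <- r) F i) = \sum_(i <- r) A (F i).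
Proof.
move=> lA; elim: r => [|i r IH]; first by rewrite !big_nil linear_zero.
by rewrite !big_cons linear_add// IH.
Qed.

Lemma psize_pdrop i p : psize (pdrop i p) = (psize p - i)%N.
Proof. by rewrite /psize pedges_pdrop size_drop. Qed.

Lemma ends_pdrop_self i p : ends (pdrop i p) p.
Proof. by rewrite /ends pedges_pdrop suffix_drop psrc_pdrop eqxx. Qed.

(** Only right factors q of p can give a nonzero value of A (xi q) at p, which makes the sum finite.
    The rest of f, off a large finite set containing these factors, has small norm, and A is
    bounded. *)
Lemma left_op_expand A f p : left_op A ->
  A f p = \sum_(i < (psize p).+1) coef A (ptake i p) * f (pdrop i p).
Proof.
move=> hA; have [bA cA] := hA; have lA := bounded_linear bA.
have [k k0 bk] := bounded_bnd bA.
pose J := [seq pdrop i p | i <- iota 0 (psize p).+1].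
have uJ : uniq J.
  rewrite map_inj_in_uniq ?iota_uniq// => i j.
  rewrite !mem_iota !add0n !ltnS /= => ip jp /(congr1 (@psize G)).
  by rewrite !psize_pdrop => E; rewrite -(subKn ip) E subKn.
have JP q : ends q p -> q \in J.
  move=> h; apply/mapP; exists (psize p - psize q)%N; last by rewrite ends_pdrop.
  by rewrite mem_iota add0n ltnS leq_subr.
have sumJ : \sum_(i < (psize p).+1) coef A (ptake i p) * f (pdrop i p)
    = \sum_(q <- J) f q * A (xi R q) p.
  rewrite big_map.
  rewrite -(big_mkord xpredT (fun i => coef A (ptake i p) * f (pdrop i p))).
  rewrite /index_iota subn0; apply: eq_big_seq => i.
  rewrite mem_iota add0n ltnS => /andP[_ ip].
  by rewrite mulrC left_op_xi// ends_pdrop_self psize_pdrop subKn.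
rewrite sumJ; apply/eqP; rewrite -subr_eq0; apply/eqP; apply: eq0_normc.
apply/eqP; rewrite eq_le normc_ge0 andbT.
apply/ler_addgt0Pr => d d0; rewrite add0r.
have [|J0 uJ0 tail] := @l2_tail _ _ f (d / (1 + k)).
  by rewrite divr_gt0// ltr_pwDl.
pose J1 := undup (J ++ J0); have uJ1 : uniq J1 by exact: undup_uniq.
have [t fE tE] := l2_split f uJ1.
have nt : l2norm t <= d / (1 + k).
  apply: l2norm_le => [|J2 uJ2]; first by rewrite divr_ge0 ?addr_ge0// ltW.
  apply: le_trans (tail [seq x <- J2 | x \notin J1] _ _); last first.
  - by move=> x xJ; rewrite mem_filter mem_undup mem_cat xJ orbT.
  - exact: filter_uniq.
  rewrite big_filter [leRHS]big_mkcond; apply: ler_sum => x _ /=; rewrite tE.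
  by case: (x \in J1); rewrite ?normc0 ?expr0n.
have -> : A f p - \sum_(q <- J) f q * A (xi R q) p = A t p.
  rewrite {1}fE linear_add// linear_opsum// l2DE l2_sumE addrAC.
  rewrite (eq_bigr (fun q => f q * A (xi R q) p)); last first.
    by move=> q _; rewrite linear_scale.
  suff -> : \sum_(q <- J1) f q * A (xi R q) p = \sum_(q <- J) f q * A (xi R q) p.
    by rewrite subrr add0r.
  rewrite [LHS](bigID (fun q => q \in J)) /= [X in _ + X]big1 ?addr0; last first.
    move=> q qJ; rewrite left_op_xi// ifN ?mulr0//.
    by apply: contra qJ; exact: JP.
  rewrite -big_filter; apply: perm_big; apply: uniq_perm => //.
    exact: filter_uniq.
  by move=> q; rewrite mem_filter mem_undup mem_cat; case: (q \in J).
apply: le_trans (normc_le_l2norm _ _) _; apply: le_trans (bk t) _.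
apply: (@le_trans _ _ (k * (d / (1 + k)))); first by rewrite ler_wpM2l.
have k1 : 0 < 1 + k by rewrite ltr_pwDl.
rewrite mulrA ler_pdivrMr// [leLHS]mulrC; apply: ler_wpM2l; first exact: ltW.
by rewrite lerDr.
Qed.

Lemma left_op_ext A B : left_op A -> left_op B -> coef A =1 coef B -> A = B.
Proof.
move=> hA hB AB; apply: funext => f; apply: l2P => p.
by rewrite !left_op_expand//; apply: eq_bigr => i _; rewrite AB.
Qed.

End PathOperators.

Section Projections.
Variables (R : realType) (X : choiceType).
Local Notation H := (l2 R X).

Definition proj (P : pred X) : H -> H := wop (fun q => (P q)%:R) id.

Lemma projE (P : pred X) f q : proj P f q = if P q then f q else 0.
Proof.
rewrite /proj wopE//; last by move=> ?; exact: normc_indicator.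
by case: (P q); rewrite ?mul1r ?mul0r.
Qed.

Lemma proj_linear (P : pred X) : linear (proj P).
Proof. by apply: wop_linear => // q; exact: normc_indicator. Qed.

Lemma proj_contraction (P : pred X) f : l2norm (proj P f) <= l2norm f.
Proof. by apply: wop_contraction => // q; exact: normc_indicator. Qed.

(** Supplies the next stage in both gliding humps: a large norm is already seen on finitely many
    paths, hence by any projection that keeps them. *)
Lemma proj_exhaust (f : H) (C : R) : C < l2norm f ->
  exists J : seq X, forall P : pred X, (forall q, q \in J -> P q) ->
    C < l2norm (proj P f).
Proof.
have [C0|C0] := ltP C 0.
  by exists [::] => P _; apply: lt_le_trans C0 (l2norm_ge0 _).
move=> /(l2norm_gt C0)[J uJ hJ]; exists J => P JP.
rewrite -(@ltr_pXn2r _ 2)// ?nnegrE ?l2norm_ge0//.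
apply: lt_le_trans hJ _; apply: le_trans (sum_le_l2norm _ uJ).
rewrite big_seq_cond [leRHS]big_seq_cond; apply: ler_sum => q /andP[qJ _].
by rewrite projE JP.
Qed.

End Projections.

(** * Automatic continuity *)

Section AutomaticContinuity.
Variables (R : realType) (G : digraph).
Local Notation H := (l2 R (dipath G)).
Local Notation TA := (tensor_algebra R G).
Variable d : (H -> H) -> (H -> H).
Hypothesis hd : derivation TA d.
Implicit Types (A B Z : H -> H) (x y : vert G).

Lemma ta_lin A : TA A -> linear A.
Proof. by move=> /tensor_bounded /bounded_linear. Qed.

Lemma ta_comb (a : R[i]) A B : TA A -> TA B -> TA (a *: A + B).
Proof. by have [_ _ h _] := tensor_subalgebra R G; exact: h. Qed.

Lemma ta_comp A B : TA A -> TA B -> TA (A \o B).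
Proof. by have [_ _ _ h] := tensor_subalgebra R G; exact: h. Qed.

Lemma ta0 : TA 0.
Proof. by have [_ h _ _] := tensor_subalgebra R G. Qed.

Lemma ta_add A B : TA A -> TA B -> TA (A + B).
Proof. by rewrite -[A in A + B]scale1r; exact: ta_comb. Qed.

Lemma ta_scale (a : R[i]) A : TA A -> TA (a *: A).
Proof. by move=> hA; rewrite -[a *: A]addr0; apply: ta_comb => //; exact: ta0. Qed.

Lemma ta_sub A B : TA A -> TA B -> TA (A - B).
Proof. by move=> hA hB; apply: ta_add => //; rewrite -scaleN1r; exact: ta_scale. Qed.

Lemma der_ta A : TA A -> TA (d A). Proof. by have [h _ _] := hd; exact: h. Qed.

Lemma der_comb (a : R[i]) A B : TA A -> TA B -> d (a *: A + B) = a *: d A + d B.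
Proof. by have [_ h _] := hd; exact: h. Qed.

Lemma der_comp A B : TA A -> TA B -> d (A \o B) = (d A \o B) + (A \o d B).
Proof. by have [_ _ h] := hd; exact: h. Qed.

Lemma der_add A B : TA A -> TA B -> d (A + B) = d A + d B.
Proof. by move=> hA hB; have := der_comb 1 hA hB; rewrite !scale1r. Qed.

Lemma der0 : d 0 = 0.
Proof.
have := der_add ta0 ta0; rewrite addr0 => e.
by apply: (@addrI _ (d 0)); rewrite addr0 -e.
Qed.

Lemma der_scale (a : R[i]) A : TA A -> d (a *: A) = a *: d A.
Proof. by move=> hA; have := der_comb a hA ta0; rewrite der0 !addr0. Qed.

Lemma ta_bnd A : TA A -> exists2 k, 0 <= k & bnd A k.
Proof. by move=> /tensor_bounded /bounded_bnd. Qed.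

Lemma ta_closed A : linear A ->
  (forall e, 0 < e -> exists2 B, TA B & bnd (A - B) e) -> TA A.
Proof. exact: norm_closed_bnd (@tensor_closed R G) (@tensor_bounded R G). Qed.

(* A gliding hump: summing the elements [B] provided by the last hypothesis
   along a sequence of stages would give an element of the algebra whose image
   under [d] is unbounded. *)
Lemma gliding_hump (J : Type) (j0 : J) (I : J -> set (H -> H)) (K : J -> R)
    (pi : J -> H -> H) :
  (forall j, I j `<=` TA) -> (forall j, I j 0) ->
  (forall j A B, I j A -> I j B -> I j (A + B)) ->
  (forall j A, TA A -> (forall e, 0 < e -> exists2 B, I j B & bnd (A - B) e) -> I j A) ->
  (forall j, linear (pi j)) -> (forall j f, l2norm (pi j f) <= l2norm f) ->
  (forall j, 0 <= K j) ->
  (forall j Z k, I j Z -> 0 <= k -> bnd Z k -> bnd (pi j \o d Z) (K j * k)) ->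
  (forall j C e, 0 < e -> exists B j', [/\ I j B, I j' `<=` I j, bnd B e &
     exists2 f, l2norm f <= 1 & C < l2norm (pi j' (d B f))]) ->
  False.
Proof.
move=> IT I0 ID Icl pil pic K0 h1 h2.
(* A state holds a counter, the current stage, the partial sum, and the bound for the next
   increment. *)
pose st := (nat * J * (H -> H) * R)%type.
pose inv (s : st) := [/\ TA s.1.2, 0 < s.2 & 2 * s.2 * K s.1.1.2 <= 1].
pose step (s s' : st) := [/\ s'.1.1.1 = s.1.1.1.+1, I s'.1.1.2 `<=` I s.1.1.2,
  I s.1.1.2 (s'.1.2 - s.1.2), bnd (s'.1.2 - s.1.2) s.2 & s'.2 <= s.2 / 2] /\
  exists2 f, l2norm f <= 1 & s.1.1.1.+1%:R < l2norm (pi s'.1.1.2 (d s'.1.2 f)).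
have stepP (s : st) : inv s -> exists s', inv s' /\ step s s'.
  case: s => [[[n j] Q] e]; rewrite /inv /step /= => -[TS e0 eK].
  have [k k0 Sk] := ta_bnd (der_ta TS).
  (* The new hump has to exceed the counter by k, the bound on the image of the partial sum so
     far. *)
  have [B [j' [jB jj' Be [f f1 Bf]]]] := h2 j (n.+1%:R + k) e e0.
  have TB := IT _ _ jB.
  (* Halving makes the partial sums converge. The second bound ensures that all later increments, of
     total norm at most 2 * e', change the image seen by pi j' by at most 1. *)
  pose e' := Num.min (e / 2) (2 * (1 + K j'))^-1.
  have K1 : 0 < 2 * (1 + K j') by rewrite mulr_gt0// ltr_pwDl.
  exists (n.+1, j', Q + B, e'); split.
    split; first exact: ta_add.
      by rewrite lt_min divr_gt0//= invr_gt0.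
    have e'1 : e' <= (2 * (1 + K j'))^-1 by rewrite ge_min lexx orbT.
    rewrite mulrAC; apply: (@le_trans _ _ (2 * K j' * (2 * (1 + K j'))^-1)).
      by rewrite ler_wpM2l// mulr_ge0.
    by rewrite ler_pdivrMr// mul1r; have := K0 j'; lra.
  split; first by split; rewrite ?[Q + B]addrC ?addrK// ge_min lexx.
  exists f => //; rewrite der_add// opDE linear_add//.
  have : l2norm (pi j' (d Q f)) <= k.
    apply: le_trans (pic _ _) _; apply: le_trans (Sk f) _.
    by rewrite ler_piMr.
  have : l2norm (pi j' (d B f)) <= l2norm (pi j' (d Q f) + pi j' (d B f))
                                  + l2norm (pi j' (d Q f)).
    by apply: le_trans (l2normB _ _); rewrite addrC addrA addNr add0r.
  lra.
have [next nextP] := choice_on id stepP.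
pose s0 : st := (0%N, j0, 0, (2 * (1 + K j0))^-1).
have i0 : inv s0.
  have K1 : 0 < 2 * (1 + K j0) by rewrite mulr_gt0// ltr_pwDl.
  split; [exact: ta0|by rewrite invr_gt0|].
  by rewrite mulrAC ler_pdivrMr// mul1r; have := K0 j0; lra.
pose u n := iter n next s0.
have iu n : inv (u n) by elim: n => //= n /nextP[].
have su n : step (u n) (u n.+1) by have [] := nextP _ (iu n).
pose jn n := (u n).1.1.2; pose Q n := (u n).1.2; pose e n := (u n).2.
have un n : (u n).1.1.1 = n by elim: n => // n IH; have [[-> _ _ _ _] _] := su n; rewrite IH.
have invn n : [/\ TA (Q n), 0 < e n & 2 * e n * K (jn n) <= 1] by exact: iu.
have stepn n : [/\ I (jn n.+1) `<=` I (jn n), I (jn n) (Q n.+1 - Q n),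
    bnd (Q n.+1 - Q n) (e n) & e n.+1 <= e n / 2] /\
    exists2 f, l2norm f <= 1 & n.+1%:R < l2norm (pi (jn n.+1) (d (Q n.+1) f)).
  by have [[_ h3 h4 h5 h6] [f f1 hf]] := su n; split=> //; exists f; rewrite // -{1}(un n).
have TS n : TA (Q n) by have [] := invn n.
have e0 n : 0 <= e n by have [_ /ltW] := invn n.
have e2 n : e n.+1 <= e n / 2 by have [[]] := stepn n.
have [A lA bA] : exists2 A, linear A & forall n, bnd (A - Q n) (2 * e n).
  apply: op_geometric_limit => // n; first exact: ta_lin.
  by have [[]] := stepn n.
have small r n : 0 < r -> exists m, bnd (A - Q (n + m)%N) r.
  move=> r0; have [] := @halving_arbitrarily_small _ (fun m => e (n + m)%N) 2 r => //.
    by move=> m; rewrite addnS.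
  by move=> m hm; exists m; apply: bnd_le (bA _); rewrite mulrC.
have TAA : TA A.
  apply: ta_closed => // r /(small _ 0%N)[m hm]; exists (Q m) => //.
have IS n m : I (jn n) (Q (n + m)%N - Q n) /\ I (jn (n + m)%N) `<=` I (jn n).
  elim: m => [|m [IH1 IH2]]; first by rewrite addn0 subrr; split.
  rewrite addnS; have [[h3 h4 _ _] _] := stepn (n + m)%N; split; last first.
    exact: subset_trans h3 IH2.
  rewrite -(subrK (Q (n + m)%N) (Q (n + m).+1)) -addrA.
  by apply: ID => //; exact: IH2.
(* Increments after stage n lie in I (jn n), since the sets I decrease along the stages; closedness
   passes this to their limit. *)
have IA n : I (jn n) (A - Q n).
  apply: Icl; first exact: ta_sub.
  move=> r /(small _ n)[m hm]; exists (Q (n + m)%N - Q n); first by have [] := IS n m.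
  by rewrite opprB addrA subrK.
have [k k0 Ak] := ta_bnd (der_ta TAA).
pose n := Num.truncn k; have nk : k < n.+1%:R by exact: truncnS_gt.
have [_ [f f1 hf]] := stepn n.+1.
have [_ e'0 eK] := invn n.+2.
have : l2norm (pi (jn n.+2) (d (A - Q n.+2) f)) <= 1.
  apply: le_trans eK; have e'1 : 0 <= 2 * e n.+2 by rewrite mulr_ge0.
  apply: le_trans (h1 _ _ _ (IA n.+2) e'1 (bA n.+2) f) _.
  by rewrite [leRHS]mulrC ler_piMr// mulr_ge0.
have : l2norm (pi (jn n.+2) (d A f)) <= k.
  by apply: le_trans (pic _ _) _; apply: le_trans (Ak f) _; rewrite ler_piMr.
have dAE : d A = d (A - Q n.+2) + d (Q n.+2).
  by rewrite -der_add ?subrK//; exact: ta_sub.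
have : l2norm (pi (jn n.+2) (d (Q n.+2) f)) <=
    l2norm (pi (jn n.+2) (d A f)) + l2norm (pi (jn n.+2) (d (A - Q n.+2) f)).
  by rewrite dAE opDE linear_add//; apply: le_trans (l2normB _ _); rewrite addrC addKr.
have : n.+2%:R = n.+1%:R + 1 :> R by rewrite natr1.
lra.
Qed.

Definition der_bounded_by (pi : H -> H) := exists2 K, 0 <= K &
  forall Z k, TA Z -> 0 <= k -> bnd Z k -> bnd (pi \o d Z) (K * k).

Lemma der_bounded_by_unit (pi : H -> H) (C : R) : linear pi ->
  (forall A f, TA A -> bnd A 1 -> l2norm f <= 1 -> l2norm (pi (d A f)) <= C) ->
  der_bounded_by pi.
Proof.
move=> lpi h; have C0 : 0 <= C.
  have := h 0 0 ta0 (bnd_le ler01 (@bnd0 R _)); rewrite l2norm0 => /(_ ler01).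
  by apply: le_trans; exact: l2norm_ge0.
exists C => // Z k TZ k0 Zk f.
have [kE|kn] := eqVneq k 0.
  have Z0 : Z = 0.
    apply: funext => v; apply: l2norm_eq0; apply/eqP.
    by rewrite eq_le l2norm_ge0 andbT -(mul0r (l2norm v)) -kE.
  by rewrite Z0 der0 /= op0E linear_zero// l2norm0 mulr_ge0 ?l2norm_ge0// mulr_ge0.
have {kn k0}k0 : 0 < k by rewrite lt_def kn k0.
pose a : R[i] := (k^-1)%:C; pose c : R[i] := k%:C.
have na : normc a = k^-1 by rewrite normc_real ger0_norm// invr_ge0 ltW.
have nc : normc c = k by rewrite normc_real ger0_norm// ltW.
have ca : c * a = 1 by rewrite -rmorphM mulfV ?gt_eqF.
have Ta : TA (a *: Z) by exact: ta_scale.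
have ba : bnd (a *: Z) 1.
  by have := bndZ a Zk; rewrite na mulVf ?gt_eqF.
have h1 : bnd (pi \o d (a *: Z)) C.
  apply: bnd_unit => [|g g1]; last exact: h.
  by apply: linear_comp => //; apply: ta_lin; exact: der_ta.
have -> : Z = c *: (a *: Z) by rewrite scalerA ca scale1r.
rewrite der_scale// /= opZE linear_scale//.
apply: le_trans (l2normZ _ _) _; rewrite nc mulrAC [leRHS]mulrC.
by apply: ler_wpM2l; [exact: ltW|exact: h1].
Qed.

Lemma der_loop_bounded x c : route x c x -> c <> [::] ->
  der_bounded_by (Lp (vpath x)).
Proof.
move=> xc c0; pose p m := mkp x (wpow c m).
have xp m : route x (wpow c m) x by exact: loop_wpow.
have sp m : psrc (p m) = x by exact: psrc_mkp (xp m).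
have cp m : psize (p m) = (m * size c)%N.
  by rewrite /psize pedges_mkp ?size_wpow// (route_chain (xp m)).
have c0' : (0 < size c)%N by case: (c) c0.
have lL q : linear (@Lp R G q) by exact: Lp_linear.
have TL q : TA (Lp q) by exact: tensor_Lp.
have [kap kapP] : exists kap : nat -> R,
    forall m, 0 <= kap m /\ bnd (d (Lp (p m))) (kap m).
  have E m : exists k, 0 <= k /\ bnd (d (Lp (p m))) k.
    by have [k k0 hk] := ta_bnd (der_ta (TL (p m))); exists k.
  by have [kap h] := choice E; exists kap.
have kap0 m : 0 <= kap m by have [] := kapP m.
have bkap m : bnd (d (Lp (p m))) (kap m) by have [] := kapP m.
apply: contrapT => nb.
have unb C : exists A f, [/\ TA A, bnd A 1, l2norm f <= 1 &
    C < l2norm (Lp (vpath x) (d A f))].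
  apply: contrapT => h; apply: nb; apply: (@der_bounded_by_unit _ C) => //.
  move=> A f TA' A1 f1; rewrite leNgt; apply/negP => hC.
  by apply: h; exists A, f.
pose I m : set (H -> H) := [set Z | exists2 Y, TA Y & Z = Lp (p m) \o Y].
pose pi m : H -> H := proj (fun q => psize q < m * size c)%N.
have LsL m (Y : H -> H) : Ls (p m) \o (Lp (p m) \o Y) = Lp (vpath x) \o Y.
  by rewrite -[LHS]/((Ls (p m) \o Lp (p m)) \o Y) LsK sp.
have LvL m (Y : H -> H) : Lp (p m) \o (Lp (vpath x) \o Y) = Lp (p m) \o Y.
  by rewrite -[LHS]/((Lp (p m) \o Lp (vpath x)) \o Y) Lp_comp_vert sp eqxx.
have TI m : I m `<=` TA by move=> _ [Y TY ->]; exact: ta_comp.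
apply: (@gliding_hump nat 0%N I kap pi) => //.
- move=> m; exists 0; first exact: ta0.
  by apply: funext => f /=; rewrite op0E linear_zero.
- move=> m _ _ [Y TY ->] [Y' TY' ->]; exists (Y + Y'); first exact: ta_add.
  by apply: funext => f /=; rewrite !opDE linear_add.
- move=> m A TAA h.
  have lA := ta_lin TAA; have lS : linear (@Ls R G (p m)) by exact: Ls_linear.
  (* Closedness of the right ideal: for B = L_p Y in it, [Ls] gives L_x Y back. So [Ls \o A] is a
     norm limit of elements of the algebra, and L_p recovers A from it. *)
  exists (Ls (p m) \o A).
    apply: ta_closed => [|e e0]; first exact: linear_comp.
    have [B [Y TY BE] AB] := h e e0; exists (Lp (vpath x) \o Y); first exact: ta_comp.
    rewrite -(LsL m) -BE => f; rewrite opBE /= -linear_sub//.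
    by apply: le_trans (Ls_bnd _ _) _; rewrite mul1r AB.
  apply: funext => f /=; apply/eqP; rewrite -subr_eq0; apply/eqP.
  apply: l2norm_eq0; apply/eqP; rewrite eq_le l2norm_ge0 andbT.
  apply/ler_addgt0Pr => e e0; rewrite add0r.
  pose D := 2 * (1 + l2norm f).
  have D0 : 0 < D by rewrite mulr_gt0// ltr_pwDl ?l2norm_ge0.
  have [|B [Y TY BE] AB] := h (e / D); first by rewrite divr_gt0.
  have BfE : B f = Lp (p m) (Ls (p m) (B f)).
    have := LvL m Y; rewrite -(LsL m) -BE => E.
    by rewrite -[RHS]/((Lp (p m) \o (Ls (p m) \o B)) f) E.
  have -> : A f - Lp (p m) (Ls (p m) (A f)) =
      (A - B) f - Lp (p m) (Ls (p m) ((A - B) f)).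
    by rewrite opBE linear_sub// linear_sub// -BfE opprB addrA subrK.
  apply: le_trans (l2normB _ _) _.
  have h2 : l2norm (Lp (p m) (Ls (p m) ((A - B) f))) <= l2norm ((A - B) f).
    apply: le_trans (Lp_bnd _ _) _; rewrite mul1r.
    by apply: le_trans (Ls_bnd _ _) _; rewrite mul1r.
  apply: le_trans (lerD (lexx _) h2) _; apply: le_trans (lerD (AB f) (AB f)) _.
  rewrite -mulrDr mulrAC ler_pdivrMr//; apply: ler_wpM2l; first exact: ltW.
  by rewrite /D; have := l2norm_ge0 f; lra.
- by move=> m; exact: proj_linear.
- by move=> m f; exact: proj_contraction.
- move=> m _ k [Y TY ->] k0 Zk.
  (* Replace Y by L_x Y, which equals [Ls (p m)] applied to the product and therefore inherits its
     bound; Y itself is not controlled. *)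
  rewrite -LvL; pose Y' := Lp (vpath x) \o Y; rewrite -/Y'.
  have TY' : TA Y' by exact: ta_comp.
  have Y'k : bnd Y' k.
    rewrite /Y' -(LsL m) => f; apply: le_trans (Ls_bnd _ _) _.
    by rewrite mul1r; exact: Zk.
  rewrite der_comp// => f /=; rewrite opDE linear_add; last exact: proj_linear.
  have -> : pi m (Lp (p m) (d Y' f)) = 0.
    apply: l2P => q; rewrite projE; case: ifP => // qm; rewrite LpE ifN//.
    apply: contraTN qm => /andP[/size_prefix h _]; rewrite -leqNgt -cp.
    exact: h.
  rewrite addr0; apply: le_trans (proj_contraction _ _) _.
  by apply: le_trans (bkap m _) _; rewrite -mulrA ler_wpM2l.
move=> m C e e0.
(* After scaling by e, the term |C| / e yields |C|, and kap m pays for the Leibniz term in which d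
   falls on L_p. *)
have [A [f [TAA A1 f1 hA]]] := unb (`|C| / e + kap m).
pose a : R[i] := e%:C; have na : normc a = e by rewrite normc_real ger0_norm// ltW.
have Ta : TA (a *: A) by exact: ta_scale.
have ba : bnd (a *: A) e by have := bndZ a A1; rewrite na mulr1.
pose B := Lp (p m) \o (a *: A).
have hB : C < l2norm (d B f).
  rewrite /B der_comp// opDE /= der_scale//.
  have -> : Lp (p m) ((a *: d A) f) = a *: Lp (p m) (d A f) by rewrite opZE linear_scale.
  have h1 : l2norm (d (Lp (p m)) ((a *: A) f)) <= kap m * e.
    apply: le_trans (bkap m _) _; rewrite ler_wpM2l//.
    by apply: le_trans (ba f) _; rewrite ler_piMr// ltW.
  have h2 : e * l2norm (Lp (vpath x) (d A f)) <= l2norm (a *: Lp (p m) (d A f)).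
    have -> : Lp (vpath x) (d A f) = Ls (p m) (Lp (p m) (d A f)).
      by rewrite -(sp m) -LsK.
    apply: le_trans (l2norm_pos_scale _ e0); rewrite ler_pM2l//.
    by apply: le_trans (Ls_bnd _ _) _; rewrite mul1r.
  have h3 : l2norm (a *: Lp (p m) (d A f)) <=
     l2norm (d (Lp (p m)) ((a *: A) f) + a *: Lp (p m) (d A f))
     + l2norm (d (Lp (p m)) ((a *: A) f)).
    by apply: le_trans (l2normB _ _); rewrite addrC addKr.
  have h4 : `|C| + kap m * e < e * l2norm (Lp (vpath x) (d A f)).
    have -> : `|C| + kap m * e = e * (`|C| / e + kap m).
      by rewrite mulrDr mulrCA mulfV ?gt_eqF// mulr1 [e * _]mulrC.
    by rewrite ltr_pM2l.
  have := ler_norm C; lra.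
have [J hJ] := proj_exhaust hB.
(* As size c >= 1, paths shorter than the new threshold include all of [J]. *)
exists B, (m + (\max_(q <- J) psize q).+1)%N; split.
- by exists (a *: A).
- move=> _ [Y TY ->]; exists (Lp (p (\max_(q <- J) psize q).+1) \o Y).
    exact: ta_comp.
  by rewrite /p wpowD (LpD R (xp m) (xp _)).
- by move=> g; apply: le_trans (Lp_bnd _ _) _; rewrite mul1r; exact: ba.
exists f => //; apply: hJ => q qJ.
apply: (@leq_ltn_trans (\max_(q <- J) psize q)); first exact: leq_bigmax_seq.
apply: leq_trans (leq_pmulr _ c0'); exact: leq_addl.
Qed.

Hypothesis back : forall x y s, route x s y -> exists t, route y t x.

(** If no nonempty loop passes through x, strong connectedness leaves x as the only path ending at
    x. Then L_x A is a scalar multiple of L_x, and the Leibniz rule bounds L_x d(A) by twice the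
    norm of d(L_x). *)
Lemma der_vertex_bounded x : der_bounded_by (Lp (vpath x)).
Proof.
have [[c [xc c0]]|nl] := pselect (exists c, route x c x /\ c <> [::]).
  exact: der_loop_bounded xc c0.
have only q : ptgt q = x -> q = vpath x.
  move=> qx; have xq := route_path q; rewrite qx in xq.
  have [t qt] := back xq; apply: path_ext => //; rewrite pedges_vpath.
  apply: contrapT => q0; apply: nl; exists (pedges q ++ t); split.
    exact: route_cat qt.
  by case: (pedges q) q0.
have [k k0 hk] := ta_bnd (der_ta (tensor_Lp (vpath x))).
apply: (@der_bounded_by_unit _ (k + k)); first exact: Lp_linear.
move=> A f TAA A1 f1.
have LA : Lp (vpath x) \o A = coef A (vpath x) *: Lp (vpath x).
  apply: funext => g; apply: l2P => q; rewrite opZE l2ZE /= Lp_vpath /= /Lvert_fun.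
  case: eqP => [/only ->|_]; last by rewrite mulr0.
  rewrite (left_op_expand _ _ (tensor_left_op TAA)) big_ord1.
  by rewrite ptake0 pdrop0.
have c1 : normc (coef A (vpath x)) <= 1.
  apply: le_trans (normc_le_l2norm _ _) _; apply: le_trans (A1 _) _.
  by rewrite mul1r l2norm_xi.
have E : Lp (vpath x) (d A f) =
    coef A (vpath x) *: d (Lp (vpath x)) f - d (Lp (vpath x)) (A f).
  have := der_comp (tensor_Lp (vpath x)) TAA; rewrite LA der_scale; last exact: tensor_Lp.
  move=> /(congr1 (fun B => B f)); rewrite opZE opDE /= => ->.
  by rewrite addrC addKr.
rewrite E; apply: le_trans (l2normB _ _) _; apply: lerD.
  apply: le_trans (l2normZ _ _) _; rewrite -[k]mul1r; apply: ler_pM => //.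
  - exact: normc_ge0.
  - exact: l2norm_ge0.
  - by apply: le_trans (hk f) _; rewrite ler_piMr// mul1r.
apply: le_trans (hk _) _; rewrite ler_piMr//.
by apply: le_trans (A1 f) _; rewrite mul1r.
Qed.

Lemma der_finite_bounded (F : seq (vert G)) :
  der_bounded_by (proj (fun q => ptgt q \in F)).
Proof.
elim: F => [|x F [K K0 hK]].
  exists 0 => // Z k _ k0 _ f /=; rewrite !mul0r; apply: l2norm_le => // J _.
  by rewrite big1 ?expr0n// => q _; rewrite projE in_nil normc0 expr0n.
have [K' K'0 hK'] := der_vertex_bounded x.
exists (K' + K); first exact: addr_ge0.
move=> Z k TZ k0 Zk f; rewrite mulrDl mulrDl.
apply: le_trans (lerD (hK' Z k TZ k0 Zk f) (hK Z k TZ k0 Zk f)).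
have [xF|xF] := boolP (x \in F).
  rewrite -[leLHS]add0r; apply: lerD; first exact: l2norm_ge0.
  rewrite le_eqVlt; apply/orP; left; apply/eqP; congr l2norm; apply: l2P => q /=.
  rewrite (projE (fun q => ptgt q \in F)) (projE (fun q => ptgt q \in x :: F)) inE.
  by case: eqP => [->|//]; rewrite xF.
apply: le_trans (l2normD _ _).
rewrite le_eqVlt; apply/orP; left; apply/eqP; congr l2norm; apply: l2P => q /=.
have LE : Lp (vpath x) (d Z f) q = if ptgt q == x then d Z f q else 0.
  by rewrite Lp_vpath.
rewrite -[RHS]/(Lp (vpath x) (d Z f) q + proj (fun q => ptgt q \in F) (d Z f) q) LE.
rewrite (projE (fun q => ptgt q \in F)) (projE (fun q => ptgt q \in x :: F)) inE.
by case: eqP => [->|_] /=; [rewrite (negbTE xF) addr0|rewrite add0r].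
Qed.

(** The constants for finite sets of vertices may grow with the set, so they do not give boundedness
    directly. Here the hump uses the whole algebra as every I, and the stage only records which
    targets are looked at. *)
Theorem derivation_bounded : der_bounded_by id.
Proof.
apply: contrapT => nb.
have unb C : exists A f, [/\ TA A, bnd A 1, l2norm f <= 1 & C < l2norm (d A f)].
  apply: contrapT => h; apply: nb; apply: (@der_bounded_by_unit _ C) => //.
  move=> A f TA' A1 f1; rewrite leNgt; apply/negP => hC.
  by apply: h; exists A, f.
have [K hK] : exists K : seq (vert G) -> R, forall F, 0 <= K F /\
    forall Z k, TA Z -> 0 <= k -> bnd Z k ->
      bnd (proj (fun q => ptgt q \in F) \o d Z) (K F * k).
  have E (F : seq (vert G)) : exists k, 0 <= k /\ forall Z l, TA Z -> 0 <= l -> bnd Z l ->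
      bnd (proj (fun q => ptgt q \in F) \o d Z) (k * l).
    by have [k k0 h] := der_finite_bounded F; exists k.
  by have [K h] := choice E; exists K.
apply: (@gliding_hump (seq (vert G)) [::] (fun=> TA) K
  (fun F => proj (fun q => ptgt q \in F))) => //.
- by move=> _ A.
- by move=> _; exact: ta0.
- by move=> _ A B; exact: ta_add.
- by move=> F; exact: proj_linear.
- by move=> F f; exact: proj_contraction.
- by move=> F; have [] := hK F.
- by move=> F; have [_] := hK F.
move=> F C e e0; have [A [f [TAA A1 f1 hA]]] := unb (`|C| / e).
pose a : R[i] := e%:C; have na : normc a = e by rewrite normc_real ger0_norm// ltW.
have hB : C < l2norm (d (a *: A) f).
  rewrite der_scale// opZE; apply: le_lt_trans (ler_norm C) _.
  rewrite ltr_pdivrMr// mulrC in hA; apply: lt_le_trans hA _.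
  exact: l2norm_pos_scale.
have [J hJ] := proj_exhaust hB.
exists (a *: A), [seq ptgt q | q <- J]; split => //; first exact: ta_scale.
  by have := bndZ a A1; rewrite na mulr1.
by exists f => //; apply: hJ => q qJ; exact: map_f.
Qed.

End AutomaticContinuity.

Section Coefficients.
Variables (R : realType) (G : digraph).
Local Notation H := (l2 R (dipath G)).
Implicit Types (A B : H -> H) (x y : vert G) (p q w : dipath G).

Lemma Lp_xi_vpath p y :
  Lp p (xi R (vpath y)) = if psrc p == y then xi R p else 0.
Proof.
apply: l2P => q; rewrite LpE; case: (boolP (starts p q)) => [h|h]; last first.
  case: eqP => _; last by rewrite l20E.
  rewrite /= /delta_fun; case: eqP => // qp.
  by rewrite qp /starts prefix_refl eqxx in h.
have qE := pedges_pstrip h; have [_ /eqP qt] := andP h.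
rewrite /= /delta_fun; case: (psrc p =P y) => [<-|ne]; last first.
  by case: eqP => // E; case: ne; rewrite -(ptgt_vpath y) -E ptgt_mkp.
rewrite /= /delta_fun; congr (if _ then _ else _); apply/eqP/eqP => [E|->].
  by apply: path_ext => //; rewrite qE E pedges_vpath cats0.
by rewrite /pstrip /psize drop_size mkp_nil.
Qed.

Lemma coef_comp_Lp A p w : left_op A ->
  coef (A \o Lp p) w = if ends p w then coef A (ptake (psize w - psize p) w) else 0.
Proof.
move=> hA; have [bA _] := hA; rewrite /coef /= Lp_xi_vpath.
case: eqP => [_|ne]; first exact: left_op_xi.
rewrite linear_zero; last exact: bounded_linear.
by rewrite l20E ifN// negb_and; apply/orP; right; apply/eqP => E; exact: ne.
Qed.

Lemma psrc_pstrip p w : starts p w -> psrc (pstrip p w) = psrc w.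
Proof. by move=> h; exact: psrc_mkp (starts_route h). Qed.

Lemma coef_Lp_comp A p w :
  coef (Lp p \o A) w = if starts p w then coef A (pstrip p w) else 0.
Proof.
by rewrite /coef /= LpE; case: ifP => // h; rewrite psrc_pstrip.
Qed.

Lemma coefD A B w : coef (A + B) w = coef A w + coef B w. Proof. by []. Qed.

End Coefficients.

(** * Removing off-diagonal terms by random signs *)

Section SignAverage.
Variables (R : realType) (T : eqType).

Definition sgn (b : bool) : R[i] := if b then -1 else 1.

Lemma sgn_mul b : sgn b * sgn b = 1.
Proof. by case: b; rewrite /sgn ?mulrNN mulr1. Qed.

Lemma normc_sgn b : normc (sgn b) = 1.
Proof. by case: b; rewrite /sgn ?normcN normc1. Qed.

(* Averaging over all signs kills the off-diagonal terms. *)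
Lemma sign_average (m : T -> T -> R[i]) (F : seq T) (C : R[i]) (K : R) : uniq F ->
  (forall e : T -> bool,
    normc (C + \sum_(x <- F) \sum_(y <- F) sgn (e x) * sgn (e y) * m x y) <= K) ->
  normc (C + \sum_(x <- F) m x x) <= K.
Proof.
elim: F C => [|z F IH] C /= uF h.
  by have := h (fun=> false); rewrite !big_nil.
case/andP: uF => zF uF; rewrite big_cons addrA; apply: IH => // e.
pose E b x := if x == z then b else e x.
have EF b x : x \in F -> E b x = e x.
  by move=> xF; rewrite /E; case: eqP => // xz; rewrite -xz xF in zF.
have Ez b : E b z = b by rewrite /E eqxx.
set S := \sum_(x <- F) _.
(* The cross terms of z with [F]. They change sign with the sign at z, so averaging the two
   inequalities removes them. *)
pose L := \sum_(y <- F) sgn (e y) * (m z y + m y z).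
have key b : C + \sum_(x <- z :: F) \sum_(y <- z :: F) sgn (E b x) * sgn (E b y) * m x y
    = C + m z z + S + sgn b * L.
  rewrite big_cons big_cons Ez sgn_mul mul1r.
  have -> : \sum_(j <- F) sgn b * sgn (E b j) * m z j
      = sgn b * \sum_(j <- F) sgn (e j) * m z j.
    by rewrite mulr_sumr; apply: eq_big_seq => y yF; rewrite EF// mulrA.
  have -> : \sum_(j <- F) \sum_(y <- z :: F) sgn (E b j) * sgn (E b y) * m j y
      = sgn b * (\sum_(j <- F) sgn (e j) * m j z) + S.
    rewrite mulr_sumr -big_split /=; apply: eq_big_seq => y yF.
    rewrite big_cons Ez EF//; congr (_ + _); first by rewrite mulrA [sgn b * _]mulrC.
    by apply: eq_big_seq => v vF; rewrite EF.
  have -> : L = \sum_(j <- F) sgn (e j) * m z j + \sum_(j <- F) sgn (e j) * m j z.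
    by rewrite -big_split; apply: eq_bigr => y _; rewrite mulrDr.
  by move: (\sum_(j <- F) _) (\sum_(j <- F) _) => s t; ring.
have h1 := h (E true); have h2 := h (E false); rewrite !key in h1 h2.
have -> : C + m z z + S = (2^-1)%:C * ((C + m z z + S + sgn true * L)
    + (C + m z z + S + sgn false * L)).
  rewrite /sgn mulN1r mul1r; move: (C + m z z + S) => t.
  have -> : t - L + (t + L) = 2%:C * t.
    by rewrite (_ : 2%:C = 2 :> R[i]) ?rmorph_nat//; ring.
  by rewrite mulrA -rmorphM mulVf ?pnatr_eq0// mul1r.
rewrite normcM normc_real ger0_norm ?invr_ge0//.
rewrite mulrC ler_pdivrMr//; apply: le_trans (le_normcD _ _) _.
by rewrite mulrDr mulr1; exact: lerD.
Qed.

End SignAverage.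

(** * The implementing operator *)

Section ToeplitzOperators.
Variables (R : realType) (G : digraph).
Local Notation H := (l2 R (dipath G)).
Implicit Types (p q w : dipath G) (a : dipath G -> R[i]) (f : H).

(* The formal series [\sum_w a w L_w] applied to [f]. *)
Definition series_fun a f p : R[i] :=
  \sum_(i < (psize p).+1) a (ptake i p) * f (pdrop i p).

Definition Top a f : H := toL2 (series_fun a f).

(** Testing against the conjugate of h gives S <= K * sqrt S for S the sum of squares. *)
Lemma normc_sum_le_form (J : seq (dipath G)) (h : dipath G -> R[i]) (K : R) :
  0 <= K ->
  (forall g : dipath G -> R[i], normc (\sum_(q <- J) h q * g q)
     <= K * Num.sqrt (\sum_(q <- J) normc (g q) ^+ 2)) ->
  \sum_(q <- J) normc (h q) ^+ 2 <= K ^+ 2.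
Proof.
move=> K0 hK; set S := \sum_(q <- J) _.
have S0 : 0 <= S by apply: sumr_ge0 => q _; exact: sqr_ge0.
have [->|Sn] := eqVneq S 0; first exact: sqr_ge0.
have {Sn}Sp : 0 < Num.sqrt S by rewrite sqrtr_gt0 lt_def Sn S0.
have := hK (fun q => conjc (h q)).
have -> : \sum_(q <- J) h q * conjc (h q) = S%:C.
  rewrite /S rmorph_sum; apply: eq_bigr => q _; case: (h q) => u v /=.
  rewrite sqr_sqrtr ?addr_ge0 ?sqr_ge0//; apply/eqP.
  by rewrite eq_complex /=; apply/andP; split; apply/eqP; ring.
rewrite normc_real ger0_norm//.
under eq_bigr do rewrite normc_conj.
rewrite -/S -{1}(sqr_sqrtr S0) expr2 ler_pM2r// => SK.
by rewrite -(sqr_sqrtr S0) ler_pXn2r// nnegrE// ltW.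
Qed.

Variables (a : dipath G -> R[i]) (K : R).
Hypothesis K0 : 0 <= K.
Hypothesis form : forall f (J : seq (dipath G)) (g : dipath G -> R[i]), uniq J ->
  normc (\sum_(q <- J) series_fun a f q * g q)
     <= K * l2norm f * Num.sqrt (\sum_(q <- J) normc (g q) ^+ 2).

Lemma Top_sum f (J : seq (dipath G)) : uniq J ->
  \sum_(q <- J) normc (series_fun a f q) ^+ 2 <= (K * l2norm f) ^+ 2.
Proof.
move=> uJ; apply: normc_sum_le_form => [|g]; first by rewrite mulr_ge0 ?l2norm_ge0.
exact: form.
Qed.

Lemma TopE f p : Top a f p = series_fun a f p.
Proof.
by have [-> _] := toL2_le (mulr_ge0 K0 (l2norm_ge0 f)) (@Top_sum f).
Qed.

Lemma Top_bnd : bnd (Top a) K.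
Proof.
by move=> f; have [_] := toL2_le (mulr_ge0 K0 (l2norm_ge0 f)) (@Top_sum f).
Qed.

Lemma Top_linear : linear (Top a).
Proof.
move=> c f g; apply: l2P => p; rewrite l2DE l2ZE !TopE /series_fun mulr_sumr -big_split.
by apply: eq_bigr => i _; rewrite l2DE l2ZE /= mulrDr mulrCA.
Qed.

Lemma Top_left_op : left_op (Top a).
Proof.
split; first exact: bnd_bounded Top_linear Top_bnd.
move=> q f; apply: l2P => p; rewrite TopE RqE TopE /series_fun.
have RE i : Rq q f (pdrop i p) = if ends q (pdrop i p)
    then f (ptake (psize p - i - psize q) (pdrop i p)) else 0.
  by rewrite RqE psize_pdrop.
have [h|h] := boolP (ends q p); last first.
  apply: big1 => i _; rewrite RE ifN ?mulr0//; apply: contra h.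
  rewrite /ends psrc_pdrop pedges_pdrop => /andP[h ->]; rewrite andbT.
  exact: suffix_trans h (suffix_drop _ _).
have [/size_suffix qp _] := andP h; set m := (psize p - psize q)%N.
(* Cuts beyond position m leave a right factor shorter than q, on which [Rq q f] vanishes; the first
   m + 1 cuts are those of the left factor. *)
have mE : (psize p).+1 = (m.+1 + psize q)%N by rewrite addSn subnK.
have sm : psize (ptake m p) = m.
  by rewrite /psize pedges_ptake size_takel// leq_subr.
rewrite mE big_split_ord /= [X in _ + X]big1 ?addr0 => [|i _]; last first.
  rewrite RE ifN ?mulr0//; apply/negP => /andP[/size_suffix].
  rewrite -/(psize q) pedges_pdrop size_drop -/(psize p) leqNgt => /negP[].
  have pE : psize p = (m + psize q)%N by rewrite subnK.
  rewrite {1}pE addSn -addnS subnDl ltn_subrL /=.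
  exact: leq_ltn_trans (ltn_ord i).
rewrite sm; apply: eq_bigr => i _; have im : (i <= m)%N by rewrite -ltnS.
have tt : take i (take m (pedges p)) = take i (pedges p) by rewrite take_takel.
congr (a _ * _).
  by apply: path_ext; rewrite ?ptgt_ptake// !pedges_ptake tt.
have ie : ends q (pdrop i p).
  case/andP: h => h1 h2; rewrite /ends psrc_pdrop h2 andbT pedges_pdrop.
  apply: suffix_linear h1 (suffix_drop _ _) _.
  rewrite size_drop leq_subRL ?(leq_trans im) ?leq_subr//.
  by rewrite addnC -leq_subRL.
rewrite RE ie; congr (f _); apply: path_ext.
  by rewrite ptgt_ptake /pdrop !ptgt_mkp pedges_ptake tt.
rewrite pedges_ptake !pedges_pdrop pedges_ptake take_drop; congr (drop _ (take _ _)).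
by rewrite subnAC -/m subnK.
Qed.

Lemma coef_Top w : coef (Top a) w = a w.
Proof.
rewrite /coef TopE /series_fun big_ord_recr /= big1 ?add0r => [|i _].
  rewrite ptake_size /delta_fun.
  have -> : pdrop (psize w) w = vpath (psrc w).
    apply: path_ext; last by rewrite pedges_pdrop /psize drop_size.
    by rewrite -psrc_ptake ptake_size.
  by rewrite eqxx mulr1.
rewrite /delta_fun; case: eqP => [E|]; last by rewrite mulr0.
have := congr1 (size \o @pedges G) E; rewrite /= pedges_pdrop size_drop.
by move=> /eqP; rewrite subn_eq0 leqNgt ltn_ord.
Qed.

End ToeplitzOperators.

(** * Coefficients of the implementing operator and their norm bound *)

Section Implementation.
Variables (R : realType) (G : digraph).
Local Notation H := (l2 R (dipath G)).
Local Notation TA := (tensor_algebra R G).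
Variable d : (H -> H) -> (H -> H).
Hypothesis hd : derivation TA d.
Hypothesis back : forall (x y : vert G) s, route x s y -> exists t, route y t x.
Variable D : R.
Hypothesis D0 : 0 <= D.
Hypothesis dD : forall A, TA A -> bnd A 1 -> bnd (d A) D.
Implicit Types (A B : H -> H) (x y : vert G) (p q w : dipath G) (f : H).

Let tL p : TA (Lp p). Proof. exact: tensor_Lp. Qed.
Let tdL p : TA (d (Lp p)). Proof. exact: der_ta. Qed.
Let ldL p : left_op (d (Lp p)). Proof. by apply: tensor_left_op. Qed.

Lemma coef_der_comp p q w :
  coef (d (Lp p \o Lp q)) w =
    (if ends q w then coef (d (Lp p)) (ptake (psize w - psize q) w) else 0)
    + (if starts p w then coef (d (Lp q)) (pstrip p w) else 0).
Proof. by rewrite der_comp// coefD coef_comp_Lp// coef_Lp_comp. Qed.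

Definition pcoef x s t := coef (d (Lp (mkp x s))) (mkp x t).

Lemma pcoef_derivation x y z s1 s2 t : route x s1 y -> route y s2 z ->
  route x t z ->
  pcoef x (s1 ++ s2) t = Rt t s2 (pcoef x s1) + Lt s1 t (pcoef y s2).
Proof.
move=> xs1 ys2 xt; rewrite /pcoef (LpD R xs1 ys2) coef_der_comp.
have c1 := route_chain xs1; have c2 := route_chain ys2; have ct := route_chain xt.
rewrite /ends /starts /ptake /pstrip !ptgt_mkp /psize !pedges_mkp// (psrc_mkp xt).
by rewrite (psrc_mkp ys2) (psrc_mkp xs1) !eqxx !andbT.
Qed.

(** These are coordinates of the single vector d(L_s) xi_z, whose norm is at most D. *)
Lemma pcoef_bounded x z s J : route x s z -> uniq J ->
  (forall t, t \in J -> route x t z) ->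
  \sum_(t <- J) normc (pcoef x s t) ^+ 2 <= D ^+ 2.
Proof.
move=> xs uJ hJ; pose h := d (Lp (mkp x s)) (xi R (vpath z)).
have nh : l2norm h <= D.
  apply: le_trans (dD (tL _) (@Lp_bnd R G _) _) _.
  by rewrite ler_piMr// l2norm_xi.
have uJ' : uniq [seq mkp x t | t <- J].
  rewrite map_inj_in_uniq// => t t' /hJ/route_chain ht /hJ/route_chain ht' E.
  by rewrite -(pedges_mkp ht) E pedges_mkp.
apply: (@le_trans _ _ (l2norm h ^+ 2)); last first.
  by rewrite ler_pXn2r// nnegrE ?l2norm_ge0.
apply: le_trans (sum_le_l2norm h uJ'); rewrite big_map.
rewrite big_seq_cond [leRHS]big_seq_cond; apply: ler_sum => t /andP[tJ _].
by rewrite /pcoef /coef (psrc_mkp (hJ t tJ)).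
Qed.

Variable a : vert G -> seq (edge G) -> R[i].
Hypothesis aP : forall x y s t, route x s y -> route x t y ->
  pcoef x s t = Lt s t (a y) - Rt t s (a x).

(** The coefficients of T. At a path that is not a loop the value is forced: the coefficient of L_x
    T - T L_x at a path w with target x and another source is that of T. *)
Definition symbol w := if ptgt w == psrc w then a (ptgt w) (pedges w)
  else coef (d (Lp (vpath (ptgt w)))) w.

Lemma ends_vpath y w : ends (vpath y) w = (psrc w == y).
Proof. by rewrite /ends pedges_vpath /suffix prefix0s. Qed.

Lemma starts_vpath x w : starts (vpath x) w = (ptgt w == x).
Proof. by rewrite /starts pedges_vpath prefix0s. Qed.

Lemma pstrip_vpath w : pstrip (vpath (ptgt w)) w = w.
Proof. by rewrite /pstrip psrc_vpath /psize pedges_vpath drop0 mkpK. Qed.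

Lemma ptake_vpath y w : ptake (psize w - psize (vpath y)) w = w.
Proof. by rewrite /psize pedges_vpath subn0 ptake_size. Qed.

Lemma coef_der_symbol p w : coef (d (Lp p)) w =
  (if starts p w then symbol (pstrip p w) else 0)
  - (if ends p w then symbol (ptake (psize w - psize p) w) else 0).
Proof.
have [src|src] := eqVneq (psrc w) (psrc p); last first.
  have eF : ends p w = false by rewrite /ends (negbTE src) andbF.
  (* Different sources: writing L_p = L_p L_(s(p)) reduces to the coefficient of d(L_(s(p))) at a
     path that is not a loop. *)
  have E : Lp p = Lp p \o Lp (vpath (psrc p)) :> (H -> H) by rewrite Lp_comp_vert eqxx.
  rewrite eF subr0 {1}E coef_der_comp ends_vpath (negbTE src) add0r.
  case: ifP => // h; rewrite /symbol {1}/pstrip ptgt_mkp psrc_pstrip// eq_sym (negbTE src).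
  by [].
have [tgt|tgt] := eqVneq (ptgt w) (ptgt p); last first.
  have sF : starts p w = false by rewrite /starts (negbTE tgt) andbF.
  have E : Lp p = Lp (vpath (ptgt p)) \o Lp p :> (H -> H) by rewrite Lp_vert_comp eqxx.
  rewrite sF sub0r {1}E coef_der_comp starts_vpath (negbTE tgt) addr0.
  case: ifP => h; last by rewrite oppr0.
  set v := ptake _ _; have vs : psrc v = ptgt p by rewrite psrc_ptake ends_pdrop.
  have vt : ptgt v = ptgt w by rewrite ptgt_ptake.
  have ne : ptgt v != psrc v by rewrite vs vt.
  rewrite /symbol (negbTE ne).
  (* Different targets yield the coefficient of d at the source vertex of v instead of its target
     vertex; applying d to the product L_(r(v)) L_(s(v)) = 0 shows that the two are opposite. *)
  have : Lp (vpath (ptgt v)) \o Lp (vpath (psrc v)) = 0 :> (H -> H).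
    by rewrite Lp_vert_comp ptgt_vpath eq_sym (negbTE ne).
  move=> /(congr1 (fun A => coef (d A) v)); rewrite coef_der_comp der0// ends_vpath eqxx.
  rewrite starts_vpath eqxx ptake_vpath pstrip_vpath vs => E0.
  apply/eqP; rewrite -addr_eq0 addrC; apply/eqP; exact: E0.
have xp := route_path p; have xw := route_path w; rewrite tgt src in xw.
have pw : mkp (ptgt p) (pedges w) = w by rewrite -tgt mkpK.
have := aP xp xw; rewrite /pcoef mkpK pw => ->.
rewrite /Lt /Rt /starts /ends tgt src !eqxx !andbT; congr (_ - _).
  case: ifP => // h; have st : starts p w by rewrite /starts tgt h eqxx.
  rewrite /symbol psrc_pstrip// {1 2}/pstrip !ptgt_mkp src eqxx.
  by rewrite /pstrip pedges_mkp// (route_chain (starts_route st)).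
case: ifP => // h; have en : ends p w by rewrite /ends src h eqxx.
rewrite /symbol ptgt_ptake psrc_ptake ends_pdrop// tgt eqxx pedges_ptake.
by [].
Qed.

Lemma symbol_short p w : (psize w < psize p)%N -> coef (d (Lp p)) w = 0.
Proof.
move=> wp; rewrite coef_der_symbol /starts /ends !ifN ?subrr//.
  by apply: contraL wp => /andP[/size_suffix h _]; rewrite -leqNgt.
by apply: contraL wp => /andP[/size_prefix h _]; rewrite -leqNgt.
Qed.

Definition pmul p q := mkp (ptgt p) (pedges p ++ pedges q).

Lemma pedges_pmul p q : psrc p = ptgt q -> pedges (pmul p q) = pedges p ++ pedges q.
Proof. by move=> h; rewrite pedges_mkp// (route_chain (pmul_route (esym h))). Qed.

Lemma psize_pmul p q : psrc p = ptgt q -> psize (pmul p q) = (psize p + psize q)%N.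
Proof. by move=> h; rewrite /psize pedges_pmul// size_cat. Qed.

Lemma psrc_pmul p q : psrc p = ptgt q -> psrc (pmul p q) = psrc q.
Proof. by move=> h; exact: psrc_mkp (pmul_route (esym h)). Qed.

Lemma ptake_pmul i p q : psrc p = ptgt q ->
  ptake (psize p + i) (pmul p q) = pmul p (ptake i q).
Proof.
move=> h; apply: path_ext; first by rewrite ptgt_ptake !ptgt_mkp.
rewrite pedges_ptake !pedges_pmul ?ptgt_ptake// pedges_ptake take_cat.
by rewrite /psize ltnNge leq_addr /= addKn.
Qed.

Lemma pdrop_pmul i p q : psrc p = ptgt q -> pdrop (psize p + i) (pmul p q) = pdrop i q.
Proof.
move=> h; have e : pedges (pdrop (psize p + i) (pmul p q)) = pedges (pdrop i q).
  rewrite !pedges_pdrop pedges_pmul// drop_cat /psize ltnNge leq_addr /=.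
  by rewrite addKn.
apply: path_ext => //.
have h1 := route_path (pdrop (psize p + i) (pmul p q)).
have h2 := route_path (pdrop i q).
rewrite e psrc_pdrop psrc_pmul// in h1; rewrite psrc_pdrop in h2.
by rewrite (route_target h1) (route_target h2).
Qed.

(** Coefficients of d(L_p) at paths shorter than p vanish, so only cuts inside the factor q
    contribute. *)
Lemma der_Lp_pmul p q f : psrc p = ptgt q ->
  d (Lp p) f (pmul p q) =
    \sum_(i < (psize q).+1) coef (d (Lp p)) (pmul p (ptake i q)) * f (pdrop i q).
Proof.
move=> h; rewrite (left_op_expand _ _ (ldL p)) psize_pmul// -addnS.
rewrite big_split_ord /= big1 ?add0r => [|i _].
  by apply: eq_bigr => i _; rewrite ptake_pmul// pdrop_pmul.
rewrite symbol_short ?mul0r// /psize pedges_ptake size_take.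
by apply: leq_ltn_trans (ltn_ord i); exact: geq_minl.
Qed.

Hypothesis aN : forall (F : seq (vert G)) (U : seq (vert G * seq (edge G))),
  exists (M : nat) (pi : nat -> vert G -> vert G * seq (edge G)), [/\ (0 < M)%N,
    forall k x, x \in F -> route (pi k x).1 (pi k x).2 x,
    forall k x y, x \in F -> y \in F -> x <> y -> (pi k x).1 = (pi k y).1 ->
      ~~ prefix (pi k x).2 (pi k y).2 &
    forall x u, (x, u) \in U -> x \in F -> route x u x ->
      \sum_(k < M) pcoef (pi k x).1 (pi k x).2 ((pi k x).2 ++ u) = M%:R * a x u].

(* Paths issued from the vertices of [F] none of which is an initial segment
   of another: the operators [L_(P x)] are partial isometries with pairwise
   orthogonal initial and final spaces. *)
Definition prefix_free (F : seq (vert G)) (P : vert G -> dipath G) :=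
  (forall x, x \in F -> psrc (P x) = x) /\
  forall x y q, x \in F -> y \in F -> starts (P x) q -> starts (P y) q -> x = y.

Lemma prefix_free_mkp (F : seq (vert G)) (pi : vert G -> vert G * seq (edge G)) :
  (forall x, x \in F -> route (pi x).1 (pi x).2 x) ->
  (forall x y, x \in F -> y \in F -> x <> y -> (pi x).1 = (pi y).1 ->
     ~~ prefix (pi x).2 (pi y).2) ->
  prefix_free F (fun x => mkp (pi x).1 (pi x).2).
Proof.
move=> hr hp; split=> [x xF|x y q xF yF].
  exact: psrc_mkp (hr x xF).
have cx := route_chain (hr x xF); have cy := route_chain (hr y yF).
rewrite /starts !ptgt_mkp !pedges_mkp// => /andP[px /eqP tx] /andP[py /eqP ty].
apply: contrapT => xy; have E : (pi x).1 = (pi y).1 by rewrite -tx ty.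
have [le|/ltnW le] := leqP (size (pi x).2) (size (pi y).2).
  by have := hp x y xF yF xy E; rewrite (prefix_linear px py).
by have := hp y x yF xF (fun h => xy (esym h)) (esym E); rewrite (prefix_linear py px).
Qed.

Lemma sum_indicator (F : seq (vert G)) (z : vert G -> R[i]) x0 : uniq F ->
  x0 \in F -> \sum_(x <- F) (x0 == x)%:R * z x = z x0.
Proof.
move=> uF xF; rewrite (bigD1_seq x0)//= eqxx mul1r big1 ?addr0// => x.
by rewrite eq_sym => /negbTE ->; rewrite mul0r.
Qed.

(** At most one P x is an initial segment of a given path, so the sum is a single weighted shift;
    [X] finds that x, and the default of [nth] is never reached on the support. *)
Lemma signed_sum_contraction (F : seq (vert G)) P (e : vert G -> bool) :
  uniq F -> prefix_free F P ->
  bnd (\sum_(x <- F) sgn R (e x) *: @Lp R G (P x)) 1.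
Proof.
move=> uF [Ps Pf]; pose X q := nth (ptgt q) F (find (fun x => starts (P x) q) F).
pose h q := has (fun x => starts (P x) q) F.
have XF q : h q -> X q \in F by move=> hq; rewrite mem_nth// -has_find.
have Xs q : h q -> starts (P (X q)) q by move=> hq; exact: (nth_find (ptgt q) hq).
pose c q : R[i] := if h q then sgn R (e (X q)) else 0.
have hc q : c q != 0 -> h q by rewrite /c; case: ifP => //; rewrite eqxx.
pose tau q := pstrip (P (X q)) q.
have c1 q : normc (c q) <= 1 by rewrite /c; case: ifP => _; rewrite ?normc_sgn ?normc0.
have tau_inj q q' : c q != 0 -> c q' != 0 -> tau q = tau q' -> q = q'.
  move=> /hc hq /hc hq' E; have XX : X q = X q'.
    by have := congr1 (@ptgt G) E; rewrite /tau !ptgt_mkp !Ps// XF.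
  move: E; rewrite /tau XX; apply: (@pstrip_inj R).
    by rewrite -XX Xs// oner_neq0.
  by rewrite Xs// oner_neq0.
suff -> : \sum_(x <- F) sgn R (e x) *: @Lp R G (P x) = wop c tau by exact: wop_bnd.
apply: funext => f; apply: l2P => q; rewrite wopE// op_sumE l2_sumE.
have [hq|hq] := boolP (h q).
  rewrite (bigD1_seq (X q)) ?XF//= big1_seq => [|x /andP[xX xF]].
    by rewrite addr0 -[LHS]/(sgn R (e (X q)) * Lp (P (X q)) f q) LpE Xs// /c hq.
  rewrite -[LHS]/(sgn R (e x) * Lp (P x) f q) LpE ifN ?mulr0//; apply: contra xX => xs.
  by apply/eqP; apply: (Pf _ _ q) => //; [exact: XF|exact: Xs].
rewrite /c (negbTE hq) mul0r big1_seq// => x /andP[_ xF].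
rewrite -[LHS]/(sgn R (e x) * Lp (P x) f q) LpE ifN ?mulr0//; apply: contra hq => xs.
by apply/hasP; exists x.
Qed.

Lemma der_sum (I : eqType) (r : seq I) (c : I -> R[i]) (F : I -> H -> H) :
  (forall i, i \in r -> TA (F i)) ->
  d (\sum_(i <- r) c i *: F i) = \sum_(i <- r) c i *: d (F i).
Proof.
elim: r => [|i r IH] h; first by rewrite !big_nil der0.
rewrite !big_cons der_comb//; first by rewrite IH// => j jr; apply: h; rewrite inE jr orbT.
  by apply: h; rewrite inE eqxx.
apply: subalgebra_sum => [|j jr]; first exact: tensor_subalgebra.
by apply: h; rewrite inE jr orbT.
Qed.

(** Evaluate d of the signed sum at the paths P(r(q)) q, with the sign of r(q) as a further weight.
    Cauchy-Schwarz bounds this for every sign pattern, and averaging leaves the diagonal, where path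
    and operator belong to one vertex. *)
Lemma compressed_form (F : seq (vert G)) P f (J : seq (dipath G)) g :
  uniq F -> prefix_free F P -> uniq J -> (forall q, q \in J -> ptgt q \in F) ->
  normc (\sum_(q <- J) d (Lp (P (ptgt q))) f (pmul (P (ptgt q)) q) * g q)
    <= D * l2norm f * Num.sqrt (\sum_(q <- J) normc (g q) ^+ 2).
Proof.
move=> uF PF uJ JF; have [Ps Pf] := PF.
pose phi q := pmul (P (ptgt q)) q.
have Pq q : q \in J -> psrc (P (ptgt q)) = ptgt q by move=> /JF; exact: Ps.
have phis q : q \in J -> starts (P (ptgt q)) (phi q).
  by move=> qJ; have [] := pstrip_mul (esym (Pq q qJ)).
have phi_inj : {in J &, injective phi}.
  move=> q q' qJ q'J E; have T : ptgt q = ptgt q'.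
    by apply: (Pf _ _ (phi q)); rewrite ?JF ?phis// E phis.
  have := congr1 (@pedges G) E; rewrite /phi !pedges_pmul ?Pq// T => /eqP.
  by rewrite eqseq_cat// eqxx /= => /eqP; exact: path_ext.
(* Here x is the vertex of the test path and y that of the operator. *)
pose m x y := \sum_(q <- J) (ptgt q == x)%:R * (d (Lp (P y)) f (phi q) * g q).
have -> : \sum_(q <- J) d (Lp (P (ptgt q))) f (pmul (P (ptgt q)) q) * g q
    = 0 + \sum_(x <- F) m x x.
  rewrite add0r exchange_big /=; apply: eq_big_seq => q qJ.
  by rewrite (sum_indicator (fun x => d (Lp (P x)) f (phi q) * g q))// JF.
apply: sign_average => // e; rewrite add0r.
pose A := \sum_(x <- F) sgn R (e x) *: @Lp R G (P x).
have TAA : TA A by apply: subalgebra_sum; [exact: tensor_subalgebra|].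
have dA : bnd (d A) D by apply: dD => //; exact: signed_sum_contraction.
have -> : \sum_(x <- F) \sum_(y <- F) sgn R (e x) * sgn R (e y) * m x y
    = \sum_(q <- J) sgn R (e (ptgt q)) * d A f (phi q) * g q.
  have E x y : sgn R (e x) * sgn R (e y) * m x y = \sum_(q <- J) (ptgt q == x)%:R *
      (sgn R (e x) * (sgn R (e y) * d (Lp (P y)) f (phi q)) * g q).
    by rewrite /m mulr_sumr; apply: eq_bigr => q _; ring.
  under eq_bigr do under eq_bigr do rewrite E.
  under eq_bigr do rewrite exchange_big /=.
  rewrite exchange_big /=; apply: eq_big_seq => q qJ.
  under eq_bigr do rewrite -mulr_sumr -mulr_suml -mulr_sumr.
  rewrite (sum_indicator (fun x => sgn R (e x) *
    (\sum_(i <- F) sgn R (e i) * d (Lp (P i)) f (phi q)) * g q))//; last exact: JF.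
  rewrite /A der_sum// op_sumE l2_sumE; congr (_ * _ * _).
apply: le_trans (ler_normc_sum _ _) _.
under eq_bigr do rewrite !normcM normc_sgn mul1r.
apply: CauchySchwarz_le.
- by rewrite mulr_ge0 ?l2norm_ge0.
- exact: sqrtr_ge0.
- apply: (@le_trans _ _ (l2norm (d A f) ^+ 2)); last first.
    by rewrite ler_pXn2r ?nnegrE ?l2norm_ge0 ?mulr_ge0 ?l2norm_ge0//; exact: dA.
  have uphi : uniq [seq phi q | q <- J] by rewrite map_inj_in_uniq.
  by apply: le_trans (sum_le_l2norm _ uphi); rewrite big_map.
- by rewrite sqr_sqrtr//; apply: sumr_ge0 => q _; exact: sqr_ge0.
Qed.

Lemma symbol_form f (J : seq (dipath G)) (g : dipath G -> R[i]) : uniq J ->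
  normc (\sum_(q <- J) series_fun symbol f q * g q)
     <= D * l2norm f * Num.sqrt (\sum_(q <- J) normc (g q) ^+ 2).
Proof.
move=> uJ; pose F := undup [seq ptgt q | q <- J].
have uF : uniq F by exact: undup_uniq.
have JF q : q \in J -> ptgt q \in F by move=> qJ; rewrite mem_undup map_f.
(* All left factors of the paths in [J]: the only places where the expansion below meets the
   symbol. *)
pose U := [seq (ptgt q, take i (pedges q)) | q <- J, i <- iota 0 (psize q).+1].
have [M [pi [M0 pr pf pN]]] := aN F U.
pose P k x := mkp (pi k x).1 (pi k x).2.
have PF k : prefix_free F (P k).
  by apply: prefix_free_mkp => [x|x y]; [exact: pr|exact: pf].
have avg q i : q \in J -> (i <= psize q)%N ->
    \sum_(k < M) coef (d (Lp (P k (ptgt q)))) (pmul (P k (ptgt q)) (ptake i q))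
      = M%:R * symbol (ptake i q).
  move=> qJ iq; set u := ptake i q; have ut : ptgt u = ptgt q by exact: ptgt_ptake.
  have Pu k : psrc (P k (ptgt q)) = ptgt u by rewrite ut; apply: (PF k).1; exact: JF.
  have [lp|nlp] := eqVneq (ptgt u) (psrc u).
    rewrite /symbol lp eqxx -lp ut -pN ?JF//.
    - apply: eq_bigr => k _; rewrite /pcoef /pmul /P ptgt_mkp pedges_mkp//.
      exact: route_chain (pr k _ (JF q qJ)).
    - rewrite /u pedges_ptake; apply/allpairsPdep; exists q, i; split => //.
      by rewrite mem_iota add0n ltnS.
    - by have := route_path u; rewrite -lp ut.
  (* When u is not a loop every k already gives the symbol exactly: p u starts with p but, having
     another source than p, does not end with p. *)
  have one k : coef (d (Lp (P k (ptgt q)))) (pmul (P k (ptgt q)) u) = symbol u.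
    have [h1 h2] := pstrip_mul (esym (Pu k)).
    rewrite coef_der_symbol /pmul h1 h2 ifN ?subr0//.
    by rewrite /ends -/(pmul _ _) psrc_pmul// Pu eq_sym (negbTE nlp) andbF.
  by under eq_bigr do rewrite one; rewrite sumr_const card_ord mulr_natl.
pose B := D * l2norm f * Num.sqrt (\sum_(q <- J) normc (g q) ^+ 2).
have E : M%:R * (\sum_(q <- J) series_fun symbol f q * g q) = \sum_(k < M)
    \sum_(q <- J) d (Lp (P k (ptgt q))) f (pmul (P k (ptgt q)) q) * g q.
  rewrite exchange_big mulr_sumr /=; apply: eq_big_seq => q qJ.
  rewrite -mulr_suml mulrA; congr (_ * _).
  have ex k : d (Lp (P k (ptgt q))) f (pmul (P k (ptgt q)) q) =
    \sum_(i < (psize q).+1) coef (d (Lp (P k (ptgt q))))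
       (pmul (P k (ptgt q)) (ptake i q)) * f (pdrop i q).
    by apply: der_Lp_pmul; apply: (PF k).1; exact: JF.
  under eq_bigr do rewrite ex.
  rewrite exchange_big /= mulr_sumr; apply: eq_bigr => i _.
  by rewrite -mulr_suml avg// ?mulrA// -ltnS.
have Mp : 0 < M%:R :> R by rewrite ltr0n.
have nM : normc (M%:R : R[i]) = M%:R.
  by rewrite -[X in normc X](rmorph_nat (real_complex R)) normc_real ger0_norm ?ltW.
rewrite -(ler_pM2l Mp) -{1}nM -normcM E.
apply: le_trans (ler_normc_sum _ _) _.
apply: (@le_trans _ _ (\sum_(k < M) B)).
  by apply: ler_sum => k _; exact: (compressed_form f g uF (PF k) uJ JF).
by rewrite sumr_const card_ord mulr_natl.
Qed.

End Implementation.

(** * Agreement of the derivation with the commutator *)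

Section InnerDerivation.
Variables (R : realType) (G : digraph).
Local Notation H := (l2 R (dipath G)).
Local Notation TA := (tensor_algebra R G).
Variable d : (H -> H) -> (H -> H).
Hypothesis hd : derivation TA d.
Variable K : R.
Hypothesis K0 : 0 <= K.
Hypothesis dK : forall A k, TA A -> 0 <= k -> bnd A k -> bnd (d A) (K * k).
Variables (T : H -> H) (D : R).
Hypothesis TL : left_op T.
Hypothesis D0 : 0 <= D.
Hypothesis TD : bnd T D.
Hypothesis coefT : forall p w, coef (d (Lp p)) w =
  (if starts p w then coef T (pstrip p w) else 0)
  - (if ends p w then coef T (ptake (psize w - psize p) w) else 0).

Let lT : linear T. Proof. by have [[]] := TL. Qed.

Lemma der_Lp_inner p : d (Lp p) = inner_derivation T (Lp p).
Proof.
have LL : left_op (@Lp R G p) by apply: tensor_left_op; exact: tensor_Lp.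
have [_ _ lc lm] := left_op_algebra R G.
apply: left_op_ext => [||w].
- by apply: tensor_left_op; apply: der_ta => //; exact: tensor_Lp.
- rewrite /inner_derivation -scaleN1r addrC; apply: lc; exact: lm.
rewrite coefT /inner_derivation -[RHS]/(coef (Lp p \o T) w - coef (T \o Lp p) w).
by rewrite coef_Lp_comp coef_comp_Lp.
Qed.

Lemma Ledge_Lp e : @Ledge R G e = Lp (mkp (tgt e) [:: e]).
Proof.
rewrite (Lp_cons R (route_refl (src e))) mkp_nil; apply: funext => f; apply: l2P => p.
rewrite /= Lp_vpath /Ledge_fun /= /Lvert_fun.
case pE: (pedges p) => [|e' s] //=; case: eqP => // -[e'e].
by rewrite (pbehead_tgt pE) e'e eqxx.
Qed.

(** The elements where the two derivations agree form a norm-closed subalgebra containing the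
    generators; closedness uses the boundedness of d and of T. *)
Lemma derivation_inner A : TA A -> d A = inner_derivation T A.
Proof.
pose N : set (H -> H) := [set B | TA B /\ d B = inner_derivation T B].
suff NA : TA `<=` N by move=> /NA[].
move=> B; apply; split; last first.
  move=> _ [[e _ <-]|[x _ <-]]; split.
  - by rewrite Ledge_Lp; exact: tensor_Lp.
  - by rewrite Ledge_Lp der_Lp_inner.
  - by rewrite -Lp_vpath; exact: tensor_Lp.
  - by rewrite -Lp_vpath der_Lp_inner.
split; first split.
- by move=> C [/tensor_bounded].
- split; first exact: ta0.
  rewrite der0//; apply: funext => f; rewrite /inner_derivation opBE /=.
  by rewrite op0E linear_zero// subrr.
- move=> a A1 A2 [T1 E1] [T2 E2]; split; first exact: ta_comb.
  rewrite der_comb// E1 E2 /inner_derivation; apply: funext => f.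
  change (a *: (A1 (T f) - T (A1 f)) + (A2 (T f) - T (A2 f))
    = a *: A1 (T f) + A2 (T f) - T (a *: A1 f + A2 f)).
  rewrite lT scalerBr.
  by rewrite addrACA -opprD.
- move=> A1 A2 [T1 E1] [T2 E2]; split; first exact: ta_comp.
  rewrite der_comp// E1 E2 /inner_derivation; apply: funext => f.
  change (A1 (T (A2 f)) - T (A1 (A2 f)) + A1 (A2 (T f) - T (A2 f))
    = A1 (A2 (T f)) - T (A1 (A2 f))).
  rewrite linear_sub; last exact: ta_lin.
  by rewrite addrC addrA subrK.
move=> {}A bA h.
have TAA : TA A by apply: tensor_closed => // e e0; have [C [TC _] AC] := h e e0; exists C.
split => //; apply: funext => f; apply/eqP; rewrite -subr_eq0; apply/eqP.
apply: l2norm_eq0; apply/eqP; rewrite eq_le l2norm_ge0 andbT.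
apply/ler_addgt0Pr => r r0; rewrite add0r.
pose Q := (K + 2 * D) * l2norm f + 1.
have KD : 0 <= (K + 2 * D) * l2norm f by rewrite mulr_ge0 ?l2norm_ge0 ?addr_ge0 ?mulr_ge0.
have Q0 : 0 < Q by rewrite ltr_pwDr.
have [|C [TC EC] AC] := h (r / Q); first by rewrite divr_gt0.
have rQ : 0 <= r / Q by rewrite divr_ge0 ?ltW.
have TAC : TA (A - C) by exact: ta_sub.
have bAC : bnd (A - C) (r / Q).
  by apply: opnorm_bnd; [exact: ta_lin|exact: ltW].
have dE : d A = d (A - C) + d C by rewrite -der_add// subrK.
have -> : d A f - inner_derivation T A f =
    d (A - C) f - ((A - C) (T f) - T ((A - C) f)).
  rewrite dE opDE EC.
  change (d (A - C) f + (C (T f) - T (C f)) - (A (T f) - T (A f))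
    = d (A - C) f - ((A (T f) - C (T f)) - T (A f - C f))).
  rewrite (linear_sub _ _ lT).
  move: (d _ f) (C (T f)) (T (C f)) (A (T f)) (T (A f)) => u1 u2 u3 u4 u5.
  rewrite -addrA; congr (u1 + _).
  by rewrite !opprB addrACA [RHS]addrACA [u5 + u2]addrC.
apply: (@le_trans _ _ (r / Q * (K * l2norm f + (D * l2norm f + D * l2norm f)))).
  apply: le_trans (l2normB _ _) _; rewrite mulrDr; apply: lerD.
    by rewrite mulrA [_ * K]mulrC; exact: dK.
  apply: le_trans (l2normB _ _) _; rewrite mulrDr; apply: lerD.
    by apply: le_trans (bAC _) _; rewrite ler_wpM2l.
  by apply: le_trans (TD _) _; rewrite mulrCA ler_wpM2l.
rewrite mulrAC ler_pdivrMr// ler_wpM2l ?ltW// /Q.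
by have := l2norm_ge0 f; lra.
Qed.

End InnerDerivation.

(** * Weak approximation by Cesaro means *)

Section WeakApproximation.
Variables (R : realType) (X : choiceType).
Local Notation H := (l2 R X).

Lemma normc_le_ReIm (z : R[i]) :
  normc z <= `|complex.Re z| + `|complex.Im z|.
Proof.
have zE : z = (complex.Re z)%:C + 'i%C * (complex.Im z)%:C.
  by case: z => u v; apply/eqP; rewrite eq_complex /=; apply/andP; split; apply/eqP; ring.
rewrite {1}zE; apply: le_trans (le_normcD _ _) _; rewrite normcM !normc_real.
have -> : normc ('i%C : R[i]) = 1 by rewrite /= expr0n expr1n add0r sqrtr1.
by rewrite mul1r.
Qed.

Lemma Re_le_normc (z : R[i]) : `|complex.Re z| <= normc z.
Proof.
case: z => u v /=; rewrite -(sqrtr_sqr u); apply: ler_wsqrtr.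
by rewrite lerDl sqr_ge0.
Qed.

Lemma Im_le_normc (z : R[i]) : `|complex.Im z| <= normc z.
Proof.
case: z => u v /=; rewrite -(sqrtr_sqr v); apply: ler_wsqrtr.
by rewrite lerDr sqr_ge0.
Qed.

Lemma rsum_le (f : X -> R) (K : R) :
  (forall J, uniq J -> \sum_(x <- J) `|f x| <= K) -> `|rsum f| <= K + K.
Proof.
move=> h; have K0 : 0 <= K by have := h [::] isT; rewrite big_nil.
have part (g : X -> \bar R) : (forall x, (0 <= g x <= `|f x|%:E)%E) ->
    (0 <= \esum_(x in [set: X]) g x <= K%:E)%E.
  move=> hg; apply/andP; split; first by apply: esum_ge0 => x _; case/andP: (hg x).
  apply: ge_ereal_sup => _ [A [finA _] <-]; rewrite fsbig_finite//=.
  apply: le_trans (lee_sum _ (fun x _ => _ : _ <= `|f x|%:E)%E) _.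
    by move=> x _; case/andP: (hg x).
  by rewrite sumEFin lee_fin; exact: h.
have hp x : (0 <= (EFin \o f)^\+ x <= `|f x|%:E)%E.
  rewrite funeposE /= -EFin_max !lee_fin le_max lexx orbT ge_max normr_ge0.
  by rewrite ler_norm.
have hn x : (0 <= (EFin \o f)^\- x <= `|f x|%:E)%E.
  rewrite funenegE /= -EFin_max !lee_fin le_max lexx orbT ge_max normr_ge0.
  by rewrite -normrN ler_norm.
have /andP[p0 pK] := part _ hp; have /andP[n0 nK] := part _ hn.
rewrite /rsum; move: p0 pK n0 nK.
move: (\esum_(x in _) _)%E (\esum_(x in _) _)%E.
move=> [u| |] [v| |] //=; rewrite !lee_fin => u0 uK v0 vK.
by rewrite ler_norml; apply/andP; split; lra.
Qed.

(** The factor 4 counts real and imaginary parts, each split by sign; it is crude, but only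
    smallness is wanted. *)
Lemma l2dot_le (h g : H) (K : R) :
  (forall J, uniq J -> \sum_(x <- J) normc (h x) * normc (g x) <= K) ->
  normc (l2dot h g) <= 4 * K.
Proof.
move=> hK; rewrite /l2dot /csum; apply: le_trans (normc_le_ReIm _) _ => /=.
have hJ (F : X -> R) : (forall x, `|F x| <= normc (h x) * normc (g x)) ->
    `|rsum F| <= K + K.
  move=> hF; apply: rsum_le => J uJ; apply: le_trans (hK J uJ).
  by apply: ler_sum => x _; exact: hF.
have -> : 4 * K = (K + K) + (K + K) by ring.
apply: lerD; apply: hJ => x; rewrite -(normc_conj (g x)) -normcM.
  exact: Re_le_normc.
exact: Im_le_normc.
Qed.

Lemma l2norm_sqr_split (f g h : H) :
  (forall x, normc (h x) ^+ 2 = normc (f x) ^+ 2 + normc (g x) ^+ 2) ->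
  l2norm h ^+ 2 = l2norm f ^+ 2 + l2norm g ^+ 2.
Proof.
move=> e; rewrite !l2norm_sqr -fineD ?l2_fin//; congr fine.
rewrite /sqsum -esumD; last 2 first.
  by move=> x _; rewrite lee_fin sqr_ge0.
  by move=> x _; rewrite lee_fin sqr_ge0.
by apply: eq_esum => x _; rewrite -EFinD e.
Qed.

(** These are the entries of the block-diagonal part of T for the partition by kappa. Each block
    contributes at most D times the norm of the corresponding part of f, and these parts are
    orthogonal. *)
Lemma block_compression (Y : eqType) (kappa : X -> Y) (T : H -> H) (D : R) (f : H) :
  0 <= D -> bnd T D -> forall J, uniq J ->
  \sum_(p <- J) normc (T (proj (fun q => kappa q == kappa p) f) p) ^+ 2
    <= (D * l2norm f) ^+ 2.
Proof.
move=> D0 TD J uJ; pose S := undup [seq kappa p | p <- J].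
pose F y := proj (fun q => kappa q == y) f.
have step1 : \sum_(p <- J) normc (T (F (kappa p)) p) ^+ 2
    = \sum_(y <- S) \sum_(p <- J | kappa p == y) normc (T (F y) p) ^+ 2.
  rewrite (exchange_big_dep xpredT)//=; apply: eq_big_seq => p pJ.
  rewrite big_mkcond (bigD1_seq (kappa p)) ?undup_uniq ?mem_undup ?map_f//=.
  by rewrite eqxx big1 ?addr0// => y; rewrite eq_sym => /negbTE ->.
rewrite step1; apply: (@le_trans _ _ (\sum_(y <- S) (D * l2norm (F y)) ^+ 2)).
  apply: ler_sum => y _; rewrite -big_filter.
  apply: le_trans (sum_le_l2norm _ _) _; first exact: filter_uniq.
  by rewrite ler_pXn2r ?nnegrE ?mulr_ge0 ?l2norm_ge0//; exact: TD.
under eq_bigr do rewrite exprMn.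
rewrite -mulr_sumr exprMn ler_wpM2l ?sqr_ge0//.
have : uniq S by exact: undup_uniq.
have key (S' : seq Y) : uniq S' -> \sum_(y <- S') l2norm (F y) ^+ 2
    = l2norm (proj (fun q => kappa q \in S') f) ^+ 2.
  elim: S' => [|y S' IH] uS.
    rewrite big_nil; apply/esym/eqP; rewrite sqrf_eq0; apply/eqP.
    rewrite (_ : proj _ f = 0) ?l2norm0//; apply: l2P => q.
    by rewrite (projE (fun q => kappa q \in [::])) in_nil.
  case/andP: uS => yS uS; rewrite big_cons IH//; apply/esym/l2norm_sqr_split => q.
  rewrite (projE (fun q => kappa q \in y :: S')) (projE (fun q => kappa q \in S')).
  rewrite (projE (fun q => kappa q == y)) inE.
  have n0 : normc (0 : R[i]) ^+ 2 = 0 by rewrite normc0 expr0n.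
  by case: eqP => [->|_]; [rewrite orTb (negbTE yS)|rewrite orFb]; rewrite n0 ?addr0 ?add0r.
move=> /key ->; rewrite ler_pXn2r ?nnegrE ?l2norm_ge0//.
exact: proj_contraction.
Qed.

End WeakApproximation.

(** * Finite Cesaro means of the Fourier series *)

Section CesaroMeans.
Variables (R : realType) (G : digraph).
Local Notation H := (l2 R (dipath G)).
Variables (a : dipath G -> R[i]) (D : R).
Hypothesis D0 : 0 <= D.
Hypothesis form : forall f (J : seq (dipath G)) (g : dipath G -> R[i]), uniq J ->
  normc (\sum_(q <- J) series_fun a f q * g q)
     <= D * l2norm f * Num.sqrt (\sum_(q <- J) normc (g q) ^+ 2).
Implicit Types (p q w : dipath G) (f g : H) (E : seq (edge G)) (V : seq (vert G)).

Fixpoint words E k : seq (seq (edge G)) :=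
  if k is k'.+1 then [::] :: [seq e :: s | e <- E, s <- words E k'] else [::].

Lemma mem_words E k s : (s \in words E k) = (size s < k)%N && all (mem E) s.
Proof.
elim: k s => //= k IH [|e s]; first by rewrite inE eqxx.
rewrite inE /= ltnS; apply/allpairsP/idP => [[[e' s'] /= [eE sW [-> ->]]]|].
  by move: sW; rewrite IH eE andTb.
by case/and3P => sk eE sE; exists (e, s); split => //=; rewrite IH sk.
Qed.

Definition wordset E V k := undup [seq mkp x s | x <- V, s <- words E k].

Lemma mem_wordset E V k w : (0 < k)%N ->
  (w \in wordset E V k) = [&& ptgt w \in V, (psize w < k)%N & all (mem E) (pedges w)].
Proof.
move=> k0; rewrite mem_undup -mem_words; apply/allpairsP/andP.
  move=> [[x s] /= [xV sW ->]]; rewrite ptgt_mkp xV; split => //.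
  have [c|c] := boolP (chain x s); first by rewrite pedges_mkp.
  (* A list that is not a path gives the junk vertex, which belongs to the set anyway since k >
     0. *)
  have -> : mkp x s = vpath x by rewrite /mkp /insubd insubN.
  by rewrite pedges_vpath mem_words k0.
by move=> [wV wW]; exists (ptgt w, pedges w); split => //=; rewrite mkpK.
Qed.

(* The Cesaro mean of order [k] of the series, over the words in the edges of
   [E], cut down to the vertices of [V]. *)
Definition cesaro E V k : H -> H :=
  \sum_(w <- wordset E V k) (((k - psize w)%:R / k%:R)%:C * a w) *: Lp w.

Lemma startsP w p : starts w p -> w = ptake (psize w) p /\ pstrip w p = pdrop (psize w) p.
Proof.
move=> h; have [/prefixP[v E] /eqP t] := andP h.
have wE : w = ptake (psize w) p.
  by apply: path_ext; rewrite ?ptgt_ptake ?pedges_ptake// /psize E take_size_cat.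
split => //; apply: path_ext; last first.
  by rewrite pedges_mkp ?(route_chain (starts_route h))// pedges_pdrop.
by rewrite ptgt_mkp {1}wE psrc_ptake.
Qed.

Lemma starts_ptake i p : starts (ptake i p) p.
Proof. by rewrite /starts pedges_ptake prefix_take ptgt_ptake eqxx. Qed.

Lemma psize_ptake i p : (i <= psize p)%N -> psize (ptake i p) = i.
Proof. by move=> h; rewrite /psize pedges_ptake size_takel. Qed.

Lemma cesaroE E V k f p : (0 < k)%N -> cesaro E V k f p =
  \sum_(i < (psize p).+1)
    (if (ptgt p \in V) && all (mem E) (take i (pedges p))
     then ((k - i)%:R / k%:R)%:C else 0) * a (ptake i p) * f (pdrop i p).
Proof.
move=> k0; rewrite /cesaro op_sumE l2_sumE.
pose phi w : R[i] := (((k - psize w)%:R / k%:R)%:C * a w) * f (pdrop (psize w) p).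
transitivity (\sum_(w <- wordset E V k | starts w p) phi w).
  rewrite [RHS]big_mkcond; apply: eq_bigr => w _.
  rewrite -[LHS]/(((k - psize w)%:R / k%:R)%:C * a w * Lp w f p) LpE.
  by case: ifP => [/startsP[_ ->]|] //; rewrite mulr0.
rewrite -big_filter.
pose L := [seq i <- iota 0 (psize p).+1 | ptake i p \in wordset E V k].
have L1 i : i \in L -> (i <= psize p)%N by rewrite mem_filter mem_iota add0n ltnS => /and3P[].
transitivity (\sum_(w <- [seq ptake i p | i <- L]) phi w).
  apply: perm_big; apply: uniq_perm.
  - by rewrite filter_uniq// undup_uniq.
  - rewrite map_inj_in_uniq ?filter_uniq ?iota_uniq// => i j /L1 ip /L1 jp.
    by move=> /(congr1 (@psize G)); rewrite !psize_ptake.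
  move=> w; rewrite mem_filter; apply/andP/mapP => [[ws wW]|[i iL ->]].
    have [wE _] := startsP ws; exists (psize w) => //.
    rewrite mem_filter -wE wW mem_iota add0n ltnS /psize.
    by case/andP: ws => /size_prefix.
  by rewrite starts_ptake; move: iL; rewrite mem_filter => /andP[].
rewrite big_map big_filter big_mkcond.
rewrite -(big_mkord xpredT (fun i => (if (ptgt p \in V) && all (mem E) (take i (pedges p))
     then ((k - i)%:R / k%:R)%:C else 0) * a (ptake i p) * f (pdrop i p))).
rewrite /index_iota subn0; apply: eq_big_seq => i.
rewrite mem_iota add0n ltnS => /andP[_ ip].
rewrite mem_wordset// ptgt_ptake psize_ptake// pedges_ptake /phi psize_ptake//.
case: (ptgt p \in V) => /=; last by rewrite !mul0r.
case: (all _ _); last by rewrite andbF !mul0r.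
rewrite andbT; case: ltnP => // ki.
by move: ki; rewrite -subn_eq0 => /eqP ->; rewrite mul0r !mul0r.
Qed.

(** What remains of p after its longest initial run of edges in [E]. As a block label it restricts a
    series to words in [E]. *)
Definition pstripset E p := pdrop (find (predC (mem E)) (pedges p)) p.

Lemma pdrop_pdrop i j p : pdrop j (pdrop i p) = pdrop (i + j) p.
Proof.
have e : pedges (pdrop j (pdrop i p)) = pedges (pdrop (i + j) p).
  by rewrite !pedges_pdrop drop_drop addnC.
apply: path_ext => //.
have h1 := route_path (pdrop j (pdrop i p)); have h2 := route_path (pdrop (i + j) p).
by rewrite (route_target h1) (route_target h2) e !psrc_pdrop.
Qed.

(** If an edge outside [E] is dropped, the remainder of p starts before position i and is strictly
    longer than that of [pdrop i p]. *)
Lemma pstripset_pdrop E i p : (i <= psize p)%N ->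
  (pstripset E (pdrop i p) == pstripset E p) = all (mem E) (take i (pedges p)).
Proof.
move=> ip; rewrite /pstripset pdrop_pdrop pedges_pdrop.
have pE := cat_take_drop i (pedges p); have st : size (take i (pedges p)) = i.
  by rewrite size_takel.
have -> : find (predC (mem E)) (pedges p) =
    if all (mem E) (take i (pedges p)) then (i + find (predC (mem E)) (drop i (pedges p)))%N
    else find (predC (mem E)) (take i (pedges p)).
  by rewrite -{1}pE find_cat has_predC st; case: all.
case: ifPn => [_|h]; first by rewrite eqxx.
apply/negP => /eqP /(congr1 (@psize G)); rewrite !psize_pdrop.
have : (find (predC (mem E)) (take i (pedges p)) < i)%N.
  by rewrite -{2}st -has_find has_predC.
set u := find _ _; set v := find _ _ => ui.
move=> E'; have : (psize p - (i + v) <= psize p - i)%N by rewrite leq_sub2l// leq_addr.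
by rewrite E' leqNgt ltn_sub2l// (leq_trans ui).
Qed.

Lemma sum_indicator_lt (k m : nat) : (m <= k)%N ->
  \sum_(i < k) ((i < m)%N%:R : R[i]) = m%:R.
Proof.
elim: k m => [|k IH] m; first by rewrite leqn0 big_ord0 => /eqP ->.
rewrite leq_eqVlt => /predU1P[->|mk].
  under eq_bigr do rewrite ltn_ord.
  by rewrite sumr_const card_ord.
by rewrite big_ord_recr /= IH// ltnNge -ltnS mk addr0.
Qed.

(** By periodicity in j one may take m = 0; then j and j + l lie in one block of length k exactly
    for j < k - l. *)
Lemma block_count k m l : (0 < k)%N ->
  \sum_(j < k) (((m + j) %/ k == (m + j + l) %/ k)%N%:R : R[i]) = (k - l)%N%:R.
Proof.
move=> k0.
rewrite (@periodic_sum_shift _ (fun i => ((i %/ k == (i + l) %/ k)%N%:R : R[i]))).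
  rewrite -(@sum_indicator_lt k (k - l)) ?leq_subr//; apply: eq_bigr => i _.
  rewrite divn_small// eq_sym; congr (_%:R : R[i]); congr nat_of_bool.
  rewrite -leqn0 leqNgt divn_gt0// -ltnNge.
  by rewrite ltn_subRL addnC.
have sk m' : ((m' + k) %/ k = (m' %/ k).+1)%N by rewrite divnDr// divnn k0 addn1.
by move=> i; rewrite addnAC !sk eqSS.
Qed.

(** The mean is an average over shifts j < k of block-diagonal parts of T. A path and its right
    factor after i edges lie in one block for k - i shifts if the dropped edges are in [E], and for
    none otherwise, which produces the Cesaro weights. *)
Lemma cesaro_bnd E V k : (0 < k)%N -> bnd (cesaro E V k) D.
Proof.
move=> k0 f; have lT := Top_linear D0 form; have TD := Top_bnd D0 form.
pose kappa j p := (pstripset E p, ((psize p + j) %/ k)%N).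
pose h j p := Top a (proj (fun q => kappa j q == kappa j p) f) p.
have hB j : (toL2 (h j) =1 h j) /\ l2norm (toL2 (h j)) <= D * l2norm f.
  apply: toL2_le; first by rewrite mulr_ge0 ?l2norm_ge0.
  exact: block_compression.
pose B j := proj (fun p => ptgt p \in V) (toL2 (h j)).
have kp : 0 < k%:R :> R by rewrite ltr0n.
have -> : cesaro E V k f = \sum_(j < k) (k%:R^-1)%:C *: B j.
  apply: l2P => p; rewrite cesaroE// l2_sumE.
  transitivity (\sum_(j < k) (k%:R^-1)%:C * (if ptgt p \in V then h j p else 0)); last first.
    apply: eq_bigr => j _; rewrite l2ZE (projE (fun p => ptgt p \in V)).
    by have [-> _] := hB j.
  case: (ptgt p \in V) => /=; last first.
    by rewrite !big1// => i _; rewrite ?mul0r ?mulr0.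
  transitivity (\sum_(j < k) \sum_(i < (psize p).+1) (k%:R^-1)%:C *
     (a (ptake i p) * f (pdrop i p) * (kappa j (pdrop i p) == kappa j p)%:R)); last first.
    apply: eq_bigr => j _; rewrite -mulr_sumr; congr (_ * _).
    rewrite /h (TopE D0 form) /series_fun; apply: eq_bigr => i _.
    rewrite (projE (fun q => kappa j q == kappa j p)) -mulrA.
    by case: (_ == _); rewrite ?mulr1 ?mulr0.
  rewrite exchange_big /=; apply: eq_bigr => i _.
  have ip : (i <= psize p)%N by rewrite -ltnS.
  rewrite -mulr_sumr -mulr_sumr.
  have -> : \sum_(j < k) ((kappa j (pdrop i p) == kappa j p)%:R : R[i])
      = if all (mem E) (take i (pedges p)) then (k - i)%N%:R else 0.
    rewrite -(pstripset_pdrop E ip).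
    transitivity (\sum_(j < k) (if pstripset E (pdrop i p) == pstripset E p then
       (((psize p - i + j) %/ k == (psize p - i + j + i) %/ k)%N%:R : R[i]) else 0)).
      apply: eq_bigr => j _; rewrite /kappa xpair_eqE psize_pdrop.
      by rewrite addnAC subnK//; case: (_ == pstripset _ _).
    case: eqP => _; first exact: block_count.
    by rewrite big1.
  case: all; last by rewrite !mulr0 !mul0r.
  by rewrite mulrC mulrA rmorphM /= rmorph_nat; ring.
apply: le_trans (l2norm_sum _ _) _.
apply: (@le_trans _ _ (\sum_(j < k) k%:R^-1 * (D * l2norm f))).
  apply: ler_sum => j _; apply: le_trans (l2normZ _ _) _.
  have e1 : 0 <= (k%:R^-1 : R) by rewrite invr_ge0 ltW.
  rewrite normc_real (ger0_norm e1) ler_wpM2l//.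
  by apply: le_trans (proj_contraction _ _) _; have [] := hB j.
by rewrite -mulr_suml sumr_const card_ord -[X in X * _]mulr_natr mulVf ?mul1r// gt_eqF.
Qed.

Lemma cesaro_mem (M : set (H -> H)) E V k :
  subalgebra M -> @generators R G `<=` M -> M (cesaro E V k).
Proof.
move=> sM gM; rewrite /cesaro; apply: subalgebra_sum => // w _.
exact: subalgebra_Lp.
Qed.

Lemma cesaro_weak f g (e : R) : 0 < e ->
  exists (J : seq (dipath G)) (k0 : nat), forall E V k,
    (forall p, p \in J -> ptgt p \in V /\ all (mem E) (pedges p)) ->
    (k0 < k)%N -> normc (l2dot ((Top a - cesaro E V k) f) g) < e.
Proof.
(* [C] bounds the error vector, both operators having bound D; the 1 keeps it positive. Off [J] the
   pairing is at most C * (e / (16 * C)), on [J] at most e / 16, and [l2dot_le] turns the total into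
   e / 2. *)
move=> e0; pose C := 2 * D * l2norm f + 1.
have C0 : 0 < C by rewrite ltr_pwDr// !mulr_ge0 ?l2norm_ge0.
have eC : 0 < e / (16 * C) by rewrite divr_gt0// mulr_gt0.
have [J uJ tail] := l2_tail g eC.
pose c p := \sum_(i < (psize p).+1) normc (a (ptake i p)) * normc (f (pdrop i p)).
have c0 p : 0 <= c p by apply: sumr_ge0 => i _; rewrite mulr_ge0 ?normc_ge0.
pose S := \sum_(p <- J) (psize p)%:R * c p * normc (g p).
have S0 : 0 <= S.
  by apply: sumr_ge0 => p _; rewrite mulr_ge0 ?normc_ge0// mulr_ge0 ?ler0n.
(* On [J] the weights miss 1 by i / k <= psize p / k, so k > 16 * S / e suffices there; k also
   exceeds the lengths in [J], so that k - i is not truncated. *)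
exists J, (Num.truncn (16 * S / e) + \max_(p <- J) psize p)%N => E V k hJ hk.
have k0 : (0 < k)%N by exact: leq_ltn_trans hk.
have kp : 0 < k%:R :> R by rewrite ltr0n.
have kS : 16 * S / e < k%:R.
  apply: lt_le_trans (truncnS_gt _) _; rewrite ler_nat.
  by apply: leq_trans hk; rewrite ltnS leq_addr.
pose h := (Top a - cesaro E V k) f.
have nh : l2norm h <= C.
  have -> : C = (D + D) * l2norm f + 1 by rewrite /C; ring.
  apply: le_trans (bndB (Top_bnd D0 form) (cesaro_bnd E V k0) f) _.
  by rewrite lerDl.
have hp p : p \in J -> normc (h p) <= (psize p)%:R * c p / k%:R.
  move=> pJ; have [pV pE] := hJ p pJ.
  have pk : (psize p < k)%N.
    apply: leq_ltn_trans hk; apply: leq_trans (leq_addl _ _).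
    exact: (leq_bigmax_seq _ pJ).
  rewrite /h opBE l2BE (TopE D0 form) cesaroE// /series_fun -sumrB.
  apply: le_trans (ler_normc_sum _ _) _.
  rewrite /c mulr_sumr mulr_suml; apply: ler_sum => i _.
  have ip : (i <= psize p)%N by rewrite -ltnS.
  have tE : all (mem E) (take i (pedges p)).
    by apply/allP => e' /mem_take; exact: (allP pE).
  rewrite pV tE /=.
  have -> : a (ptake i p) * f (pdrop i p)
      - ((k - i)%:R / k%:R)%:C * a (ptake i p) * f (pdrop i p)
      = (i%:R / k%:R)%:C * (a (ptake i p) * f (pdrop i p)).
    have -> : (i%:R / k%:R)%:C = 1 - ((k - i)%:R / k%:R)%:C :> R[i].
      rewrite -(rmorph1 (real_complex R)) -rmorphB; congr (_%:C).
      rewrite natrB; last by rewrite (leq_trans ip)// ltnW.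
      by rewrite mulrBl mulfV ?gt_eqF// opprB addrC subrK.
    by ring.
  have ik : 0 <= i%:R / k%:R :> R by rewrite divr_ge0 ?ler0n.
  rewrite !normcM normc_real (ger0_norm ik) mulrAC ler_wpM2r ?mulr_ge0 ?normc_ge0//.
  by rewrite ler_wpM2r ?mulr_ge0 ?normc_ge0// ler_nat.
apply: le_lt_trans (@l2dot_le _ _ h g (e / 8) _) _; last first.
  have -> : 4 * (e / 8) = e / 2 by lra.
  by rewrite ltr_pdivrMr// mulr_natr mulr2n ltrDl.
move=> J' uJ'; rewrite (bigID (fun p => p \in J)) /=.
have -> : e / 8 = e / 16 + e / 16 by lra.
apply: lerD.
  apply: (@le_trans _ _ (\sum_(p <- J' | p \in J) (psize p)%:R * c p * normc (g p) / k%:R)).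
    apply: ler_sum => p pJ; rewrite mulrAC ler_wpM2r ?normc_ge0//.
    exact: hp.
  rewrite -mulr_suml; apply: (@le_trans _ _ (S / k%:R)).
    rewrite ler_wpM2r ?invr_ge0 ?ler0n// -big_filter /S.
    have uF : uniq [seq p <- J' | p \in J] by exact: filter_uniq.
    have -> : \sum_(p <- [seq p <- J' | p \in J]) (psize p)%:R * c p * normc (g p)
       = \sum_(p <- [seq p <- J | p \in J']) (psize p)%:R * c p * normc (g p).
      apply: perm_big; apply: uniq_perm; rewrite ?filter_uniq// => p.
      by rewrite !mem_filter andbC.
    rewrite big_filter big_mkcond; apply: ler_sum => p _; case: ifP => // _.
    by rewrite mulr_ge0 ?normc_ge0// mulr_ge0 ?ler0n.
  rewrite ler_pdivrMr//; move: kS; rewrite ltr_pdivrMr// => /ltW; lra.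
rewrite -big_filter; have -> : e / 16 = C * (e / (16 * C)).
  by field; rewrite gt_eqF.
apply: CauchySchwarz_le.
- exact: ltW.
- exact: ltW.
- apply: le_trans (sum_le_l2norm h _) _; first exact: filter_uniq.
  by rewrite ler_pXn2r ?nnegrE ?l2norm_ge0// ltW.
- apply: tail; first exact: filter_uniq.
  by move=> p pJ; rewrite mem_filter pJ.
Qed.

(** A weak neighbourhood tests finitely many pairs of vectors, so one finite set of edges, one of
    vertices and one order k serve them all. *)
Lemma Top_semigroupoid : free_semigroupoid_algebra R G (Top a).
Proof.
move=> M [[sM wM] gM]; apply: wM.
  exact: bnd_bounded (Top_linear D0 form) (Top_bnd D0 form).
move=> n f g e e0.
have [JJ hJJ] := choice (fun i : 'I_n => cesaro_weak (f i) (g i) e0).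
have [kk hkk] := choice hJJ.
pose J := flatten [seq JJ i | i <- enum 'I_n].
pose E := flatten [seq pedges p | p <- J]; pose V := [seq ptgt p | p <- J].
pose k := (\max_(i < n) kk i).+1.
exists (cesaro E V k); first exact: cesaro_mem.
move=> i; apply: hkk; last by rewrite ltnS leq_bigmax.
move=> p pJ; have pJ' : p \in J.
  by apply/flatten_mapP; exists i => //; rewrite mem_enum.
split; first exact: map_f.
by apply/allP => e' ee'; apply/flatten_mapP; exists p.
Qed.

End CesaroMeans.

Lemma component_route (G : digraph) (x y : vert G) s : route x s y ->
  undirected_component x y.
Proof.
elim: s x => [|e s IH] x; first by rewrite route_nil => /eqP ->; exact: rst_refl.
rewrite route_cons => /andP[/eqP <- /IH sy]; apply: rst_trans sy.
by apply/rst_sym/rst_step; exists e.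
Qed.

Lemma route_back (G : digraph) :
  (forall x : vert G, strongly_connected (undirected_component x)) ->
  forall (x y : vert G) s, route x s y -> exists t, route y t x.
Proof.
move=> hG x y s xy; have [p [px py]] := hG x x y (rst_refl _ _ _) (component_route xy).
by exists (pedges p); rewrite -px -py; exact: route_path.
Qed.

(** Continuity makes the extended norm finite; keeping its exact value as D is what gives |T| <= |d|
    with constant 1. *)
Lemma map_norm_bnd (R : realType) (G : digraph)
  (d : (l2 R (dipath G) -> l2 R (dipath G)) -> (l2 R (dipath G) -> l2 R (dipath G))) :
  derivation (tensor_algebra R G) d -> der_bounded_by d id ->
  exists D, [/\ 0 <= D, D%:E = map_norm (tensor_algebra R G) d &
    forall A, tensor_algebra R G A -> bnd A 1 -> bnd (d A) D].
Proof.
move=> hd [K K0 dK]; pose N := map_norm (tensor_algebra R G) d.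
have N0 : (0 <= N)%E.
  apply: (@le_trans _ _ (opnorm (d 0))); first exact: opnorm_ge0.
  apply: ereal_sup_ubound; exists 0 => //; split; first exact: ta0.
  by apply: opnorm_le => //; exact: bnd_le ler01 (@bnd0 R _).
have NK : (N <= K%:E)%E.
  apply: ge_ereal_sup => _ [A [TA A1] <-]; apply: opnorm_le => //.
  rewrite -[K]mulr1; apply: dK => //.
  by apply: opnorm_bnd => //; exact: ta_lin.
have NE : (fine N)%:E = N by rewrite fineK// ge0_fin_numE//; apply: le_lt_trans NK (ltry _).
exists (fine N); split => //; first exact: fine_ge0.
move=> A TA A1; apply: opnorm_bnd; first by apply: ta_lin; exact: der_ta.
rewrite NE; apply: ereal_sup_ubound; exists A => //; split => //.
exact: opnorm_le.
Qed.

Theorem corollary5p6 (R : realType) (G : digraph)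
  (hG : forall x : vert G, strongly_connected (undirected_component x))
  (delta : (l2 R (dipath G) -> l2 R (dipath G)) ->
           (l2 R (dipath G) -> l2 R (dipath G)))
  (hdelta : derivation (tensor_algebra R G) delta) :
  exists T : l2 R (dipath G) -> l2 R (dipath G),
    [/\ free_semigroupoid_algebra R G T,
        forall A, tensor_algebra R G A -> delta A = inner_derivation T A &
        (opnorm T <= map_norm (tensor_algebra R G) delta)%E].
Proof.
have back := route_back hG; have bd := derivation_bounded hdelta back.
(* [D] is the norm of the derivation and enters the final inequality; [K] is a homogeneous bound,
   used to pass to norm limits. *)
have [D [D0 DE dD]] := map_norm_bnd hdelta bd; have [K K0 dK] := bd.
have [a [aP aN]] := formal_derivation_inner (pcoef_derivation hdelta)
  (pcoef_bounded D0 dD) back.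
have form := symbol_form hdelta D0 dD aP aN.
exists (Top (symbol delta a)); split; first exact: Top_semigroupoid D0 form.
  move=> A; apply: (derivation_inner hdelta K0 dK _ D0).
  - exact: Top_left_op D0 form.
  - exact: Top_bnd D0 form.
  - by move=> p w; rewrite !(coef_Top D0 form); exact: coef_der_symbol.
by rewrite -DE; apply: opnorm_le => //; exact: Top_bnd D0 form.
Qed.
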